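(* Let $S \subset \mathbb{P}^3$ be an irreducible smooth surface of degree at least $4$ which does not contain any lines. Then $\operatorname{Sing}\bigl(\operatorname{CH}_1(S)\bigr) = \operatorname{Bit}(S) \cup \operatorname{Infl}(S)$.
   Context: Everything is over $\mathbb{C}$. $\operatorname{Gr}(1,\mathbb{P}^3)$ is the Grassmannian of lines in $\mathbb{P}^3$; $T_x(S)$ is the embedded projective tangent plane of $S$ at a smooth point $x$; $\operatorname{Sing}(\cdot)$ denotes the singular locus. For a surface $S \subset \mathbb{P}^3$: the Hurwitz hypersurface $\operatorname{CH}_1(S)$ is the Zariski closure in $\operatorname{Gr}(1,\mathbb{P}^3)$ of the set of lines that are tangent to $S$ at a smooth point; $\operatorname{Bit}(S)$ is the Zariski closure of the set of lines $L$ such that $x,y \in L \subset T_x(S)\cap T_y(S)$ for two distinct smooth points $x,y \in S$; $\operatorname{Infl}(S)$ is the Zariski closure of the set of lines that intersect $S$ at some smooth point with multiplicity at least $3$. *)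

(* Defs.v *)
From HB Require Import structures.
From mathcomp Require Import all_boot all_order all_algebra.
From mathcomp Require Import complex.
From mathcomp Require Import mpoly.
From mathcomp Require Import boolp classical_sets reals.
Set Implicit Arguments.
Unset Strict Implicit.
Unset Printing Implicit Defensive.
Import GRing.Theory.
Local Open Scope classical_set_scope.
Local Open Scope ring_scope.

(* Projective k-planes in P^n(K), as (k+1)-dimensional subspaces of K^(n+1). *)
Definition plane (K : fieldType) (k n : nat) : Type :=
  {U : {vspace 'rV[K]_n.+1} | \dim U == k.+1}.

Definition proj (K : fieldType) (n : nat) : Type := plane K 0 n.

(* Gr(1, P^3) *)
Definition grass_line (K : fieldType) : Type := plane K 1 3.

Section Projective.
Variables (K : fieldType) (n : nat).
Implicit Types (X Z : set (proj K n)) (x y : proj K n) (F G : {mpoly K[n.+1]}).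

(* A choice of homogeneous coordinates: vpick selects a nonzero vector. Every
   use below is invariant under rescaling. *)
Definition hcoord x : 'I_n.+1 -> K := fun i => vpick (val x) 0 i.

Definition points (U : {vspace 'rV[K]_n.+1}) : set (proj K n) :=
  [set x | (val x <= U)%VS].

Definition form F : Prop := exists d : nat, F \is d.-homog.

Definition zero_locus (I : set {mpoly K[n.+1]}) : set (proj K n) :=
  [set x | forall F, I F -> F.@[hcoord x] = 0].

(* The forms vanishing on X, i.e. the homogeneous elements of the ideal I(X). *)
Definition vanishing_forms X : set {mpoly K[n.+1]} :=
  [set F | form F /\ forall x, X x -> F.@[hcoord x] = 0].

Definition zariski_closed X : Prop :=
  exists2 I : set {mpoly K[n.+1]}, I `<=` form & X = zero_locus I.

Definition zariski_closure X : set (proj K n) :=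
  [set x | forall Z, zariski_closed Z -> X `<=` Z -> Z x].

Definition zariski_irreducible X : Prop :=
  X !=set0 /\
  forall Z1 Z2, zariski_closed Z1 -> zariski_closed Z2 ->
    X `<=` Z1 `|` Z2 -> X `<=` Z1 \/ X `<=` Z2.

(* For irreducible Z: the function field K(Z) contains m elements F_i / G
   (quotients of forms of equal degree, over a common denominator G which does
   not vanish identically on Z) that are algebraically independent over K. *)
Definition trdeg_ge Z (m : nat) : Prop :=
  exists (e : nat) (F : 'I_m -> {mpoly K[n.+1]}) (G : {mpoly K[n.+1]}),
    [/\ forall i, F i \is e.-homog,
        G \is e.-homog,
        exists2 z, Z z & G.@[hcoord z] != 0 &
        forall P : {mpoly K[m]},
          (forall z, Z z -> G.@[hcoord z] != 0 ->
             P.@[fun i => (F i).@[hcoord z] / G.@[hcoord z]] = 0) ->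
          P = 0].

(* Dimension of an irreducible Z, as the transcendence degree of K(Z). *)
Definition irr_dim Z (m : nat) : Prop := trdeg_ge Z m /\ ~ trdeg_ge Z m.+1.

(* Local dimension of a closed X at x: the largest dimension of an irreducible
   closed subset of X through x. *)
Definition local_dim X x (m : nat) : Prop :=
  (exists Z, [/\ zariski_closed Z, zariski_irreducible Z, Z `<=` X, Z x
               & irr_dim Z m]) /\
  (forall Z k, zariski_closed Z -> zariski_irreducible Z -> Z `<=` X -> Z x ->
     irr_dim Z k -> (k <= m)%N).

(* The embedded projective tangent space T_x(X). *)
Definition tangent_space X x : set (proj K n) :=
  [set y | forall F, vanishing_forms X F ->
     \sum_(i < n.+1) F^`M(i).@[hcoord x] * hcoord y i = 0].

(* dim T_x(X) = dim_x X, the (projective) dimension of T_x(X) being that of the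
   Zariski tangent space of X at x. *)
Definition smooth_at X x : Prop :=
  X x /\
  exists (m : nat) (U : {vspace 'rV[K]_n.+1}),
    [/\ local_dim X x m, tangent_space X x = points U & \dim U = m.+1].

Definition Sing X : set (proj K n) := [set x | X x /\ ~ smooth_at X x].

(* L meets X at x with multiplicity at least k: every form in I(X), restricted
   to L, vanishes to order at least k at x. The restriction is computed along
   t |-> p + t q, where p represents x and q ranges over L. *)
Definition meets_with_mult (L : plane K 1 n) X x (k : nat) : Prop :=
  [/\ X x, points (val L) x &
      forall F (q : 'rV[K]_n.+1), vanishing_forms X F -> q \in val L ->
        ('X^k %| mmap (@polyC K) (fun i => (hcoord x i)%:P + (q 0 i) *: 'X) F)%R].

End Projective.

Section Surface.
Variable K : fieldType.
Implicit Type S : set (proj K 3).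

Definition irreducible_surface S : Prop :=
  [/\ zariski_closed S, zariski_irreducible S & irr_dim S 2].

(* The degree of a surface in P^3 is the degree of the generator of its
   homogeneous ideal. *)
Definition surface_degree S (d : nat) : Prop :=
  exists f : {mpoly K[4]},
    [/\ f != 0, f \is d.-homog &
        forall F, form F -> (vanishing_forms S F <-> exists G, F = G * f)].

Definition smooth_surface S : Prop := Sing S = set0.

End Surface.

Section Pluecker.
Variable K : fieldType.
Implicit Type L : grass_line K.

Definition pluecker_pairs : seq ('I_4 * 'I_4) :=
  [seq (inord p.1, inord p.2)
  | p <- [:: (0, 1); (0, 2); (0, 3); (1, 2); (1, 3); (2, 3)]%N].

(* The 2x2 minors p_ij = u_i v_j - u_j v_i, i < j, for a basis (u, v) of L. *)
Definition pluecker_vec L : 'rV[K]_6 :=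
  let u := (vbasis (val L))`_0 in
  let v := (vbasis (val L))`_1 in
  \row_(k < 6) let ij := nth (ord0, ord0) pluecker_pairs k in
    (u 0 ij.1 * v 0 ij.2 - u 0 ij.2 * v 0 ij.1).

Lemma pluecker_vec_neq0 L : pluecker_vec L != 0.
Proof.
case: L => U dimU; rewrite /pluecker_vec /=.
have szU : size (vbasis U) = 2 by rewrite size_tuple (eqP dimU).
have := basis_free (vbasisP U).
case: (tval (vbasis U)) szU => [|u [|v []]] //= _.
rewrite free_cons span_seq1 free_cons nil_free andbT span_nil memv0.
case/andP=> uNv v_neq0; apply/eqP => /rowP w0.
have {}w0 (i j : 'I_4) : (i < j)%N -> u 0 i * v 0 j = u 0 j * v 0 i.
  move=> lt_ij; have ij_in : (i, j) \in pluecker_pairs.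
    apply/mapP; exists (i : nat, j : nat); last by rewrite /= !inord_val.
    by case: i j lt_ij => [[|[|[|[]]]] //= ?] [[|[|[|[]]]] //= ?].
  have k_lt : (index (i, j) pluecker_pairs < 6)%N by rewrite index_mem.
  have := w0 (Ordinal k_lt).
  by rewrite !mxE nth_index //= => /eqP; rewrite subr_eq0 => /eqP.
have {}w0 (i j : 'I_4) : u 0 i * v 0 j = u 0 j * v 0 i.
  have [/w0 //|/w0 ->//|/val_inj-> //] := ltngtP i j.
have [i vi_neq0] : exists i, v 0 i != 0.
  by apply/rV0Pn.
case/vlineP: uNv; exists (u 0 i / v 0 i).
apply/rowP => j; rewrite mxE mulrAC w0 mulfK //.
Qed.

Lemma pluecker_subproof L : \dim <[pluecker_vec L]>%VS == 1%N.
Proof. by rewrite dim_vline pluecker_vec_neq0. Qed.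

(* The Pluecker embedding Gr(1, P^3) -> P^5. *)
Definition pluecker L : proj K 5 :=
  exist (fun U : {vspace 'rV[K]_6} => \dim U == 1%N) _ (pluecker_subproof L).

(* Closure and singular locus of subsets of Gr(1, P^3), seen in P^5. The
   Grassmannian is closed in P^5, so closures do not leave it. *)
Definition grass_closure (A : set (grass_line K)) : set (grass_line K) :=
  pluecker @^-1` zariski_closure (pluecker @` A).

Definition grass_Sing (A : set (grass_line K)) : set (grass_line K) :=
  pluecker @^-1` Sing (pluecker @` A).

End Pluecker.

Section LineCongruences.
Variable K : fieldType.
Implicit Type S : set (proj K 3).

Definition contains_no_line S : Prop :=
  forall L : grass_line K, ~ (points (val L) `<=` S).

Definition tangent_at S (L : grass_line K) (x : proj K 3) : Prop :=
  [/\ smooth_at S x, points (val L) x & points (val L) `<=` tangent_space S x].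

Definition CH1 S : set (grass_line K) :=
  grass_closure [set L | exists x, tangent_at S L x].

Definition Bit S : set (grass_line K) :=
  grass_closure [set L | exists x y,
    [/\ x <> y, tangent_at S L x & tangent_at S L y]].

Definition Infl S : set (grass_line K) :=
  grass_closure [set L | exists2 x, smooth_at S x & meets_with_mult L S x 3].

End LineCongruences.

(* Main.v *)
(* Let f be an equation of S. For vectors v and w, the line spanned by x and by
   (w.grad f(x)) v - (v.grad f(x)) w is tangent to S at x, so a form F on P^5 vanishing
   on CH_1(S) becomes divisible by f after this substitution. Expanding the identity
   along x + t v and x + t z shows that the tangent space of CH_1(S) at a tangent line
   L = x /\ v contains x /\ K^4 and v /\ T_x, and that it contains all of L /\ K^4 as
   soon as L is inflectional at x or tangent at a second point. The latter space has
   dimension 5, and containing it is a closed condition, while CH_1(S) is irreducible of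
   dimension 3: hence CH_1(S) is singular along Bit(S) and Infl(S).

   Conversely, if L has a single point of tangency, which is simple, then the
   discriminant of f restricted to a line, written as a Sylvester determinant in the
   Pluecker coordinates, has a nonzero differential on L /\ K^4. The tangent space is
   then cut out by two independent equations, so its dimension is 4.

   The dimension is at least 3 because the partial derivatives of a homogeneous relation
   between four suitable Pluecker coordinates again vanish on CH_1(S), and at most 3 by
   counting monomials on a parametrization by S x A^1. *)
Require Import Defs.
From HB Require Import structures.
From mathcomp Require Import all_boot all_order all_algebra.
From mathcomp Require Import complex.
From mathcomp Require Import mpoly.
From mathcomp Require Import boolp classical_sets reals.
From mathcomp Require Import ring zify.
Set Implicit Arguments.
Unset Strict Implicit.
Unset Printing Implicit Defensive.
Import Order.TTheory GRing.Theory Num.Theory.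
Local Open Scope classical_set_scope.
Local Open Scope ring_scope.
(* all_algebra also exports a notion of (sesquilinear) form. *)
Local Notation form := (@Defs.form _ _).

(** * Substitution in multivariate polynomials *)

(** No generators of the ideal of CH_1(S) are at hand, while [tangent_space] refers to every form
    vanishing there. Hence tangent spaces are bounded from below by a computation with an arbitrary
    vanishing form, and from above by two explicit ones, the Pfaffian and the discriminant. The
    computation rests on the fact that a form on P^3 vanishing on S is a multiple of f; therefore v
    and w are constant and the tangent vector is a polynomial in the point, at the price of a factor
    w.grad f(x) and of members that degenerate to zero.

    The absence of lines in S enters twice. It makes f nonzero on each line, so that contact orders
    are finite; and it gives each line a point v off S, so that f(u + t v) has exact degree d in t
    and a vanishing discriminant means a double root, not a drop of the degree. Consequently the
    closure defining CH_1(S) adds no lines, and the converse may start from an actual point of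
    tangency. Bit(S) and Infl(S) may contain limit lines, for which only the closed condition on L
    /\ K^4 is at hand. *)

Lemma mpoly_ring_ind n (R : comNzRingType) (P : {mpoly R[n]} -> Prop) :
  (forall c, P c%:MP) -> (forall i, P 'X_i) ->
  (forall p q, P p -> P q -> P (p + q)) ->
  (forall p q, P p -> P q -> P (p * q)) -> forall p, P p.
Proof.
move=> PC PX PD PM; elim/mpolyind=> [|c m p _ _ Pp].
  by rewrite -mpolyC0; apply: PC.
apply: PD => //; rewrite -mul_mpolyC; apply/PM => //.
rewrite mpolyXE_id; apply: (big_ind P); [by rewrite -mpolyC1 | exact: PM | move=> i _].
elim: (m i) => [|k IH]; first by rewrite expr0 -mpolyC1.
by rewrite exprS; apply/PM.
Qed.

Lemma mderivXU n (R : comNzRingType) (i j : 'I_n) :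
  ('X_i)^`M(j) = (i == j)%:R :> {mpoly R[n]}.
Proof.
rewrite mderivX mnm1E; case: eqP => [->|_]; last by rewrite scale0r.
by rewrite scale1r -mpolyX0; congr 'X_[_]; apply/mnmP => k; rewrite mnmBE mnm0E subnn.
Qed.

Lemma mmapXU n (R A : comNzRingType) (h : {rmorphism R -> A}) (Y : 'I_n -> A) i :
  mmap h Y 'X_i = Y i.
Proof. by rewrite mmapX mmap1U. Qed.

Lemma mmap_rmorph n (R A B : comNzRingType) (h : {rmorphism R -> A})
    (k : {rmorphism A -> B}) (h' : {rmorphism R -> B}) (Y : 'I_n -> A) (F : {mpoly R[n]}) :
  k \o h =1 h' -> k (mmap h Y F) = mmap h' (k \o Y) F.
Proof.
move=> hE; elim/mpoly_ring_ind: F => [c|i|p q IHp IHq|p q IHp IHq].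
- by rewrite !mmapC; apply: hE.
- by rewrite !mmapXU.
- by rewrite !rmorphD /= IHp IHq.
- by rewrite !rmorphM /= IHp IHq.
Qed.

Lemma mmap_eq_fun n (R A : comNzRingType) (h h' : R -> A) (Y : 'I_n -> A)
    (F : {mpoly R[n]}) : h =1 h' -> mmap h Y F = mmap h' Y F.
Proof. by move=> /funext ->. Qed.

Section Substitution.
Variables (R A : comNzRingType) (h : {rmorphism R -> A}).

Lemma mmap_ext n (Y Y' : 'I_n -> A) (F : {mpoly R[n]}) :
  Y =1 Y' -> mmap h Y F = mmap h Y' F.
Proof. by move=> /funext ->. Qed.

Lemma mmap_mmap n k (X : 'I_k -> A) (Y : 'I_n -> {mpoly R[k]})
    (F : {mpoly R[n]}) :
  mmap h X (mmap (@mpolyC k R) Y F) = mmap h (fun i => mmap h X (Y i)) F.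
Proof. by apply: mmap_rmorph => c /=; rewrite mmapC. Qed.

Lemma mmap_homogZ n e (F : {mpoly R[n]}) (c : A) (a : 'I_n -> A) :
  F \is e.-homog -> mmap h (fun i => c * a i) F = c ^+ e * mmap h a F.
Proof.
move=> /dhomogP Fe; rewrite /mmap mulr_sumr big_seq [RHS]big_seq.
apply: eq_bigr => m /Fe /= <-; rewrite /mmap1 mdegE -prodrXr mulrCA; congr (_ * _).
by rewrite -big_split /=; apply: eq_bigr => i _; rewrite exprMn.
Qed.

(** In the applications [s] is a power of the parameter of a curve; of the remainder only its
    divisibility by [s ^+ 2] matters, so [c] stays existential. *)
Lemma mmap_taylor n (F : {mpoly R[n]}) (a b : 'I_n -> A) (s : A) :
  exists c, mmap h (fun i => a i + s * b i) F =
    mmap h a F + s * (\sum_i mmap h a F^`M(i) * b i) + s ^+ 2 * c.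
Proof.
elim/mpoly_ring_ind: F => [c|i|p q [c IHp] [c' IHq]|p q [c IHp] [c' IHq]].
- exists 0; rewrite !mmapC big1 ?mulr0 ?addr0 // => i _.
  by rewrite mderivC mmap0 mul0r.
- exists 0; rewrite !mmapXU (bigD1 i) //= big1 ?addr0 => [|j ji].
    by rewrite mulr0 addr0 mderivXU eqxx rmorph1 mul1r.
  by rewrite mderivXU eq_sym (negPf ji) mmap0 mul0r.
- exists (c + c'); rewrite !mmapD IHp IHq.
  under [in RHS]eq_bigr => i _ do rewrite mderivD mmapD mulrDl.
  rewrite big_split /=; ring.
- pose Sp := \sum_i mmap h a p^`M(i) * b i; pose Sq := \sum_i mmap h a q^`M(i) * b i.
  exists (mmap h a p * c' + c * mmap h a q + Sp * Sq + s * (Sp * c' + c * Sq)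
          + s ^+ 2 * (c * c')).
  rewrite !rmorphM /= IHp IHq -/Sp -/Sq.
  have -> : \sum_i mmap h a (p * q)^`M(i) * b i =
      mmap h a q * Sp + mmap h a p * Sq.
    rewrite !mulr_sumr -big_split /=; apply: eq_bigr => i _.
    by rewrite mderivM rmorphD !rmorphM /=; ring.
  ring.
Qed.

End Substitution.

Lemma mderivX_mulX n (R : comNzRingType) (m : 'X_{1..n}) i :
  'X_[m]^`M(i) * 'X_i = (m i)%:R *: 'X_[m] :> {mpoly R[n]}.
Proof.
rewrite mderivX -scalerAl -mpolyXD.
have [->|m0] := eqVneq (m i) 0; first by rewrite !scale0r.
rewrite addmC addmBA; first by rewrite addmC addmK.
by apply/mnm_lepP => j; rewrite mnm1E; case: eqP => // <-; rewrite lt0n.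
Qed.

Lemma mpoly_euler n (R : comNzRingType) e (F : {mpoly R[n]}) :
  F \is e.-homog -> \sum_i F^`M(i) * 'X_i = e%:R *: F.
Proof.
move=> /dhomogP Fe; rewrite {2}(mpolyE F) scaler_sumr.
under eq_bigr => i _ do
  rewrite {1}(mpolyE F) linear_sum /= mulr_suml.
rewrite exchange_big /= big_seq [RHS]big_seq; apply: eq_bigr => m /Fe /= <-.
under eq_bigr => i _ do
  rewrite mderivZ -scalerAl mderivX_mulX scalerA mulrC -scalerA.
by rewrite -scaler_suml mdegE natr_sum.
Qed.

Lemma mmap_euler n (R A : comNzRingType) (h : {rmorphism R -> A}) e
    (F : {mpoly R[n]}) (a : 'I_n -> A) :
  F \is e.-homog -> \sum_i mmap h a F^`M(i) * a i = e%:R * mmap h a F.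
Proof.
move=> /mpoly_euler /(congr1 (mmap h a)); rewrite mmapZ rmorph_nat => <-.
by rewrite rmorph_sum; apply: eq_bigr => i _; rewrite rmorphM /= mmapXU.
Qed.

Lemma mderiv_homog n (R : comNzRingType) e (F : {mpoly R[n]}) i :
  F \is e.-homog -> F^`M(i) \is e.-1.-homog.
Proof.
move=> /dhomogP Fe; apply/dhomogP => m; rewrite mcoeff_msupp mcoeff_mderiv.
move=> nz; have /Fe <- : (m + U_(i))%MM \in msupp F.
  by rewrite mcoeff_msupp; apply: contraNneq nz => ->; rewrite mul0rn.
by rewrite /= mdegD mdeg1 addn1.
Qed.

Lemma dhomog_mmap n k (R : comNzRingType) d e (Y : 'I_n -> {mpoly R[k]})
    (F : {mpoly R[n]}) :
  (forall i, Y i \is d.-homog) -> F \is e.-homog ->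
  mmap (@mpolyC k R) Y F \is (d * e).-homog.
Proof.
move=> Yd /dhomogP Fe; rewrite /mmap big_seq; apply: rpred_sum => m /Fe /= <-.
rewrite mul_mpolyC rpredZ // mdegE big_distrr /= /mmap1.
elim/big_rec2: _ => [|i p q _ IH]; first exact: dhomog1.
by rewrite dhomogM // dhomogMn.
Qed.

Lemma dhomogXU n (R : comNzRingType) (i : 'I_n) : ('X_i : {mpoly R[n]}) \is 1.-homog.
Proof. by rewrite dhomogX /= mdeg1. Qed.

Lemma deriv_mmap n (R B : comNzRingType) (h : {rmorphism R -> {poly B}})
    (F : {mpoly R[n]}) (Y : 'I_n -> {poly B}) :
  (forall c, (h c)^`() = 0) ->
  (mmap h Y F)^`() = \sum_i mmap h Y F^`M(i) * (Y i)^`().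
Proof.
move=> h0; elim/mpoly_ring_ind: F => [c|i|p q IHp IHq|p q IHp IHq].
- rewrite mmapC h0 big1 // => i _; by rewrite mderivC mmap0 mul0r.
- rewrite mmapXU (bigD1 i) //= big1 ?addr0 => [|j ji].
    by rewrite mderivXU eqxx rmorph1 mul1r.
  by rewrite mderivXU eq_sym (negPf ji) mmap0 mul0r.
- rewrite mmapD derivD IHp IHq -big_split /=; apply: eq_bigr => i _.
  by rewrite mderivD mmapD mulrDl.
- rewrite rmorphM derivM /= IHp IHq mulr_suml mulr_sumr -big_split /=.
  by apply: eq_bigr => i _; rewrite mderivM rmorphD !rmorphM /=; ring.
Qed.

(** * Bivectors *)

Lemma ord4_ind (P : 'I_4 -> Prop) :
  P (inord 0) -> P (inord 1) -> P (inord 2) -> P (inord 3) -> forall i, P i.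
Proof.
move=> P0 P1 P2 P3 i; rewrite -(inord_val i).
by case: i => -[|[|[|[|?]]]] ?.
Qed.

Section Bilinear.
Variable A : comNzRingType.
Implicit Types (s t : A) (M : 'I_6 -> A).

Definition dot n (u v : 'I_n -> A) : A := \sum_i u i * v i.

Lemma dot_lin n (a u v : 'I_n -> A) s t :
  dot a (fun i => s * u i + t * v i) = s * dot a u + t * dot a v.
Proof.
by rewrite /dot !mulr_sumr -big_split; apply: eq_bigr => i _ /=; ring.
Qed.

Lemma dotZ n (a u : 'I_n -> A) s : dot a (fun i => s * u i) = s * dot a u.
Proof. by rewrite /dot mulr_sumr; apply: eq_bigr => i _; ring. Qed.

Lemma dotC n (u v : 'I_n -> A) : dot u v = dot v u.
Proof. by apply: eq_bigr => i _; rewrite mulrC. Qed.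

(** The coordinates of [pluecker_vec] over an arbitrary ring, so that the points spanning a line may
    be polynomials in a parameter or in the coordinates of a point of S. *)
Definition wedge (u v : 'I_4 -> A) : 'I_6 -> A := fun k =>
  let ij := nth (ord0, ord0) pluecker_pairs k in u ij.1 * v ij.2 - u ij.2 * v ij.1.

Lemma wedge_linl (u u' v : 'I_4 -> A) s t :
  wedge (fun i => s * u i + t * u' i) v =
  (fun k => s * wedge u v k + t * wedge u' v k).
Proof. by apply: funext => k; rewrite /wedge; ring. Qed.

Lemma wedgeC (u v : 'I_4 -> A) : wedge u v = (fun k => (-1) * wedge v u k).
Proof. by apply: funext => k; rewrite /wedge; ring. Qed.

Lemma wedge_linr (u v v' : 'I_4 -> A) s t :
  wedge u (fun i => s * v i + t * v' i) =
  (fun k => s * wedge u v k + t * wedge u v' k).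
Proof. by apply: funext => k; rewrite /wedge; ring. Qed.

Lemma wedgeDr (u v v' : 'I_4 -> A) :
  wedge u (fun i => v i + v' i) = (fun k => wedge u v k + wedge u v' k).
Proof. by apply: funext => k; rewrite /wedge; ring. Qed.

Definition pair_index (i j : 'I_4) : 'I_6 := inord (index (i, j) pluecker_pairs).

(** Entries of the skew-symmetric 4 x 4 matrix of a bivector. *)
Definition pcoord M (i j : 'I_4) : A :=
  if (i < j)%N then M (pair_index i j)
  else if (j < i)%N then - M (pair_index j i) else 0.

Lemma pluecker_pairs_lt k : (k < 6)%N ->
  ((nth (ord0, ord0) pluecker_pairs k).1 < (nth (ord0, ord0) pluecker_pairs k).2)%N.
Proof. by case: k => [|[|[|[|[|[|k]]]]]] //= _; rewrite !inordK. Qed.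

Lemma index_pluecker_pairs (i j : 'I_4) : (i < j)%N ->
  (index (i, j) pluecker_pairs < 6)%N.
Proof.
move=> ij; rewrite -[6%N]/(size pluecker_pairs) index_mem.
apply/mapP; exists (i : nat, j : nat); last by rewrite /= !inord_val.
by case: i j ij => [[|[|[|[]]]] //= ?] [[|[|[|[]]]] //= ?].
Qed.

Lemma nth_pair_index (i j : 'I_4) : (i < j)%N ->
  nth (ord0, ord0) pluecker_pairs (pair_index i j) = (i, j).
Proof.
move=> ij; have lt6 := index_pluecker_pairs ij.
by rewrite /pair_index inordK // nth_index // -index_mem.
Qed.

Lemma uniq_pluecker_pairs : uniq pluecker_pairs.
Proof.
by rewrite /= !inE !xpair_eqE -!val_eqE /= !inordK.
Qed.

Lemma pair_index_nth (k : 'I_6) :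
  let ij := nth (ord0, ord0) pluecker_pairs k in pair_index ij.1 ij.2 = k.
Proof.
rewrite /= /pair_index -surjective_pairing index_uniq ?uniq_pluecker_pairs //.
by rewrite inord_val.
Qed.

Lemma pcoordE M (k : 'I_6) :
  let ij := nth (ord0, ord0) pluecker_pairs k in M k = pcoord M ij.1 ij.2.
Proof.
by rewrite /= /pcoord pluecker_pairs_lt // pair_index_nth.
Qed.

Lemma pcoordC M i j : pcoord M i j = - pcoord M j i.
Proof.
by rewrite /pcoord; case: ltngtP => //; rewrite ?opprK ?oppr0.
Qed.

Lemma pcoord_wedge (u v : 'I_4 -> A) i j :
  pcoord (wedge u v) i j = u i * v j - u j * v i.
Proof.
rewrite /pcoord /wedge; case: ltngtP => [ij|ji|/val_inj ->].
- by rewrite nth_pair_index.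
- by rewrite nth_pair_index //=; ring.
- by rewrite mulrC subrr.
Qed.

(** Contraction with a covector. On the Pluecker vector of a line it gives, when nonzero, the point
    where the line meets the plane [a]; points of the line thus become linear in its Pluecker
    coordinates. *)
Definition papply M (a : 'I_4 -> A) : 'I_4 -> A := fun i => dot (pcoord M i) a.

Lemma papply_wedge (u v a : 'I_4 -> A) :
  papply (wedge u v) a = (fun i => dot v a * u i + (- dot u a) * v i).
Proof.
apply: funext => i; rewrite /papply /dot -sumrN !mulr_suml -big_split /=.
by apply: eq_bigr => j _; rewrite pcoord_wedge; ring.
Qed.

(* The polarization of the Pfaffian, whose zeros are the decomposable bivectors. *)
Definition pfpolar M M' : A :=
  pcoord M (inord 0) (inord 1) * pcoord M' (inord 2) (inord 3) +
  pcoord M' (inord 0) (inord 1) * pcoord M (inord 2) (inord 3) -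
  pcoord M (inord 0) (inord 2) * pcoord M' (inord 1) (inord 3) -
  pcoord M' (inord 0) (inord 2) * pcoord M (inord 1) (inord 3) +
  pcoord M (inord 0) (inord 3) * pcoord M' (inord 1) (inord 2) +
  pcoord M' (inord 0) (inord 3) * pcoord M (inord 1) (inord 2).

Definition pfaff M : A :=
  pcoord M (inord 0) (inord 1) * pcoord M (inord 2) (inord 3) -
  pcoord M (inord 0) (inord 2) * pcoord M (inord 1) (inord 3) +
  pcoord M (inord 0) (inord 3) * pcoord M (inord 1) (inord 2).

Lemma pfaff_wedge (u v : 'I_4 -> A) : pfaff (wedge u v) = 0.
Proof. by rewrite /pfaff !pcoord_wedge; ring. Qed.

Lemma pfpolar_wedge (u v b : 'I_4 -> A) : pfpolar (wedge u v) (wedge u b) = 0.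
Proof. by rewrite /pfpolar !pcoord_wedge; ring. Qed.

(** Of the 256 index quadruples, those with a repetition give identities of skew matrices, and the
    others give the Pfaffian relation up to sign. *)
Lemma pluecker_relation M (i j k l : 'I_4) : pfaff M = 0 ->
  pcoord M i j * pcoord M k l =
  pcoord M i k * pcoord M j l - pcoord M i l * pcoord M j k.
Proof.
rewrite /pfaff => pf0.
have solve (a b c : A) : a - b + c = 0 -> a = b - c.
  by move=> abc; rewrite -[LHS]subr0 -abc; ring.
have diag a : pcoord M a a = 0 by rewrite /pcoord ltnn.
have c10 := pcoordC M (inord 1) (inord 0); have c20 := pcoordC M (inord 2) (inord 0).
have c30 := pcoordC M (inord 3) (inord 0); have c21 := pcoordC M (inord 2) (inord 1).
have c31 := pcoordC M (inord 3) (inord 1); have c32 := pcoordC M (inord 3) (inord 2).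
set p01 := pcoord M (inord 0) (inord 1) in pf0 c10 *.
set p02 := pcoord M (inord 0) (inord 2) in pf0 c20 *.
set p03 := pcoord M (inord 0) (inord 3) in pf0 c30 *.
set p12 := pcoord M (inord 1) (inord 2) in pf0 c21 *.
set p13 := pcoord M (inord 1) (inord 3) in pf0 c31 *.
set p23 := pcoord M (inord 2) (inord 3) in pf0 c32 *.
have pfE : p01 * p23 = p02 * p13 - p03 * p12.
  exact: solve pf0.
by move: i j k l; do 4!elim/ord4_ind;
  rewrite ?diag ?c10 ?c20 ?c30 ?c21 ?c31 ?c32 -/p01 -/p02 -/p03 -/p12 -/p13 -/p23;
  move: pfE; clear; move: p01 p02 p03 p12 p13 p23 => p01 p02 p03 p12 p13 p23 pfE;
  ring: pfE.
Qed.

End Bilinear.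

Lemma rmorph_dot (A B : comNzRingType) (k : {rmorphism A -> B}) n (u v : 'I_n -> A) :
  k (dot u v) = dot (k \o u) (k \o v).
Proof. by rewrite /dot rmorph_sum; apply: eq_bigr => i _; rewrite rmorphM. Qed.

Lemma wedge_rmorph (A B : comNzRingType) (k : {rmorphism A -> B}) (u v : 'I_4 -> A) i :
  k (wedge u v i) = wedge (k \o u) (k \o v) i.
Proof. by rewrite /wedge rmorphB !rmorphM. Qed.

Definition grad n (R : nzRingType) (F : {mpoly R[n]}) (r : 'I_n -> R) : 'I_n -> R :=
  fun i => F^`M(i).@[r].

Section BivectorSpace.
Variable K : fieldType.
Implicit Types u v b c : 'rV[K]_4.

Definition wedgev u v : 'rV[K]_6 := \row_k wedge (u 0) (v 0) k.

Lemma wedgevE u v : (wedgev u v) 0 = wedge (u 0) (v 0).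
Proof. by apply: funext => k; rewrite mxE. Qed.

Lemma wedgev_comb (s0 s1 s2 s3 t0 t1 t2 t3 : K) b0 b1 b2 b3 :
  wedgev (s0 *: b0 + s1 *: b1 + s2 *: b2 + s3 *: b3)
         (t0 *: b0 + t1 *: b1 + t2 *: b2 + t3 *: b3) =
  (s0 * t1 - s1 * t0) *: wedgev b0 b1 + (s0 * t2 - s2 * t0) *: wedgev b0 b2 +
  (s0 * t3 - s3 * t0) *: wedgev b0 b3 + (s1 * t2 - s2 * t1) *: wedgev b1 b2 +
  (s1 * t3 - s3 * t1) *: wedgev b1 b3 + (s2 * t3 - s3 * t2) *: wedgev b2 b3.
Proof. by apply/rowP => k; rewrite !mxE /wedge !mxE; ring. Qed.

Lemma wedgev_delta (k : 'I_6) :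
  let ij := nth (ord0, ord0) pluecker_pairs k in
  wedgev (delta_mx 0 ij.1) (delta_mx 0 ij.2) = delta_mx 0 k.
Proof.
move=> ij; apply/rowP => l; rewrite !mxE /wedge !mxE /=.
have := pluecker_pairs_lt (ltn_ord l); have := pluecker_pairs_lt (ltn_ord k).
rewrite -/ij.
have szP (m : 'I_6) : (m < size pluecker_pairs)%N by [].
have := nth_uniq (ord0, ord0) (szP l) (szP k) uniq_pluecker_pairs.
rewrite -/ij => nuq; rewrite -[l == k]nuq.
case: (nth _ _ l) => i' j' /=; case: (ij) => i j /= ij_lt ij'_lt.
rewrite -!natrM !mulnb -pair_eqE /=.
have -> : (j' == i) && (i' == j) = false.
  by apply/negP => /andP[/eqP ji /eqP ji']; move: ij'_lt; rewrite ji ji' ltnNge ltnW.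
by rewrite subr0.
Qed.

Lemma basis4_comb b0 b1 b2 b3 u : basis_of fullv [:: b0; b1; b2; b3] ->
  exists s0 s1 s2 s3, u = s0 *: b0 + s1 *: b1 + s2 *: b2 + s3 *: b3.
Proof.
move=> bas; have := coord_basis (X := [tuple b0; b1; b2; b3]) bas (memvf u).
set s := coord _ => uE.
rewrite uE !big_ord_recl big_ord0 addr0 !addrA.
by do 4!eexists.
Qed.

Lemma basis_extend2 u v : free [:: u; v] ->
  exists b c, basis_of fullv [:: u; v; b; c].
Proof.
move=> uv; pose U := <<[:: u; v]>>%VS.
have dU : \dim U = 2 by apply/eqP.
have dC : \dim U^C = 2 by rewrite dimv_compl dimvf dU /dim.
have szC : size (vbasis U^C) = 2 by rewrite size_tuple dC.
have := vbasisP U^C; move: szC; case: (tval (vbasis _)) => [|b [|c []]] //= _ basC.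
exists b, c; rewrite -[[:: u; v; b; c]]/([:: u; v] ++ [:: b; c]) -(addv_complf U).
apply: cat_basis; [exact/directv_addP/capv_compl | exact/andP | exact: basC].
Qed.

Lemma wedgev_basis b0 b1 b2 b3 : basis_of fullv [:: b0; b1; b2; b3] ->
  basis_of fullv [:: wedgev b0 b1; wedgev b0 b2; wedgev b0 b3;
                     wedgev b1 b2; wedgev b1 b3; wedgev b2 b3].
Proof.
move=> bas; rewrite basisEdim dimvf /dim /= andbT.
apply/subvP => M _; rewrite (row_sum_delta M); apply: memv_suml => k _.
apply: memvZ; rewrite -wedgev_delta.
set ij := nth _ _ _; have [s0 [s1 [s2 [s3 ->]]]] := basis4_comb (delta_mx 0 ij.1) bas.
have [t0 [t1 [t2 [t3 ->]]]] := basis4_comb (delta_mx 0 ij.2) bas.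
by rewrite wedgev_comb !memvD ?memvZ // memv_span // !inE eqxx ?orbT.
Qed.

(** The first two terms fill L /\ K^4, the tangent space of the Grassmannian at the line of u and v;
    [wedgev b c] spans a complement. *)
Lemma wedgev_decomp u v b c (M : 'rV[K]_6) : basis_of fullv [:: u; v; b; c] ->
  exists p q s, M = wedgev u p + wedgev v q + s *: wedgev b c.
Proof.
move=> bas; have bas6 := wedgev_basis bas.
have := coord_basis (X := [tuple wedgev u v; wedgev u b; wedgev u c;
                     wedgev v b; wedgev v c; wedgev b c]) bas6 (memvf M).
set s := coord _; rewrite !big_ord_recl big_ord0 addr0 /= => ->.
set s0 := s _ M; set s1 := s _ M; set s2 := s _ M; set s3 := s _ M; set s4 := s _ M.
exists (s0 *: v + s1 *: b + s2 *: c), (s3 *: b + s4 *: c), (s (lift ord0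
  (lift ord0 (lift ord0 (lift ord0 (lift ord0 ord0))))) M).
by apply/rowP => k; rewrite !mxE /wedge !mxE; ring.
Qed.

Lemma wedgev_neq0 u v : free [:: u; v] -> wedgev u v != 0.
Proof.
move=> /basis_extend2[b [c /wedgev_basis/basis_free]].
by rewrite free_cons => /andP[+ _]; apply: contraNneq => ->; rewrite mem0v.
Qed.

Lemma wedgev_dep u v : ~~ free [:: u; v] -> wedgev u v = 0.
Proof.
rewrite free_cons span_seq1 negb_and negbK => /orP[/vlineP[s ->]|].
  by apply/rowP => k; rewrite !mxE /wedge !mxE; ring.
rewrite free_cons nil_free andbT span_nil memv0 negbK => /eqP ->.
by apply/rowP => k; rewrite !mxE /wedge !mxE; ring.
Qed.

Lemma free2P u v : free [:: u; v] = (wedgev u v != 0).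
Proof.
by apply/idP/idP => [/wedgev_neq0 //|]; apply: contraNT => /wedgev_dep ->.
Qed.

End BivectorSpace.

(** * Points and lines in coordinates *)

Section Points.
Variables (K : fieldType) (n : nat).
Implicit Types (x y : proj K n) (r s : 'rV[K]_n.+1) (F : {mpoly K[n.+1]}).

Definition hvec x : 'rV[K]_n.+1 := vpick (val x).

Lemma hvec_neq0 x : hvec x != 0.
Proof. by rewrite /hvec vpick0 -dimv_eq0; case: x => U /= /eqP ->. Qed.

Lemma hvec_line x : val x = <[hvec x]>%VS.
Proof.
apply/esym/eqP; rewrite eqEdim dim_vline hvec_neq0 (eqP (valP x)) andbT.
by rewrite -memvE memv_pick.
Qed.

Lemma mem_pointsE (U : {vspace 'rV[K]_n.+1}) x : points U x <-> hvec x \in U.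
Proof. by rewrite /points /= hvec_line memvE. Qed.

Lemma proj_eq x y : hvec x \in val y -> x = y.
Proof.
move=> xy; apply: val_inj; apply/eqP.
by rewrite eqEdim (eqP (valP x)) (eqP (valP y)) leqnn andbT hvec_line -memvE.
Qed.

Lemma mkproj_subproof r : r != 0 -> \dim <[r]>%VS == 1%N.
Proof. by rewrite dim_vline => ->. Qed.

Definition mkproj r (r0 : r != 0) : proj K n :=
  exist (fun U : {vspace 'rV[K]_n.+1} => \dim U == 1%N) _ (mkproj_subproof r0).

Lemma mem_proj_scale x r : r \in val x -> exists c, r = c *: hvec x.
Proof. by rewrite hvec_line => /vlineP[c ->]; exists c. Qed.

Lemma mem_mkproj r (r0 : r != 0) : r \in val (mkproj r0).
Proof. exact: memv_line. Qed.

Lemma hvec_mkproj r (r0 : r != 0) : exists2 c, c != 0 & r = c *: hvec (mkproj r0).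
Proof.
have [c rE] := mem_proj_scale (mem_mkproj r0); exists c => //.
by apply/eqP => c0; have := r0; rewrite {1}rE c0 scale0r eqxx.
Qed.

Lemma meval_homogZ e F (c : K) (a : 'I_n.+1 -> K) : F \is e.-homog ->
  F.@[fun i => c * a i] = c ^+ e * F.@[a].
Proof. exact: (@mmap_homogZ _ _ idfun). Qed.

Lemma scale_rowE (c : K) r : (c *: r) 0 = (fun i => c * r 0 i).
Proof. by apply: funext => i; rewrite mxE. Qed.

Lemma form_eval F x r : form F -> r != 0 -> r \in val x ->
  F.@[hcoord x] = 0 <-> F.@[r 0] = 0.
Proof.
move=> [e Fe] r0 /mem_proj_scale[c rE].
have c0 : c != 0 by apply: contraNneq r0 => c0; rewrite rE c0 scale0r.
rewrite rE scale_rowE (meval_homogZ _ _ Fe) -/(hvec x).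
split=> [->|/eqP]; first by rewrite mulr0.
by rewrite mulf_eq0 expf_eq0 (negPf c0) andbF => /eqP.
Qed.

Lemma grad_homogZ e F (c : K) (a : 'I_n.+1 -> K) : F \is e.-homog ->
  grad F (fun i => c * a i) = (fun i => c ^+ e.-1 * grad F a i).
Proof.
by move=> Fe; apply: funext => i; rewrite /grad (meval_homogZ _ _ (mderiv_homog i Fe)).
Qed.

Lemma form_grad_eval F x y r s : form F -> r != 0 -> r \in val x ->
  s != 0 -> s \in val y ->
  \sum_(i < n.+1) F^`M(i).@[hcoord x] * hcoord y i = 0 <-> dot (grad F (r 0)) (s 0) = 0.
Proof.
move=> [e Fe] r0 /mem_proj_scale[c rE] s0 /mem_proj_scale[c' sE].
have c0 : c != 0 by apply: contraNneq r0 => c0; rewrite rE c0 scale0r.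
have c'0 : c' != 0 by apply: contraNneq s0 => c'0; rewrite sE c'0 scale0r.
rewrite rE sE !scale_rowE (grad_homogZ _ _ Fe) dotZ dotC dotZ dotC.
rewrite -[X in X = 0 <-> _]/(dot (grad F (hcoord x)) (hcoord y)).
split=> [->|/eqP]; first by rewrite !mulr0.
by rewrite !mulf_eq0 expf_eq0 (negPf c0) (negPf c'0) andbF => /eqP.
Qed.

End Points.

Section Lines.
Variable K : fieldType.
Implicit Types (L : grass_line K) (u v : 'rV[K]_4) (F : {mpoly K[6]}).

Lemma mkline_subproof u v : free [:: u; v] -> \dim <<[:: u; v]>>%VS == 2.
Proof. by []. Qed.

Definition mkline u v (uv : free [:: u; v]) : grass_line K :=
  exist (fun U : {vspace 'rV[K]_4} => \dim U == 2) _ (mkline_subproof uv).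

Lemma val_mkline u v (uv : free [:: u; v]) : val (mkline uv) = <<[:: u; v]>>%VS.
Proof. by []. Qed.

Lemma line_basis L : exists u v, free [:: u; v] /\ val L = <<[:: u; v]>>%VS.
Proof.
have := vbasisP (val L).
have szL : size (vbasis (val L)) = 2 by rewrite size_tuple (eqP (valP L)).
case: (tval (vbasis _)) szL => [|u [|v []]] //= _ bas.
by exists u, v; rewrite (basis_free bas) (span_basis bas).
Qed.

Lemma line_span L u v : u \in val L -> v \in val L -> free [:: u; v] ->
  val L = <<[:: u; v]>>%VS.
Proof.
move=> uL vL uv; apply/esym/eqP; rewrite eqEdim (eqP (valP L)) (eqP uv) leqnn andbT.
by apply/span_subvP => w; rewrite !inE => /orP[] /eqP ->.
Qed.

Lemma mem_span2 u v w : w \in <<[:: u; v]>>%VS ->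
  exists s t, w = s *: u + t *: v.
Proof.
rewrite span_cons span_seq1 => /memv_addP[_ /vlineP[s ->] [_ /vlineP[t ->] ->]].
by exists s, t.
Qed.

Lemma mem_pluecker L u v : u \in val L -> v \in val L -> free [:: u; v] ->
  wedgev u v \in val (pluecker L).
Proof.
have szL : size (vbasis (val L)) = 2 by rewrite size_tuple (eqP (valP L)).
have := vbasisP (val L); rewrite /= /pluecker_vec.
case: (tval (vbasis _)) szL => [|a [|b []]] //= _ bas.
rewrite -(span_basis bas) => /mem_span2[s [t ->]] /mem_span2[s' [t' ->]] _.
apply/vlineP; exists (s * t' - t * s').
by apply/rowP => k; rewrite !mxE /wedge !mxE; ring.
Qed.

Lemma form_pluecker F L u v : form F -> u \in val L -> v \in val L ->
  free [:: u; v] -> F.@[hcoord (pluecker L)] = 0 <-> F.@[wedge (u 0) (v 0)] = 0.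
Proof.
move=> Ff uL vL uv; rewrite -wedgevE; apply: form_eval => //; first exact: wedgev_neq0.
exact: mem_pluecker.
Qed.

(** Rows i and j of the skew matrix of a bivector M with zero Pfaffian have wedge p_ij M; where p_ij
    is nonzero they span a line with Pluecker vector M. *)
Lemma wedge_pcoord (M : 'I_6 -> K) (k : 'I_6) : pfaff M = 0 ->
  let ij := nth (ord0, ord0) pluecker_pairs k in
  wedge (pcoord M ij.1) (pcoord M ij.2) = (fun l => M k * M l).
Proof.
move=> pf0 ij; apply: funext => l; rewrite (pcoordE (wedge _ _) l) pcoord_wedge.
by rewrite (pcoordE M k) (pcoordE M l); apply/esym/pluecker_relation.
Qed.

Lemma pluecker_surj (p : proj K 5) : pfaff (hvec p 0) = 0 -> exists L, pluecker L = p.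
Proof.
move=> /wedge_pcoord pfE; have [k pk0] : exists k, hvec p 0 k != 0 by apply/rV0Pn/hvec_neq0.
have := pfE k; set ij := nth _ _ _; set M := hvec p 0 => ME.
pose u : 'rV[K]_4 := \row_l pcoord M ij.1 l; pose v : 'rV[K]_4 := \row_l pcoord M ij.2 l.
have uvE : wedgev u v = M k *: hvec p.
  have rowE (a : 'I_4 -> K) : (\row_l a l) 0 = a by apply: funext => l; rewrite mxE.
  by apply/rowP => l; rewrite mxE [RHS]mxE !rowE ME.
have uv : free [:: u; v] by rewrite free2P uvE scaler_eq0 negb_or pk0 hvec_neq0.
exists (mkline uv); apply/esym/proj_eq.
have : wedgev u v \in val (pluecker (mkline uv)).
  by apply: mem_pluecker; rewrite // val_mkline memv_span // !inE eqxx ?orbT.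
by rewrite uvE => /(memvZ (M k)^-1); rewrite scalerA mulVf // scale1r.
Qed.

End Lines.

(** * The tangent lines of a surface along a curve *)

Lemma horner_mmap n (R : comNzRingType) (F : {mpoly R[n]}) (Y : 'I_n -> {poly R}) t :
  (mmap (@polyC R) Y F).[t] = F.@[fun i => (Y i).[t]].
Proof.
rewrite -[LHS]/(horner_eval t _) /meval.
by apply: mmap_rmorph => c /=; rewrite /horner_eval hornerC.
Qed.

Lemma meval_mmap n k (R : comNzRingType) (F : {mpoly R[n]})
    (Y : 'I_n -> {mpoly R[k]}) (x : 'I_k -> R) :
  (mmap (@mpolyC k R) Y F).@[x] = F.@[fun i => (Y i).@[x]].
Proof. exact: (@mmap_mmap _ _ idfun). Qed.

(** The shape of [tangent_wedge] along X + t Z: [a] is the value of w.grad f, and [t * b] that of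
    v.grad f, which vanishes at t = 0. *)
Lemma wedge_move (A : comNzRingType) (X Z V W : 'I_4 -> A) a b t k :
  wedge (fun i => X i + t * Z i) (fun i => a * V i - t * b * W i) k =
  a * wedge X V k + t * (a * wedge Z V k - b * wedge X W k - t * b * wedge Z W k).
Proof. by rewrite /wedge; ring. Qed.

(** For Z = V the term in Z /\ V disappears, so the deviation from [a * wedge X V] is divisible by
    the full power [s] contained in v.grad f. *)
Lemma wedge_along (A : comNzRingType) (X V W : 'I_4 -> A) a b s t k :
  wedge (fun i => X i + t * V i) (fun i => a * V i - s * b * W i) k =
  a * wedge X V k + s * ((- b) * (wedge X W k + t * wedge V W k)).
Proof. by rewrite /wedge; ring. Qed.

(** * Differentials of polynomials *)

Section Gradient.
Variable R : comNzRingType.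

Lemma dot_gradD n (G : {mpoly R[n]}) (p u v : 'I_n -> R) :
  dot (grad G p) (fun i => u i + v i) = dot (grad G p) u + dot (grad G p) v.
Proof.
rewrite -[dot _ u in RHS]mul1r -[dot _ v in RHS]mul1r -dot_lin.
by congr dot; apply: funext => i; rewrite !mul1r.
Qed.

Lemma dot_gradM n (G H : {mpoly R[n]}) (p u : 'I_n -> R) :
  dot (grad (G * H) p) u = dot (grad G p) u * H.@[p] + G.@[p] * dot (grad H p) u.
Proof.
rewrite /dot mulr_suml mulr_sumr -big_split /=; apply: eq_bigr => i _.
by rewrite /grad mderivM mevalD !mevalM; ring.
Qed.

Definition pform (i j : 'I_4) : {mpoly R[6]} := pcoord (fun k => 'X_k) i j.

Lemma pform_homog i j : pform i j \is 1.-homog.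
Proof.
rewrite /pform /pcoord; case: ifP => _; first exact: dhomogXU.
by case: ifP => _; rewrite ?rpredN ?dhomogXU ?rpred0.
Qed.

Lemma meval_pform (M : 'I_6 -> R) i j : (pform i j).@[M] = pcoord M i j.
Proof.
rewrite /pform /pcoord; case: ifP => _; first by rewrite mevalXU.
by case: ifP => _; rewrite ?mevalN ?meval0 ?mevalXU.
Qed.

Lemma dot_gradX n (p M : 'I_n -> R) k : dot (grad ('X_k : {mpoly R[n]}) p) M = M k.
Proof.
rewrite /dot (bigD1 k) //= big1 => [|j jk]; rewrite /grad mderivXU.
  by rewrite eqxx meval1 mul1r addr0.
by rewrite eq_sym (negPf jk) meval0 mul0r.
Qed.

Lemma dot_gradN n (G : {mpoly R[n]}) (p u : 'I_n -> R) :
  dot (grad (- G) p) u = - dot (grad G p) u.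
Proof. by rewrite /dot -sumrN; apply: eq_bigr => i _; rewrite /grad mderivN mevalN mulNr. Qed.

Lemma dot_gradPD n (G H : {mpoly R[n]}) (p u : 'I_n -> R) :
  dot (grad (G + H) p) u = dot (grad G p) u + dot (grad H p) u.
Proof.
by rewrite /dot -big_split; apply: eq_bigr => i _; rewrite /grad mderivD mevalD mulrDl.
Qed.

Lemma dot_gradC n (c : R) (p u : 'I_n -> R) : dot (grad (c%:MP_[n]) p) u = 0.
Proof. by rewrite /dot big1 // => i _; rewrite /grad mderivC meval0 mul0r. Qed.

Lemma dot_grad_pform (p M : 'I_6 -> R) i j : dot (grad (pform i j) p) M = pcoord M i j.
Proof.
rewrite /pform /pcoord; case: ifP => _; first exact: dot_gradX.
by case: ifP => _; rewrite ?dot_gradN ?dot_gradX // -mpolyC0 dot_gradC.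
Qed.

Lemma dot_grad_mmap n k (Y : 'I_n -> {mpoly R[k]}) (H : {mpoly R[n]}) (p M : 'I_k -> R) :
  dot (grad (mmap (@mpolyC k R) Y H) p) M =
  \sum_m H^`M(m).@[fun i => (Y i).@[p]] * dot (grad (Y m) p) M.
Proof.
elim/mpoly_ring_ind: H => [c|i|G H IHG IHH|G H IHG IHH].
- by rewrite mmapC dot_gradC big1 // => i _; rewrite mderivC meval0 mul0r.
- rewrite mmapXU (bigD1 i) //= big1 => [|j ji]; rewrite mderivXU.
    by rewrite eqxx meval1 mul1r addr0.
  by rewrite eq_sym (negPf ji) meval0 mul0r.
- rewrite mmapD dot_gradPD [X in X + _]IHG [X in _ + X]IHH -big_split; apply: eq_bigr => i _ /=.
  by rewrite mderivD mevalD mulrDl.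
- rewrite rmorphM dot_gradM [X in X * _ + _]IHG [X in _ + _ * X]IHH !meval_mmap mulr_suml mulr_sumr -big_split.
  by apply: eq_bigr => i _ /=; rewrite mderivM mevalD !mevalM; ring.
Qed.

End Gradient.

Section TangentFamily.
Variables (R : comNzRingType) (f : {mpoly R[4]}).

(* A bivector of the line through X and a tangent vector of f at X in the plane
   spanned by X, v and w. *)
Definition tangent_wedge (A : comNzRingType) (h : {rmorphism R -> A})
    (v w : 'I_4 -> R) (X : 'I_4 -> A) : 'I_6 -> A :=
  let n := fun i => mmap h X f^`M(i) in
  wedge X (fun i => dot n (h \o w) * h (v i) - dot n (h \o v) * h (w i)).

Definition tangent_poly (v w : 'I_4 -> R) : 'I_6 -> {mpoly R[4]} :=
  tangent_wedge (@mpolyC 4 R) v w (fun i => 'X_i).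

Lemma mmap_tangent_poly (A : comNzRingType) (h : {rmorphism R -> A}) v w X k :
  mmap h X (tangent_poly v w k) = tangent_wedge h v w X k.
Proof.
rewrite /tangent_poly /tangent_wedge wedge_rmorph.
have XX : mmap h X \o (fun i => 'X_i) = X.
  by apply: funext => i; rewrite /= mmapXU.
rewrite XX; congr (wedge _ _ _); apply: funext => i /=.
rewrite rmorphB !rmorphM !rmorph_dot /=.
have hC (u : 'I_4 -> R) : mmap h X \o (@mpolyC 4 R \o u) = h \o u.
  by apply: funext => j; rewrite /= mmapC.
rewrite !hC !mmapC.
suff -> : mmap h X \o (fun j => mmap (@mpolyC 4 R) (fun l => 'X_l) f^`M(j)) =
          (fun j => mmap h X f^`M(j)) by [].
apply: funext => j /=; rewrite mmap_mmap; congr (mmap h _ _).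
by apply: funext => l; rewrite mmapXU.
Qed.

Lemma tangent_poly_homog d v w k : f \is d.-homog -> (0 < d)%N ->
  tangent_poly v w k \is d.-homog.
Proof.
case: d => [//|d] fd _; rewrite /tangent_poly /tangent_wedge /wedge.
have gE i : mmap (@mpolyC 4 R) (fun j => 'X_j) f^`M(i) = f^`M(i).
  by rewrite -[RHS]comp_mpoly_id; apply: mmap_ext => j; rewrite tnth_mktuple.
have dot_homog (u : 'I_4 -> R) :
    dot (fun i => mmap (@mpolyC 4 R) (fun j => 'X_j) f^`M(i)) (@mpolyC 4 R \o u)
      \is d.-homog.
  apply: rpred_sum => i _; rewrite gE /= mulrC mul_mpolyC rpredZ //.
  exact: (mderiv_homog i fd).
have vec_homog i : dot (fun i => mmap (@mpolyC 4 R) (fun j => 'X_j) f^`M(i))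
      (@mpolyC 4 R \o w) * (v i)%:MP -
    dot (fun i => mmap (@mpolyC 4 R) (fun j => 'X_j) f^`M(i))
      (@mpolyC 4 R \o v) * (w i)%:MP \is d.-homog.
  by apply: rpredB; rewrite mulrC mul_mpolyC rpredZ.
by apply: rpredB; rewrite -[d.+1]add1n; apply: dhomogM; rewrite ?dhomogXU //=; apply: vec_homog.
Qed.

Definition tangent_comp (v w : 'I_4 -> R) (F : {mpoly R[6]}) : {mpoly R[4]} :=
  mmap (@mpolyC 4 R) (tangent_poly v w) F.

Lemma mmap_tangent_comp (A : comNzRingType) (h : {rmorphism R -> A}) v w X F :
  mmap h X (tangent_comp v w F) = mmap h (tangent_wedge h v w X) F.
Proof.
by rewrite mmap_mmap; apply: mmap_ext => k; rewrite mmap_tangent_poly.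
Qed.

Lemma meval_tangent_comp v w (x : 'I_4 -> R) F :
  (tangent_comp v w F).@[x] =
  F.@[wedge x (fun i => dot (grad f x) w * v i - dot (grad f x) v * w i)].
Proof. exact: (@mmap_tangent_comp _ idfun). Qed.

End TangentFamily.

(** * First-order consequences of divisibility by f *)

Section ContactOrder.
Variables (K : numFieldType) (f : {mpoly K[4]}).

Definition curve n (x z : 'I_n -> K) : 'I_n -> {poly K} :=
  fun i => (x i)%:P + 'X * (z i)%:P.

Definition restr n (F : {mpoly K[n]}) (x z : 'I_n -> K) : {poly K} := mmap (@polyC K) (curve x z) F.

Lemma curve0 n (x z : 'I_n -> K) : (fun i => (curve x z i).[0]) = x.
Proof.
by apply: funext => i; rewrite /curve !hornerE.
Qed.

Lemma restr0 n (F : {mpoly K[n]}) (x z : 'I_n -> K) : (restr F x z).[0] = F.@[x].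
Proof. by rewrite /restr horner_mmap curve0. Qed.

Lemma horner_restr n (F : {mpoly K[n]}) (x z : 'I_n -> K) t :
  (restr F x z).[t] = F.@[fun i => x i + t * z i].
Proof.
by rewrite /restr horner_mmap; congr meval; apply: funext => i; rewrite /curve !hornerE.
Qed.

Lemma deriv_restr n (F : {mpoly K[n]}) (x z : 'I_n -> K) :
  (restr F x z)^`() = dot (fun i => restr F^`M(i) x z) (@polyC K \o z).
Proof.
rewrite /restr deriv_mmap => [|c]; last exact: derivC.
by apply: eq_bigr => i _; rewrite /curve derivD derivC derivM derivX derivC add0r mul1r mulr0 addr0.
Qed.

Lemma deriv_restr0 n (F : {mpoly K[n]}) (x z : 'I_n -> K) : (restr F x z)^`().[0] = dot (grad F x) z.
Proof.
rewrite deriv_restr /dot -[LHS]/(horner_eval 0 _) rmorph_sum.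
by apply: eq_bigr => i _; rewrite rmorphM /= /horner_eval restr0 hornerC.
Qed.

Variables (e : nat) (F : {mpoly K[6]}).
Hypothesis Fe : F \is e.-homog.

(** The coefficient [a] in front of M is itself a polynomial in the parameter; homogeneity of F and
    of its partial derivatives extracts it as a power. *)
Lemma restr_expand (M : 'I_6 -> K) (a s : {poly K}) (m : 'I_6 -> {poly K}) :
  F.@[M] = 0 ->
  exists c, mmap (@polyC K) (fun k => a * (M k)%:P + s * m k) F =
    s * (a ^+ e.-1 * dot (@polyC K \o grad F M) m + s * c).
Proof.
move=> FM; have [c ->] := mmap_taylor (@polyC K) F (fun k => a * (M k)%:P) m s.
exists c; rewrite (mmap_homogZ _ _ _ Fe).
have evC G : mmap (@polyC K) (fun k => (M k)%:P) G = (G.@[M])%:P.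
  by rewrite /meval; apply/esym/mmap_rmorph.
rewrite evC FM mulr0 add0r expr2 -mulrA -mulrDr; congr (_ * (_ + _)).
rewrite /dot mulr_sumr; apply: eq_bigr => k _.
by rewrite (mmap_homogZ _ _ _ (mderiv_homog k Fe)) evC mulrA.
Qed.

Variables (x v w : 'I_4 -> K) (g : {mpoly K[4]}).
Hypothesis FPhi : tangent_comp f v w F = g * f.
Hypothesis fx : f.@[x] = 0.
Hypothesis nv : dot (grad f x) v = 0.
Let a0 := dot (grad f x) w.
Hypothesis nw : a0 != 0.
Let th (M : 'I_6 -> K) := dot (grad F (wedge x v)) M.

Lemma form_tangent_wedge0 : F.@[wedge x v] = 0.
Proof.
have /(congr1 (meval x)) := FPhi.
rewrite meval_tangent_comp mevalM fx mulr0 nv -/a0.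
have -> : (fun i => a0 * v i - 0 * w i) = (fun i => a0 * v i + 0 * v i).
  by apply: funext => i; rewrite !mul0r subr0 addr0.
rewrite wedge_linr; under [X in F.@[X]]funext => k do rewrite mul0r addr0.
rewrite (meval_homogZ _ _ Fe) => /eqP.
by rewrite mulf_eq0 expf_eq0 (negPf nw) andbF => /eqP.
Qed.

Lemma restr_tangent_comp z :
  mmap (@polyC K) (tangent_wedge f (@polyC K) v w (curve x z)) F = restr g x z * restr f x z.
Proof. by rewrite -mmap_tangent_comp FPhi rmorphM. Qed.

Lemma dot_restr z u : (dot (fun i => restr f^`M(i) x z) (@polyC K \o u)).[0] =
  dot (grad f x) u.
Proof.
rewrite /dot -[LHS]/(horner_eval 0 _) rmorph_sum.
by apply: eq_bigr => i _; rewrite rmorphM /= /horner_eval restr0 hornerC.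
Qed.

Lemma rootX_factor (p : {poly K}) : p.[0] = 0 -> exists q, p = 'X * q.
Proof.
move=> p0; have /factor_theorem[q ->] : root p 0 by apply/eqP.
by exists q; rewrite subr0 mulrC.
Qed.

(** Both sides are the coefficient of t in [FPhi] along x + t z. The number [b] is the derivative of
    v.grad f in the direction z; it need not be known, since its factor turns out to be zero in
    [tangent_kernel]. *)
Lemma tangent_move z : exists b,
  a0 ^+ e.-1 * (a0 * th (wedge z v) - b * th (wedge x w)) = g.@[x] * dot (grad f x) z.
Proof.
pose n i := restr f^`M(i) x z; pose a := dot n (@polyC K \o w).
have [b bE] : exists b, dot n (@polyC K \o v) = 'X * b.
  by apply: rootX_factor; rewrite dot_restr.
have [r rE] : exists r, restr f x z = 'X * r.
  by apply: rootX_factor; rewrite restr0.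
have r0 : r.[0] = dot (grad f x) z.
  by rewrite -deriv_restr0 rE derivM derivX !hornerE.
pose m := fun k => a * (wedge z v k)%:P - b * (wedge x w k)%:P
  - 'X * b * (wedge z w k)%:P.
have := restr_tangent_comp z; rewrite rE.
have -> : tangent_wedge f (@polyC K) v w (curve x z) =
    (fun k => a * (wedge x v k)%:P + 'X * m k).
  apply: funext => k; rewrite /tangent_wedge -/(restr _ _ _) -/n bE -/a /m.
  by rewrite !wedge_rmorph wedge_move.
have [c ->] := restr_expand a 'X m form_tangent_wedge0.
rewrite mulrCA => /(mulfI (negbT (polyX_eq0 _))) /(congr1 (horner^~ 0)).
rewrite hornerD !hornerM hornerX mul0r addr0 horner_exp restr0 r0 => <-.
exists b.[0]; rewrite dot_restr -/a0; congr (_ * _).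
rewrite /th /dot -[RHS]/(horner_eval 0 _) rmorph_sum !mulr_sumr -sumrB.
apply: eq_bigr => k _; rewrite rmorphM /= /horner_eval hornerC /m.
move: (wedge z v k) (wedge x w k) (wedge z w k) => W1 W2 W3.
by rewrite !hornerE dot_restr -/a0 /=; ring.
Qed.

(** Along x + t v, the function v.grad f is the derivative of f, so it has order m + 1 with leading
    coefficient (m + 2) psi(0), while f has order m + 2. After division of [FPhi] by t^(m+1), the
    constant term gives the first claim and the coefficient of t the second; the quadratic remainder
    starts at t^(m+1), hence stays out of the latter only for m > 0. *)
Lemma tangent_along m psi :
  restr f x v = 'X^(m.+2) * psi -> psi.[0] != 0 ->
  th (wedge x w) = 0 /\
  ((0 < m)%N -> m.+2%:R * (a0 ^+ e.-1 * th (wedge v w)) = - g.@[x]).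
Proof.
move=> phiE psi0; pose n i := restr f^`M(i) x v; pose a := dot n (@polyC K \o w).
have [chi phi'E chi0] : exists2 chi, dot n (@polyC K \o v) = 'X^(m.+1) * chi &
    chi.[0] = m.+2%:R * psi.[0].
  exists (m.+2%:R * psi + 'X * psi^`()).
    by rewrite -[LHS]deriv_restr phiE derivM derivXn -mulr_natl exprS /=; ring.
  by rewrite hornerD !hornerM hornerX mul0r addr0 -polyC_natr hornerC.
pose M := fun k => (- chi) * ((wedge x w k)%:P + 'X * (wedge v w k)%:P).
have := restr_tangent_comp v; rewrite phiE.
have -> : tangent_wedge f (@polyC K) v w (curve x v) =
    (fun k => a * (wedge x v k)%:P + 'X^(m.+1) * M k).
  apply: funext => k; rewrite /tangent_wedge -/(restr _ _ _) -/n phi'E -/a /M.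
  by rewrite !wedge_rmorph wedge_along.
have [c ->] := restr_expand a 'X^(m.+1) M form_tangent_wedge0.
rewrite [in RHS]exprSr -mulrA mulrCA => /(mulfI _) E.
have {}E := E (expf_neq0 _ (negbT (polyX_eq0 _))).
pose thp u := dot (@polyC K \o grad F (wedge x v)) (@polyC K \o u).
have thpE u : thp u = (th u)%:P.
  by rewrite /thp -rmorph_dot.
have ME : dot (@polyC K \o grad F (wedge x v)) M =
    - chi * ((th (wedge x w))%:P + 'X * (th (wedge v w))%:P).
  rewrite -!thpE /M dotZ; congr (_ * _).
  rewrite -[thp (wedge x w)]mul1r -dot_lin.
  by congr dot; apply: funext => k; rewrite mul1r.
rewrite {}ME in E.
have thxw : th (wedge x w) = 0.
  have /(congr1 (horner^~ 0)) := E; rewrite !(hornerE, hornerXn) /= chi0.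
  rewrite ?expr0n /= ?(mul0r, mulr0, addr0) ?(mul0r, mulr0, addr0) dot_restr -/a0 => /eqP.
  rewrite !mulf_eq0 oppr_eq0 mulf_eq0 expf_eq0 (negPf nw) andbF pnatr_eq0 (negPf psi0) /=.
  by move/eqP.
split=> // m_gt0; move: E; rewrite thxw add0r -(prednK m_gt0).
set T := th (wedge v w).
have -> : a ^+ e.-1 * (- chi * ('X * T%:P)) + 'X^(m.-1.+1.+1) * c =
  'X * (a ^+ e.-1 * (- chi * T%:P) + 'X^(m.-1.+1) * c).
  by rewrite [in LHS]exprS; move: ('X^(m.-1.+1)) => Xm; ring.
rewrite [RHS]mulrCA => /(mulfI (negbT (polyX_eq0 _))) /(congr1 (horner^~ 0)).
rewrite !(hornerE, hornerXn) /= chi0 dot_restr -/a0 ?expr0n /= ?mul0r ?addr0 restr0 => E.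
by apply: (mulIf psi0); rewrite mulNr -E prednK //; ring.
Qed.

End ContactOrder.

(** * Zeros of univariate polynomials *)

Section PolyFacts.
Variable K : numFieldType.

Lemma poly_horner0 (p : {poly K}) : (forall t, p.[t] = 0) -> p = 0.
Proof.
move=> p0; apply/eqP; apply: contraT => nz.
pose rs := [seq i%:R : K | i <- iota 0 (size p)].
have := max_poly_roots nz (rs := rs); rewrite size_map size_iota ltnn.
apply; first by apply/allP => t _; apply/eqP.
by rewrite map_inj_uniq ?iota_uniq // => i j /eqP; rewrite eqr_nat => /eqP.
Qed.

Lemma poly_nonroot (p : {poly K}) : p != 0 -> exists t, p.[t] != 0.
Proof.
move=> nz; apply: contrapT => all0; case/eqP: nz; apply: poly_horner0 => t.
by apply: contrapT => /eqP nt; apply: all0; exists t.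
Qed.

Lemma poly_mulX0 (p : {poly K}) : (forall t, t != 0 -> p.[t] = 0) -> p = 0.
Proof.
move=> p0; have /eqP : 'X * p = 0.
  apply: poly_horner0 => t; rewrite hornerM hornerX.
  by have [->|/p0 ->] := eqVneq t 0; rewrite ?mul0r ?mulr0.
by rewrite mulf_eq0 polyX_eq0 => /eqP.
Qed.

Lemma polyX_factor (p : {poly K}) : p != 0 ->
  exists m psi, p = 'X^m * psi /\ psi.[0] != 0.
Proof.
move=> nz; have [m [q]] := multiplicity_XsubC p 0.
by rewrite nz subr0 => q0 ->; exists m, q; rewrite mulrC.
Qed.

End PolyFacts.

Section TangentKernel.
Variables (K : numFieldType) (f : {mpoly K[4]}) (e : nat) (F : {mpoly K[6]}).
Hypothesis Fe : F \is e.-homog.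
Hypothesis Fcomp : forall v w, exists g, tangent_comp f v w F = g * f.

(* The tangent space of the Hurwitz hypersurface at x /\ v. The value g(x) of the
   cofactor of f is computed along x + t w and along x + t v; in the second case it
   gets multiplied by the contact order m + 2, so it vanishes when m > 0. *)
Lemma tangent_kernel (x v : 'I_4 -> K) m psi :
  f.@[x] = 0 -> dot (grad f x) v = 0 -> (exists w, dot (grad f x) w != 0) ->
  restr f x v = 'X^(m.+2) * psi -> psi.[0] != 0 ->
  let th := dot (grad F (wedge x v)) in
  (forall z, th (wedge x z) = 0) /\
  exists c, (forall z, th (wedge z v) = c * dot (grad f x) z) /\ ((0 < m)%N -> c = 0).
Proof.
move=> fx nv [w nw] phiE psi0 th.
have along z : dot (grad f x) z != 0 -> th (wedge x z) = 0.
  by move=> nz; have [g gE] := Fcomp v z; have [] := tangent_along Fe gE fx nv nz phiE psi0.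
(* [along] needs a direction transverse to S; a tangential z is the difference of the transverse
   vectors z + w and w. *)
have thx z : th (wedge x z) = 0.
  have [nz|] := eqVneq (dot (grad f x) z) 0; last exact: along.
  have := along (fun i => z i + w i); rewrite dot_gradD nz add0r => /(_ nw).
  by rewrite wedgeDr /th dot_gradD -/th [th (wedge x w)]along // addr0.
split=> //; have [g gE] := Fcomp v w; set a0 := dot (grad f x) w in nw.
have a0e : a0 ^+ e.-1 != 0 by rewrite expf_neq0.
have thz z : a0 ^+ e.-1 * (a0 * th (wedge z v)) = g.@[x] * dot (grad f x) z.
  have [b] := tangent_move Fe gE fx nv nw z.
  by rewrite -/th thx mulr0 subr0.
exists (g.@[x] / (a0 ^+ e.-1 * a0)); split=> [z|m_gt0].
  rewrite mulrAC -thz mulrA mulrAC mulfV ?mul1r //; exact: mulf_neq0.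
have [_ /(_ m_gt0)] := tangent_along Fe gE fx nv nw phiE psi0.
have thC : th (wedge w v) = - th (wedge v w).
  by rewrite [wedge w v]wedgeC /th dotZ mulN1r.
have := thz w; rewrite -/a0 thC mulrN mulrN mulrCA -/th.
rewrite [g.@[x] * a0]mulrC -mulrN => /(mulfI nw).
set A := _ * th _ => E; rewrite -E opprK -natr1 mulrDl mul1r => /eqP.
rewrite -subr_eq0 addrK mulf_eq0 pnatr_eq0 /= => /eqP A0.
by rewrite A0 oppr0 mul0r.
Qed.

End TangentKernel.

(** * Dimension and closure *)

Lemma mmap_id n (R : comNzRingType) (P : {mpoly R[n]}) :
  mmap (@mpolyC n R) (fun i => 'X_i) P = P.
Proof. by rewrite -[RHS]comp_mpoly_id; apply: mmap_ext => j; rewrite tnth_mktuple. Qed.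

Section Dimension.
Variables (K : fieldType) (n : nat).
Implicit Types (X Z : set (proj K n)).

Lemma trdeg_ge_subset X Z m : Z `<=` X -> trdeg_ge Z m -> trdeg_ge X m.
Proof.
move=> ZX [e [F [G [Fe Ge [z Zz Gz] indep]]]]; exists e, F, G; split=> //.
  by exists z => //; apply: ZX.
by move=> P P0; apply: indep => y /ZX; apply: P0.
Qed.

Lemma trdeg_ge_leq X k m : (k <= m)%N -> trdeg_ge X m -> trdeg_ge X k.
Proof.
move=> km [e [F [G [Fe Ge exG indep]]]].
exists e, (fun i => F (widen_ord km i)), G; split=> // P P0.
pose Q := mmap (@mpolyC m K) (fun i => 'X_(widen_ord km i)) P.
have Q0 : Q = 0.
  apply: indep => z Xz Gz; rewrite /Q meval_mmap -[RHS](P0 z Xz Gz).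
  by congr meval; apply: funext => i; rewrite mevalXU.
have := congr1 (mmap (@mpolyC k K) (fun j : 'I_m =>
  if insub (val j) is Some i then 'X_i else 0)) Q0.
rewrite mmap_mmap mmap0 => <-; rewrite -[LHS]mmap_id; apply: mmap_ext => i.
by rewrite mmapXU /= insubT //= => lt_ik; congr 'X_(_); apply: val_inj.
Qed.

Lemma local_dim_uniq X x m m' : local_dim X x m -> local_dim X x m' -> m = m'.
Proof.
move=> [[Z [cZ iZ ZX Zx dZ]] maxm] [[Z' [cZ' iZ' ZX' Zx' dZ']] maxm'].
by apply/eqP; rewrite eqn_leq (maxm' Z) // (maxm Z').
Qed.

Lemma local_dim_irreducible X x m : zariski_closed X -> zariski_irreducible X ->
  X x -> irr_dim X m -> local_dim X x m.
Proof.
move=> cX iX Xx dX; split; first by exists X; split.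
move=> Z k _ _ ZX _ [kZ _]; rewrite leqNgt; apply/negP => mk.
by case: dX => _; apply; apply: trdeg_ge_leq mk (trdeg_ge_subset ZX kZ).
Qed.

Lemma closure_closed X : zariski_closed (zariski_closure X).
Proof.
exists (vanishing_forms X) => [F []//|]; apply/seteqP; split=> x.
  move=> Xx F [Ff F0]; apply: (Xx (zero_locus [set F])) => [|y Xy _ ->|//]; last exact: F0.
  by exists [set F] => [_ ->|].
move=> Xx Z [I If ->] XI G IG; apply: Xx; split; first exact: If.
by move=> y /XI /(_ G IG).
Qed.

Lemma subset_closureX X : X `<=` zariski_closure X.
Proof. by move=> x Xx Z _; apply. Qed.

Lemma closureP X x :
  zariski_closure X x <-> forall F, vanishing_forms X F -> F.@[hcoord x] = 0.
Proof.
split=> [Xx F [Ff F0]|Xx Z [I If ->] XI G IG].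
  apply: (Xx (zero_locus [set F])) => [|y Xy _ ->|//]; last exact: F0.
  by exists [set F] => [_ ->|].
by apply: Xx; split; [exact: If | move=> y /XI /(_ G IG)].
Qed.

Lemma vanishing_closure X F : vanishing_forms (zariski_closure X) F <-> vanishing_forms X F.
Proof.
split=> -[Ff F0]; split=> // x Xx; first by apply: F0; apply: subset_closureX.
by move/closureP: Xx; apply.
Qed.

End Dimension.

Lemma ord4_complete (i j : 'I_4) : i != j -> exists k l, uniq [:: i; j; k; l].
Proof.
have E a b : (a < 4)%N -> (b < 4)%N -> (inord a == inord b :> 'I_4) = (a == b).
  by move=> a4 b4; rewrite -val_eqE /= !inordK.
move: i j; do 2!elim/ord4_ind; rewrite ?E //= => _;
  do ?[by exists (inord 0), (inord 1); rewrite !inE !E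
      |by exists (inord 0), (inord 2); rewrite !inE !E
      |by exists (inord 0), (inord 3); rewrite !inE !E
      |by exists (inord 1), (inord 2); rewrite !inE !E
      |by exists (inord 1), (inord 3); rewrite !inE !E
      |by exists (inord 2), (inord 3); rewrite !inE !E].
Qed.

(** * Sylvester matrices *)

Section Sylvester.
Variable A : comNzRingType.

(* Sylvester matrix of p and q, of formal degrees n + 1 and n. *)
Definition sylvester n (p q : {poly A}) : 'M[A]_(n + n.+1) :=
  col_mx (\matrix_(i < n, j < n + n.+1) (p * 'X^i)`_j) (\matrix_(i < n.+1, j < n + n.+1) (q * 'X^i)`_j).

Lemma coef_rVpolyM m (a : 'rV[A]_m) (p : {poly A}) j :
  (rVpoly a * p)`_j = \sum_(i < m) a 0 i * (p * 'X^i)`_j.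
Proof.
rewrite /rVpoly poly_def mulr_suml coef_sum; apply: eq_bigr => i _.
by rewrite -scalerAl coefZ [p * _]mulrC insubT //= => lt_im; congr (a 0 _ * _); apply: val_inj.
Qed.

Lemma mul_row_sylvester n (p q : {poly A}) (a : 'rV_n) (b : 'rV_n.+1) j :
  (row_mx a b *m sylvester n p q) 0 j = (rVpoly a * p + rVpoly b * q)`_j.
Proof.
rewrite mul_row_col mxE coefD !coef_rVpolyM.
by congr (_ + _); rewrite mxE; apply: eq_bigr => i _; rewrite mxE.
Qed.

Lemma map_sylvester (B : comNzRingType) (g : {rmorphism A -> B}) n p q :
  map_mx g (sylvester n p q) =
  col_mx (\matrix_(i < n, j < n + n.+1) (map_poly g p * 'X^i)`_j)
         (\matrix_(i < n.+1, j < n + n.+1) (map_poly g q * 'X^i)`_j).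
Proof.
rewrite map_col_mx; congr col_mx; apply/matrixP => i j; rewrite !mxE;
  by rewrite -(map_polyXn g) -rmorphM coef_map.
Qed.

End Sylvester.

(** * Sylvester determinants over a field *)

Section SylvesterField.
Variable K : fieldType.

Lemma size_sylvester_comb n (p q : {poly K}) (a : 'rV_n) (b : 'rV_n.+1) :
  (size p <= n.+2)%N -> (size q <= n.+1)%N ->
  (size (rVpoly a * p + rVpoly b * q)%R <= n + n.+1)%N.
Proof.
move=> sp sq; have sa : (size (rVpoly a) <= n)%N by apply: size_poly.
have sb : (size (rVpoly b) <= n.+1)%N by apply: size_poly.
apply: leq_trans (size_polyD _ _) _; rewrite geq_max; apply/andP; split;
  apply: leq_trans (size_polyMleq _ _) _; lia.
Qed.

(** A vector in the left kernel is a syzygy a p + b q = 0 with deg b <= n < deg p; if p and q were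
    coprime, p would divide b. The exact size of p excludes a simultaneous drop of both degrees, see
    [sylvester_lead]. *)
Lemma det_sylvester0 n (p q : {poly K}) : size p = n.+2 -> (size q <= n.+1)%N ->
  \det (sylvester n p q) = 0 -> ~~ coprimep p q.
Proof.
move=> sp sq /eqP/det0P[v v0]; rewrite -[v]hsubmxK.
set a := lsubmx v; set b := rsubmx v => E.
have {}E : rVpoly a * p + rVpoly b * q = 0.
  apply/polyP => j; rewrite coef0; case: (ltnP j (n + n.+1)) => jn.
    by rewrite -[j]/(val (Ordinal jn)) -mul_row_sylvester E mxE.
  by rewrite nth_default // (leq_trans _ jn) // size_sylvester_comb // sp.
have p0 : p != 0 by rewrite -size_poly_eq0 sp.
apply: contra_neqN v0 => cop.
have b0 : rVpoly b = 0.
  apply: contraTeq (size_poly n.+1 (fun k => if insub k is Some i then b 0 i else 0)) => nz.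
  rewrite -ltnNge -sp -/(rVpoly b); apply: dvdp_leq => //.
  rewrite -(Gauss_dvdpl _ cop); move/eqP: E; rewrite addrC addr_eq0 => /eqP ->.
  by rewrite dvdpNr dvdp_mull.
have a0 : rVpoly a = 0.
  by move/eqP: E; rewrite b0 mul0r addr0 mulf_eq0 (negPf p0) orbF => /eqP.
rewrite -[v]hsubmxK -/a -/b -[a]rVpolyK -[b]rVpolyK a0 b0.
by rewrite !linear0 row_mx0.
Qed.

(** The vector of powers of a common root is annihilated by all rows. *)
Lemma sylvester_root n (p q : {poly K}) t : (size p <= n.+2)%N -> (size q <= n.+1)%N ->
  root p t -> root q t -> \det (sylvester n p q) = 0.
Proof.
move=> sp sq /eqP pt /eqP qt; apply/eqP; rewrite -det_tr; apply/det0P.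
exists (\row_(j < n + n.+1) t ^+ j).
  apply/rV0Pn; have lt0 : (0 < n + n.+1)%N by rewrite addnS.
  by exists (Ordinal lt0); rewrite mxE expr0 oner_eq0.
have ev (g : {poly K}) (i : nat) : g.[t] = 0 -> (size g + i <= n + n.+1)%N ->
    \sum_(j < n + n.+1) t ^+ j * (g * 'X^i)`_j = 0.
  move=> gt si; transitivity ((g * 'X^i).[t]); last by rewrite hornerM gt mul0r.
  rewrite (@horner_coef_wide _ (n + n.+1)); last first.
    by apply: leq_trans (size_polyMleq _ _) _; rewrite size_polyXn addnS.
  by apply: eq_bigr => j _; rewrite mulrC.
apply/rowP => i; rewrite [RHS]mxE mxE.
under eq_bigr => j _ do rewrite [(_^T) _ _]mxE [(\row_ _ _) _ _]mxE.
rewrite -(splitK i); case: (split i) => i' /=;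
  under eq_bigr => j _ do rewrite ?col_mxEu ?col_mxEd mxE;
  apply: ev => //; have := ltn_ord i'; lia.
Qed.

(** The case of a common root at infinity: the last column is zero. *)
Lemma sylvester_lead n (p q : {poly K}) : (size p <= n.+1)%N -> (size q <= n)%N ->
  \det (sylvester n p q) = 0.
Proof.
move=> sp sq; apply/eqP; rewrite -det_tr; apply/det0P.
have ltm : (n + n < n + n.+1)%N by rewrite addnS.
exists (delta_mx 0 (Ordinal ltm)).
  by apply/rV0Pn; exists (Ordinal ltm); rewrite mxE !eqxx oner_eq0.
rewrite -rowE; apply/rowP => i; rewrite !mxE.
by case: splitP => i' _; rewrite mxE coefMXn; case: ltnP => // _;
  rewrite nth_default //=; (apply: leq_trans sp _ || apply: leq_trans sq _);
  have := ltn_ord i'; lia.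
Qed.

(* The first column of the Sylvester matrix consists of the constant terms, so it
   is divisible by the parameter; the quotient is nonsingular at 0 because the
   only syzygies of p0 and q0 have a nonzero first coefficient. *)
Lemma sylvester_simple n (p q : {poly {poly K}}) (al be : {poly K}) (h k : {poly K}) :
  (0 < n)%N -> p`_0 = 'X * al -> q`_0 = 'X * be ->
  map_poly (horner_eval 0) p = 'X^2 * h -> map_poly (horner_eval 0) q = 'X * k ->
  size h = n -> (size k <= n)%N -> coprimep ('X * h) k -> al.[0] != 0 ->
  exists2 D, \det (sylvester n p q) = 'X * D & D.[0] != 0.
Proof.
move=> n0 p0 q0 pE qE sh sk cop al0.
have lt0 : (0 < n + n.+1)%N by rewrite addnS.
pose z0 := Ordinal lt0.
(* Only the first row of each block meets the constant coefficient, so the divided first column has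
   at most two nonzero entries, [al] and [be]. *)
pose red (R : comNzRingType) m (g : {poly R}) (c : R) : 'M[R]_(m, n + n.+1) :=
  \matrix_(i < m, j < n + n.+1) if j == z0 then (i == 0 :> nat)%:R * c else (g * 'X^i)`_j.
pose M := col_mx (red _ n p al) (red _ n.+1 q be).
pose Dg : 'rV[{poly K}]_(n + n.+1) := \row_j if j == z0 then 'X else 1.
have sylE : sylvester n p q = M *m diag_mx Dg.
  have redE m (g : {poly {poly K}}) c : g`_0 = 'X * c ->
      \matrix_(i < m, j < n + n.+1) (g * 'X^i)`_j = red _ m g c *m diag_mx Dg.
    move=> g0; apply/matrixP => i j; rewrite mul_mx_diag !mxE.
    case: eqP => [->|_]; last by rewrite mulr1.
    rewrite coefMXn /=; case: (val i) => [|i']; last by rewrite /= !mul0r.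
    by rewrite /= g0 mul1r mulrC.
  by rewrite /sylvester /M mul_col_mx (redE _ _ _ p0) (redE _ _ _ q0).
exists (\det M).
  rewrite sylE det_mulmx det_diag mulrC; congr (_ * _).
  by rewrite (bigD1 z0) //= big1 => [|j /negPf jz]; rewrite mxE ?eqxx ?mulr1 // jz.
rewrite -[_.[0]]/(horner_eval 0 _) -det_map_mx map_col_mx.
have mapred m (g : {poly {poly K}}) c : map_mx (horner_eval 0) (red _ m g c) =
    red _ m (map_poly (horner_eval 0) g) c.[0].
  apply/matrixP => i j; rewrite !mxE; case: eqP => _.
    by rewrite rmorphM rmorph_nat.
  transitivity ((map_poly (horner_eval 0) (g * 'X^i))`_j); first by rewrite coef_map.
  by rewrite rmorphM /= map_polyXn.
rewrite !mapred pE qE; apply/det0P => -[v]; rewrite -[v]hsubmxK; move: (lsubmx v) (rsubmx v) => a b ab0.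
rewrite mul_row_col => E.
have Ej j : j != z0 -> (rVpoly a * ('X^2 * h) + rVpoly b * ('X * k))`_j = 0.
  move=> /negPf jz; have := congr1 (fun N : 'M_(1, _) => N 0 j) E; rewrite !mxE => Ej; rewrite -[RHS]Ej.
  rewrite coefD !coef_rVpolyM; congr (_ + _);
  by apply: eq_bigr => i _; rewrite mxE jz.
have E0 : a 0 (Ordinal n0) * al.[0] + b 0 ord0 * be.[0] = 0.
  have := congr1 (fun N : 'M_(1, _) => N 0 z0) E; rewrite !mxE => Ez; rewrite -[RHS]Ez; congr (_ + _).
    rewrite (bigD1 (Ordinal n0)) //= mxE eqxx /= mul1r big1 ?addr0 // => i.
    by rewrite mxE eqxx -val_eqE /= => /negPf ->; rewrite mul0r mulr0.
  rewrite (bigD1 ord0) //= mxE eqxx /= mul1r big1 ?addr0 // => i.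
  by rewrite mxE eqxx -val_eqE /= => /negPf ->; rewrite mul0r mulr0.
have h0 : h != 0 by rewrite -size_poly_eq0 sh -lt0n.
have X0 : ('X : {poly K}) != 0 by rewrite polyX_eq0.
have {}E : 'X * (rVpoly a * ('X * h) + rVpoly b * k) = 0.
  have EX : 'X * (rVpoly a * ('X * h) + rVpoly b * k) =
      rVpoly a * ('X^2 * h) + rVpoly b * ('X * k) by ring.
  apply/polyP => j; rewrite coef0.
  have [->|j0] := posnP j; first by rewrite coefXM.
  rewrite EX; case: (ltnP j (n + n.+1)) => jn.
    by rewrite -[j]/(val (Ordinal jn)) Ej // -val_eqE /= -lt0n.
  rewrite nth_default // (leq_trans _ jn) // size_sylvester_comb //.
    by apply: leq_trans (size_polyMleq _ _) _; rewrite size_polyXn sh.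
  by apply: leq_trans (size_polyMleq _ _) _; rewrite size_polyX.
move: E => /eqP; rewrite mulf_eq0 (negPf X0) /= => /eqP E.
have sXh : size ('X * h) = n.+1 by rewrite mulrC size_mulX ?sh.
have sb : (size (rVpoly b) <= n.+1)%N by apply: size_poly.
have /dvdpP[c bE] : 'X * h %| rVpoly b.
  rewrite -(Gauss_dvdpl _ cop); move/eqP: E; rewrite addrC addr_eq0 => /eqP ->.
  by rewrite dvdpNr dvdp_mull.
have Xh0 : 'X * h != 0 by rewrite mulf_neq0.
have aE : rVpoly a = - c * k.
  apply: (mulIf Xh0); apply/eqP; rewrite -subr_eq0 -[X in _ == X]E bE; apply/eqP; ring.
have k0 : k.[0] != 0.
  by apply: (coprimep_root cop); rewrite /root hornerM hornerX mul0r.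
have a0 : a 0 (Ordinal n0) = - (c.[0] * k.[0]).
  by rewrite -coef_rVpoly_ord /= aE -horner_coef0 hornerM hornerN mulNr.
have b0 : b 0 ord0 = 0.
  by rewrite -coef_rVpoly_ord /= bE -horner_coef0 !hornerM hornerX mul0r mulr0.
have c0 : c.[0] = 0.
  move/eqP: E0; rewrite a0 b0 mul0r addr0 mulf_eq0 (negPf al0) orbF oppr_eq0.
  by rewrite mulf_eq0 (negPf k0) orbF => /eqP.
(* The degree of b is at most n, that of ['X * h], so [c] is a constant; the divided first column
   has already forced its value at 0 to vanish. *)
have cz : c = 0.
  apply: contraTeq sb => nz; rewrite bE -ltnNge size_mul // sXh.
  have : (1 < size c)%N.
    rewrite ltnNge; apply: contraNN nz => /size1_polyC cC.
    by move: c0; rewrite cC -horner_coef0 hornerC => ->.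
  by move: (size c) => m; lia.
case/eqP: ab0; rewrite -[a]rVpolyK -[b]rVpolyK aE bE cz oppr0 !mul0r.
by rewrite !linear0 row_mx0.
Qed.

End SylvesterField.

(** * Algebraic dependence by counting monomials *)

Section Homogenization.
Variables (R : comNzRingType) (n k : nat) (I : eqType) (s : seq I).
Variables (r : I -> R) (mm : I -> 'X_{1..n}).

(** The polynomial with terms [r a] times the monomial [mm a], homogenized to degree N by G and
    evaluated at F. Being defined over any ring, it commutes with substitutions and evaluations. *)
Definition hom_sum (A : comNzRingType) (h : R -> A) N (G : A) (F : 'I_n -> A) : A :=
  \sum_(a <- s) h (r a) * (G ^+ (N - mdeg (mm a)) * mmap1 F (mm a)).

Lemma rmorph_hom_sum (A B : comNzRingType) (h : R -> A) (g : {rmorphism A -> B}) N G F :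
  g (hom_sum h N G F) = hom_sum (g \o h) N (g G) (g \o F).
Proof.
rewrite rmorph_sum; apply: eq_bigr => a _; rewrite !rmorphM rmorphXn rmorph_prod.
by congr (_ * (_ * _)); apply: eq_bigr => i _; rewrite rmorphXn.
Qed.

Lemma mmap1_homog e (F : 'I_n -> {mpoly R[k]}) (m : 'X_{1..n}) :
  (forall i, F i \is e.-homog) -> mmap1 F m \is (e * mdeg m).-homog.
Proof.
move=> Fe; rewrite mdegE big_distrr /= /mmap1.
elim/big_rec2: _ => [|i p q _ IH]; first exact: dhomog1.
by rewrite dhomogM // dhomogMn.
Qed.

Lemma hom_sum_homog N e (G : {mpoly R[k]}) (F : 'I_n -> {mpoly R[k]}) :
  (forall a, a \in s -> (mdeg (mm a) <= N)%N) ->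
  G \is e.-homog -> (forall i, F i \is e.-homog) ->
  hom_sum (@mpolyC k R) N G F \is (e * N).-homog.
Proof.
move=> leN Ge Fe; rewrite /hom_sum big_seq; apply: rpred_sum => a /leN aN.
rewrite mul_mpolyC rpredZ //=; suff : G ^+ (N - mdeg (mm a)) * mmap1 F (mm a)
  \is (e * (N - mdeg (mm a)) + e * mdeg (mm a)).-homog by rewrite -mulnDr subnK.
by rewrite dhomogM ?dhomogMn ?mmap1_homog.
Qed.

End Homogenization.

Lemma hom_sum_field (K : fieldType) n (I : eqType) (s : seq I) (r : I -> K)
    (mm : I -> 'X_{1..n}) N (G : K) (F : 'I_n -> K) :
  (forall a, a \in s -> (mdeg (mm a) <= N)%N) -> G != 0 ->
  hom_sum s r mm id N G F =
  G ^+ N * (\sum_(a <- s) r a *: 'X_[mm a]).@[fun i => F i / G].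
Proof.
move=> leN G0; rewrite rmorph_sum mulr_sumr /hom_sum big_seq [RHS]big_seq.
apply: eq_bigr => a /leN aN; rewrite /= mevalZ mevalX [RHS]mulrCA; congr (_ * _).
under [in RHS]eq_bigr => i _ do rewrite exprMn exprVn.
rewrite big_split /= prodfV prodrXr -mdegE -{2}(subnK aN) exprD.
by rewrite [RHS]mulrCA mulrC mulfK ?expf_neq0.
Qed.

Section BoxCounting.
Variable K : fieldType.
Implicit Types p q : {mpoly K[4]}.

Definition boxed c p := forall m, m \in msupp p -> forall i, (m i <= c)%N.

Lemma boxedM c c' p q : boxed c p -> boxed c' q -> boxed (c + c') (p * q).
Proof.
move=> pc qc m /msuppM_le/allpairsP[[m1 m2] /= [/pc m1c /qc m2c ->]] i.
by rewrite mnmDE leq_add.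
Qed.

Lemma boxed1 : boxed 0 1.
Proof. by move=> m; rewrite msupp1 inE => /eqP -> i; rewrite mnm0E. Qed.

Lemma boxedX c p k : boxed c p -> boxed (c * k) (p ^+ k).
Proof.
move=> pc; elim: k => [|k IH]; first by rewrite muln0; apply: boxed1.
by rewrite exprS mulnS; apply: boxedM.
Qed.

Lemma boxed_leq c c' p : (c <= c')%N -> boxed c p -> boxed c' p.
Proof. by move=> cc' pc m /pc mc i; apply: leq_trans cc'. Qed.

Lemma boxed_exists p : exists c, boxed c p.
Proof.
exists (\max_(m <- msupp p) \max_i m i)%N => m mp i.
apply: leq_trans (leq_bigmax_seq _ mp _) => //; exact: leq_bigmax.
Qed.

Lemma boxed_mmap1 c (F : 'I_4 -> {mpoly K[4]}) (m : 'X_{1..4}) :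
  (forall i, boxed c (F i)) -> boxed (c * mdeg m) (mmap1 F m).
Proof.
move=> Fc; rewrite mdegE big_distrr /= /mmap1.
elim/big_rec2: _ => [|i p q _ IH]; first exact: boxed1.
by apply: boxedM => //; apply: boxedX.
Qed.

Definition box_mnm N (a : {ffun 'I_4 -> 'I_N}) : 'X_{1..4} := [multinom (a i : nat) | i < 4].

Lemma box_mnm_inj N : injective (@box_mnm N).
Proof.
move=> a b /mnmP ab; apply/ffunP => i; apply: val_inj.
by have := ab i; rewrite !mnmE.
Qed.

Lemma box_mnm_deg N (a : {ffun 'I_4 -> 'I_N}) : (mdeg (box_mnm a) <= 4 * N)%N.
Proof.
have {2}<- : #|{: 'I_4}| = 4%N by rewrite card_ord.
rewrite mdegE -sum_nat_const; apply: leq_sum => i _.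
by rewrite mnmE ltnW.
Qed.

Lemma boxed_mnm M p m : boxed M p -> m \in msupp p ->
  exists a : {ffun 'I_4 -> 'I_M.+1}, m = box_mnm a.
Proof.
move=> pM /pM mM; exists [ffun i => inord (m i)]; apply/mnmP => i.
by rewrite mnmE ffunE inordK // ltnS.
Qed.

Lemma mcoeff_box_sum N (r : {ffun 'I_4 -> 'I_N} -> K) a :
  (\sum_b r b *: 'X_[box_mnm b] : {mpoly K[4]})@_(box_mnm a) = r a.
Proof.
rewrite raddf_sum (bigD1 a) //= mcoeffZ mcoeffX eqxx mulr1 big1 ?addr0 // => b ba.
by rewrite mcoeffZ mcoeffX (inj_eq (@box_mnm_inj N)) (negPf ba) mulr0.
Qed.

Lemma dependent_exists (I : finType) (p : I -> {mpoly K[4]}) M :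
  (forall i, boxed M (p i)) -> (M.+1 ^ 4 < #|I|)%N ->
  exists2 r : I -> K, (exists i, r i != 0) & \sum_i r i *: p i = 0.
Proof.
move=> pM ltI; pose T := {ffun 'I_4 -> 'I_M.+1}.
pose B : 'M[K]_(#|I|, #|T|) := \matrix_(i, t) (p (enum_val i))@_(box_mnm (enum_val t)).
have : kermx B != 0.
  rewrite -mxrank_eq0 mxrank_ker subn_eq0 -ltnNge.
  by apply: leq_ltn_trans (rank_leq_col _) _; rewrite card_ffun !card_ord.
move=> /rowV0Pn[u /sub_kermxP uB /rV0Pn[i0 ui0]].
exists (fun i => u 0 (enum_rank i)); first by exists (enum_val i0); rewrite enum_valK.
apply/mpolyP => m; rewrite mcoeff0 raddf_sum /=.
have [[a ->]|no] := pselect (exists a : T, m = box_mnm a); last first.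
  apply: big1 => i _; rewrite mcoeffZ memN_msupp_eq0 ?mulr0 //.
  by apply/negP => /(boxed_mnm (pM i)); apply: no.
have /matrixP /(_ 0 (enum_rank a)) := uB; rewrite !mxE => E.
rewrite -[RHS]E (reindex_onto (@enum_val I I) enum_rank) => [|i _]; last exact: enum_rankK.
apply: eq_big => [i|i _]; first by rewrite enum_valK eqxx.
by rewrite mcoeffZ !mxE enum_rankK enum_valK.
Qed.

(** Put M = 4 N c + 1. Then M^4 - (M - c)^4 <= 4 c M^3, and M <= 5 N c for c > 0 bounds this by 500
    c^4 N^3, which is less than N^4 for N = 500 c^4 + 1. *)
Lemma box_arith c : exists N, ((4 * N * c).+1 ^ 4 < N ^ 4 + ((4 * N * c).+1 - c) ^ 4)%N.
Proof.
exists (500 * c ^ 4).+1; set N := (500 * c ^ 4).+1; set M := (4 * N * c).+1.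
have cM : (c <= M)%N by rewrite /M /N; nia.
have expand b : ((b + c) ^ 4 <= b ^ 4 + 4 * c * (b + c) ^ 3)%N by rewrite !expnS expn0; nia.
have MM' : (M = (M - c) + c)%N by rewrite subnK.
have := expand (M - c)%N; rewrite -MM' => /leq_ltn_trans; apply.
rewrite addnC ltn_add2r.
case: (posnP c) => [->|c0]; first by rewrite muln0 mul0n expn_gt0.
have M5 : (M <= 5 * (N * c))%N by rewrite /M; nia.
apply: (@leq_ltn_trans (4 * c * (5 * (N * c)) ^ 3)%N).
  by rewrite leq_mul2l leq_exp2r // M5 orbT.
have -> : (4 * c * (5 * (N * c)) ^ 3 = (500 * c ^ 4) * N ^ 3)%N by rewrite !expnS !expn0; ring.
by rewrite [X in (_ < X)%N]expnS ltn_mul2r expn_gt0 /= /N ltnSn.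
Qed.

(* Bounding the degree in each variable, the monomials of degree < N in the F_i
   are homogenized by G and compared with the multiples of H: there are N^4 of the
   former, while the box of side M = O(N) has only O(N^3) monomials modulo H. *)
Lemma algebraic_dependence (F : 'I_4 -> {mpoly K[4]}) (G H : {mpoly K[4]}) :
  H != 0 -> exists N (r : {ffun 'I_4 -> 'I_N} -> K) Q, (exists a, r a != 0) /\
    hom_sum (index_enum {ffun 'I_4 -> 'I_N}) r (@box_mnm N) (@mpolyC 4 K) (4 * N)%N G F
    = H * Q.
Proof.
move=> H0; have [cH Hc] := boxed_exists H; have [cG Gc] := boxed_exists G.
have /all_sig[cF Fc] i : {c | boxed c (F i)} by apply/cid/boxed_exists.
pose c := (cH + cG + \max_i cF i)%N.
have {}Hc : boxed c H by apply: boxed_leq Hc; rewrite /c; lia.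
have {}Gc : boxed c G by apply: boxed_leq Gc; rewrite /c; lia.
have {}Fc i : boxed c (F i).
  apply: boxed_leq (Fc i); apply: leq_trans (leq_bigmax i) _; rewrite /c; lia.
have [N ltN] := box_arith c; set M := (4 * N * c)%N in ltN.
pose I := {ffun 'I_4 -> 'I_N}; pose J := {ffun 'I_4 -> 'I_(M.+1 - c)}.
pose pI (a : I) := G ^+ (4 * N - mdeg (box_mnm a)) * mmap1 F (box_mnm a).
pose pJ (b : J) := H * 'X_[box_mnm b].
pose p (i : I + J) := match i with inl a => pI a | inr b => pJ b end.
have pM i : boxed M (p i).
  case: i => [a|b]; rewrite /p.
    have Bx := boxedM (boxedX (k := (4 * N - mdeg (box_mnm a))%N) Gc) (boxed_mmap1 (m := box_mnm a) Fc).
    apply: boxed_leq Bx.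
    by rewrite -mulnDr subnK ?box_mnm_deg // mulnC.
  move=> m /msuppM_le/allpairsP[[m1 m2] /= [/Hc m1c]].
  rewrite msuppX inE => /eqP -> -> l; rewrite mnmDE mnmE.
  have := ltn_ord (b l); have := m1c l; lia.
have [|r0 [i0 ri0] E] := dependent_exists pM.
  by rewrite card_sum !card_ffun !card_ord.
exists N, (fun a => r0 (inl a)), (- \sum_b r0 (inr b) *: 'X_[box_mnm b]).
have E' : hom_sum (index_enum I) (fun a => r0 (inl a)) (@box_mnm N) (@mpolyC 4 K) (4 * N)%N G F
    = H * (- \sum_b r0 (inr b) *: 'X_[box_mnm b]).
  move: E; rewrite big_sumType /= => /eqP; rewrite addr_eq0 => /eqP E.
  rewrite mulrN mulr_sumr; under [in RHS]eq_bigr => b _ do rewrite -scalerAr.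
  by rewrite -[RHS]E; apply: eq_bigr => a _; rewrite mul_mpolyC.
(* A relation without any [r a] would be H Q = 0, but the monomial multiples of H are linearly
   independent. *)
split=> //; apply: contrapT => no.
have rI0 a : r0 (inl a) = 0 by apply: contrapT => /eqP ra; apply: no; exists a.
move: E'; rewrite /hom_sum big1 => [|a _]; last by rewrite rI0 mpolyC0 mul0r.
move=> /esym/eqP; rewrite mulf_eq0 (negPf H0) oppr_eq0 => /eqP Q0.
case: i0 ri0 => [a|b]; first by rewrite rI0 eqxx.
by rewrite -(mcoeff_box_sum (fun b => r0 (inr b))) Q0 mcoeff0 eqxx.
Qed.

End BoxCounting.

(** * Tangent lines of a smooth surface without lines *)

Definition smooth_lineless_surface (K : fieldType) (S : set (proj K 3)) (d : nat)
    (f : {mpoly K[4]}) : Prop :=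
  [/\ irreducible_surface S, smooth_surface S & contains_no_line S] /\
  [/\ f \is d.-homog, (1 < d)%N &
      forall F, form F -> (vanishing_forms S F <-> exists G, F = G * f)].

Section Surface.
Variables (K : numClosedFieldType) (S : set (proj K 3)) (d : nat) (f : {mpoly K[4]}).
Hypothesis hS : smooth_lineless_surface S d f.
Implicit Types (x y : proj K 3) (r u v w : 'rV[K]_4) (L : grass_line K).

Let S_surface : irreducible_surface S. Proof. by case: hS => -[]. Qed.
Let S_smooth : smooth_surface S. Proof. by case: hS => -[]. Qed.
Let S_nolines : contains_no_line S. Proof. by case: hS => -[]. Qed.
Let f_homog : f \is d.-homog. Proof. by case: hS => _ []. Qed.
Let d_gt1 : (1 < d)%N. Proof. by case: hS => _ []. Qed.
Let f_gen F : form F -> (vanishing_forms S F <-> exists G, F = G * f).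
Proof. by case: hS => _ [_ _]; apply. Qed.

Lemma f_form : form f. Proof. by exists d. Qed.

Lemma surfaceP x : S x <-> f.@[hcoord x] = 0.
Proof.
have [[I If SI] _ _] := S_surface; split=> [Sx|fx].
  by have [_] := (f_gen f_form).2 (ex_intro _ 1 (esym (mul1r f))); apply.
rewrite SI => F IF; have [|G ->] := (f_gen (If F IF)).1; last by rewrite mevalM fx mulr0.
by split=> [|y]; [exact: If | rewrite SI => /(_ F IF)].
Qed.

Lemma surface_memP x r : r != 0 -> r \in val x -> S x <-> f.@[r 0] = 0.
Proof. by move=> r0 rx; rewrite surfaceP; apply: form_eval => //; apply: f_form. Qed.

Lemma tangent_spaceP x y : S x ->
  tangent_space S x y <-> dot (grad f (hvec x 0)) (hvec y 0) = 0.
Proof.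
move=> Sx; split=> [|nxy F vF].
  by move=> /(_ f); apply; apply/(f_gen f_form).2; exists 1; rewrite mul1r.
have [G ->] := (f_gen vF.1).1 vF.
by rewrite -[LHS]/(dot (grad (G * f) _) _) dot_gradM nxy (surfaceP x).1 // mulr0 mulr0 addr0.
Qed.

Lemma smooth_surface_at x : S x -> smooth_at S x.
Proof.
move=> Sx; apply: contrapT => nsm.
by have : Sing S x by []; rewrite S_smooth.
Qed.

(** Otherwise the differentials of all forms in the ideal vanish at r, so the tangent space is P^3,
    and smoothness would give S local dimension 3. *)
Lemma grad_neq0 r : r != 0 -> f.@[r 0] = 0 -> exists w : 'rV_4, dot (grad f (r 0)) (w 0) != 0.
Proof.
move=> r0 fr; apply: contrapT => all0.
have g0 w : dot (grad f (r 0)) (w 0) = 0.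
  by apply: contrapT => /eqP nw; apply: all0; exists w.
pose x := mkproj r0; have Sx : S x by apply/(surface_memP r0 (mem_mkproj r0)).
have [_ [m [U [[[Z [_ _ ZS _ [mZ _]]] _] TU dU]]]] := smooth_surface_at Sx.
have full w : w \in U.
  have [->|w0] := eqVneq w 0; first exact: mem0v.
  have : tangent_space S x (mkproj w0).
    move=> F vF; apply/(form_grad_eval vF.1 r0 (mem_mkproj r0) w0 (mem_mkproj w0)).
    have [G ->] := (f_gen vF.1).1 vF.
    by rewrite dot_gradM g0 fr !mulr0 addr0.
  by rewrite TU => /subvP; apply; apply: mem_mkproj.
have m3 : m = 3%N.
  suff UE : U = fullv by move: dU; rewrite UE dimvf /dim /= => -[].
  by apply/eqP; rewrite eqEsubv subvf /=; apply/subvP => w _.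
case: S_surface => _ _ [_]; apply.
by move: mZ; rewrite m3; apply: trdeg_ge_subset.
Qed.

Lemma grad_self r : f.@[r 0] = 0 -> dot (grad f (r 0)) (r 0) = 0.
Proof. by move=> fr; have := mmap_euler idfun (r 0) f_homog; rewrite -/(f.@[r 0]) fr mulr0. Qed.

Definition tgt u v := [/\ f.@[u 0] = 0, free [:: u; v] & dot (grad f (u 0)) (v 0) = 0].

Lemma free2_neq0 u v : free [:: u; v] -> u != 0 /\ v != 0.
Proof. by move=> /free_not0 nz; split; apply: nz; rewrite !inE eqxx ?orbT. Qed.

Lemma mem_mkline u v (uv : free [:: u; v]) : u \in val (mkline uv) /\ v \in val (mkline uv).
Proof. by rewrite val_mkline; split; apply: memv_span; rewrite !inE eqxx ?orbT. Qed.

Lemma tgt_tangent_at u v L (u0 : u != 0) :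
  tgt u v -> u \in val L -> v \in val L -> tangent_at S L (mkproj u0).
Proof.
move=> [fu uv nv] uL vL.
have Su : S (mkproj u0) by apply/(surface_memP u0 (mem_mkproj u0)).
split; [exact: smooth_surface_at | | move=> y].
  by rewrite /points /=; apply/subvP => _ /vlineP[s ->]; apply: memvZ.
move=> /mem_pointsE; rewrite (line_span uL vL uv) => /mem_span2[s [t yE]].
move=> F vF; apply/(form_grad_eval vF.1 u0 (mem_mkproj u0) (hvec_neq0 y) (memv_pick _)).
have [G ->] := (f_gen vF.1).1 vF; rewrite dot_gradM fu mulr0 add0r -/(hvec y) yE.
have -> : (s *: u + t *: v) 0 = (fun i => s * u 0 i + t * v 0 i).
  by apply: funext => i; rewrite !mxE.
by rewrite dot_lin nv grad_self // !mulr0 addr0 mulr0.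
Qed.

Lemma free2_exists L r : r != 0 -> r \in val L -> exists v, free [:: r; v] /\ v \in val L.
Proof.
move=> r0 rL; have [u [v [uv LE]]] := line_basis L.
have mL w : w \in [:: u; v] -> w \in val L by rewrite LE; apply: memv_span.
have [|ru] := boolP (free [:: r; u]); first by exists u; split=> //; apply: mL; rewrite inE eqxx.
exists v; split; last by apply: mL; rewrite !inE eqxx orbT.
rewrite free2P; apply: contraNneq r0 => rv0.
move: rL; rewrite LE => /mem_span2[s [t rE]].
move: ru; rewrite free2P negbK => /eqP ru0.
have uv0 := wedgev_neq0 uv.
have suv : s *: wedgev u v = 0.
  by rewrite -rv0 rE; apply/rowP => k; rewrite !mxE /wedge !mxE; ring.
have tuv : t *: wedgev u v = 0.
  rewrite -[RHS]oppr0 -ru0 rE; apply/rowP => k; rewrite !mxE /wedge !mxE; ring.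
move: suv tuv => /eqP; rewrite scaler_eq0 (negPf uv0) orbF => /eqP s0 /eqP.
by rewrite scaler_eq0 (negPf uv0) orbF => /eqP t0; rewrite rE s0 t0 !scale0r addr0.
Qed.

Lemma tangent_at_tgt L x : tangent_at S L x -> exists v, [/\ tgt (hvec x) v,
  v \in val L & hvec x \in val L].
Proof.
move=> [[Sx _] /mem_pointsE xL LT].
have [v [xv vL]] := free2_exists (hvec_neq0 x) xL.
exists v; split=> //; split=> //; first exact/surfaceP.
have [_ v0] := free2_neq0 xv.
have : points (val L) (mkproj v0).
  apply/mem_pointsE; have /vlineP[c ->] : hvec (mkproj v0) \in <[v]>%VS := memv_pick _.
  exact: memvZ.
move=> /LT /(tangent_spaceP _ Sx); have [c c0 vE] := hvec_mkproj v0.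
by move=> nv; rewrite vE scale_rowE dotZ nv mulr0.
Qed.

Lemma surface_neq0 : exists r, r != 0 /\ f.@[r 0] = 0.
Proof.
have [_ [[x Sx] _] _] := S_surface; exists (hvec x).
by split; [exact: hvec_neq0 | exact/surfaceP].
Qed.

(** If the partial derivatives other than the i-th vanished, Euler's relation and [r 0 i != 0] would
    kill the i-th as well. The result is an affine chart in which S is locally a graph over the
    coordinates k and l. *)
Lemma frame_at r i : f.@[r 0] = 0 -> r 0 i != 0 ->
  exists j k l : 'I_4, uniq [:: i; j; k; l] /\ grad f (r 0) j != 0.
Proof.
move=> fr ri; have r0 : r != 0 by apply/rV0Pn; exists i.
suff [j [ij gj]] : exists j, j != i /\ grad f (r 0) j != 0.
  rewrite eq_sym in ij; have [k [l uq]] := ord4_complete ij.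
  by exists j, k, l.
apply: contrapT => no; have g0 j : j != i -> grad f (r 0) j = 0.
  by move=> ji; apply: contrapT => /eqP gj; apply: no; exists j.
have gi : grad f (r 0) i = 0.
  have := grad_self fr; rewrite /dot (bigD1 i) //= big1 => [|j /g0 ->]; last by rewrite mul0r.
  by rewrite addr0 => /eqP; rewrite mulf_eq0 (negPf ri) orbF => /eqP.
have [w] := grad_neq0 r0 fr; rewrite /dot big1 ?eqxx // => j _.
by have [->|/g0 ->] := eqVneq j i; rewrite ?gi mul0r.
Qed.

Definition kvec (a b : K) (i j : 'I_4) : 'rV[K]_4 := a *: delta_mx 0 i + b *: delta_mx 0 j.

Lemma dot_kvec (n : 'I_4 -> K) a b i j : dot n (kvec a b i j 0) = a * n i + b * n j.
Proof.
rewrite /dot /kvec; under eq_bigr => l _ do rewrite !mxE eqxx /= mulrDr.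
rewrite big_split /= (bigD1 i) //= eqxx big1 => [|l /negPf ->]; last by rewrite !mulr0.
rewrite (bigD1 j) //= eqxx [X in _ + (_ + X)]big1 => [|l /negPf ->]; last by rewrite !mulr0.
by rewrite /=; ring.
Qed.

Lemma tgt_at r : r != 0 -> f.@[r 0] = 0 -> exists v, tgt r v.
Proof.
move=> r0 fr; have [i ri] : exists i, r 0 i != 0 by apply/rV0Pn.
have [j [k [l [uq gj]]]] := frame_at fr ri.
(* The direction k, corrected along j so as to be tangent. *)
exists (kvec (grad f (r 0) j) (- grad f (r 0) k) k j); split=> //; last first.
  by rewrite dot_kvec; ring.
rewrite free2P; apply/eqP => /(congr1 (fun M : 'rV_6 => pcoord (M 0) i k)).
rewrite wedgevE pcoord_wedge !mxE eqxx /=.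
move: uq; rewrite /= !inE !negb_or => /andP[/and3P[ij ik il] /andP[/andP[jk jl] _]].
rewrite [k == j]eq_sym (negPf jk) eqxx (negPf ik) (negPf ij) /= !mulr0 mulr1 !addr0 mulr0 subr0.
have -> : pcoord ((0 : 'rV[K]_6) 0) i k = 0.
  by rewrite /pcoord !mxE oppr0; case: ifP => // _; case: ifP.
by move=> /eqP; rewrite mulf_eq0 (negPf ri) (negPf gj).
Qed.

Lemma tgt_exists : exists u v, tgt u v.
Proof.
by have [r [r0 fr]] := surface_neq0; have [v rv] := tgt_at r0 fr; exists r, v.
Qed.

(** When v is already tangent at u, the family passes through the line u /\ v itself, up to a
    scalar. This carries statements about pullbacks on S back to single tangent lines. *)
Lemma meval_tangent_comp_tgt e (F : {mpoly K[6]}) u v (w : 'I_4 -> K) :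
  F \is e.-homog -> tgt u v -> (tangent_comp f (v 0) w F).@[u 0] =
  dot (grad f (u 0)) w ^+ e * F.@[wedge (u 0) (v 0)].
Proof.
move=> Fe [_ _ nv]; rewrite meval_tangent_comp nv -(meval_homogZ _ _ Fe).
by congr meval; apply: funext => k; rewrite /wedge; ring.
Qed.

(** For members of the tangent family that degenerate to the zero bivector. As [0 ^+ 0] is 1, the
    formula also covers constant forms. *)
Lemma form_at0 e n (F : {mpoly K[n.+1]}) (M : 'I_n.+1 -> K) : F \is e.-homog ->
  F.@[fun=> 0] = 0 ^+ e * F.@[M].
Proof.
by move=> Fe; rewrite -(meval_homogZ _ _ Fe); congr meval; apply: funext => k; rewrite mul0r.
Qed.

Definition tangent_lines : set (grass_line K) := [set L | exists x, tangent_at S L x].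

Definition hurwitz : set (proj K 5) := zariski_closure (@pluecker K @` tangent_lines).

Lemma vanishing_tgtP (F : {mpoly K[6]}) : form F ->
  vanishing_forms (@pluecker K @` tangent_lines) F <->
  (forall u v, tgt u v -> F.@[wedge (u 0) (v 0)] = 0).
Proof.
move=> Ff; split=> [[_ F0] u v uvt|F0].
  have [fu uv nv] := uvt; have [u0 _] := free2_neq0 uv.
  have [uL vL] := mem_mkline uv.
  apply/(form_pluecker Ff uL vL uv)/F0; exists (mkline uv) => //.
  by exists (mkproj u0); apply: tgt_tangent_at uvt _ _.
split=> // _ [L [x /tangent_at_tgt[v [xv vL xL]]] <-].
by apply/(form_pluecker Ff xL vL); [case: xv | exact: F0].
Qed.

Lemma vanishing_hurwitzP (F : {mpoly K[6]}) :
  vanishing_forms hurwitz F <->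
  form F /\ (forall u v, tgt u v -> F.@[wedge (u 0) (v 0)] = 0).
Proof.
split=> [/vanishing_closure vF|[Ff F0]].
  by split; [exact: vF.1 | apply/(vanishing_tgtP vF.1)].
by apply/vanishing_closure/(vanishing_tgtP Ff).
Qed.

Lemma surface_memI r : r != 0 -> f.@[r 0] = 0 -> exists x, S x /\ r \in val x.
Proof.
move=> r0 fr; exists (mkproj r0); split; last exact: mem_mkproj.
exact/(surface_memP r0 (mem_mkproj r0)).
Qed.

Lemma tangent_comp_eq0 e (F : {mpoly K[6]}) r (v w : 'I_4 -> K) :
  F \is e.-homog -> r != 0 -> f.@[r 0] = 0 ->
  (forall u, tgt r u -> F.@[wedge (r 0) (u 0)] = 0) ->
  (tangent_comp f v w F).@[r 0] = 0.
Proof.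
move=> Fe r0 fr F0; rewrite meval_tangent_comp.
set u := fun i => _; pose ur : 'rV_4 := \row_i u i.
have urE : ur 0 = u by apply: funext => i; rewrite mxE.
have nu : dot (grad f (r 0)) u = 0.
  rewrite /u; set a := dot _ w; set b := dot _ v.
  have -> : (fun i => a * v i - b * w i) = (fun i => a * v i + (- b) * w i).
    by apply: funext => i; rewrite mulNr.
  by rewrite dot_lin -/a -/b; ring.
have [xu|] := boolP (free [:: r; ur]).
  by rewrite -urE; apply: F0; split=> //; rewrite urE.
move=> /wedgev_dep xu0; have [v1 uv1] := tgt_at r0 fr.
have -> : wedge (r 0) u = (fun=> 0).
  by rewrite -urE -wedgevE xu0; apply: funext => k; rewrite mxE.
by rewrite (form_at0 (wedge (r 0) (v1 0)) Fe) F0 // mulr0.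
Qed.

Lemma tangent_comp_form (v w : 'I_4 -> K) (F : {mpoly K[6]}) :
  form F -> form (tangent_comp f v w F).
Proof.
move=> [e Fe]; exists (d * e)%N; apply: dhomog_mmap => // k.
exact: tangent_poly_homog f_homog (ltnW d_gt1).
Qed.

Lemma hurwitz_comp e (F : {mpoly K[6]}) : F \is e.-homog ->
  (forall u v, tgt u v -> F.@[wedge (u 0) (v 0)] = 0) ->
  forall v w : 'I_4 -> K, exists g, tangent_comp f v w F = g * f.
Proof.
move=> Fe F0 v w; have Gf : form (tangent_comp f v w F).
  by apply: tangent_comp_form; exists e.
apply/(f_gen Gf); split=> // x /surfaceP fx.
by apply: (tangent_comp_eq0 _ _ Fe (hvec_neq0 x) fx) => u; apply: F0.
Qed.

Lemma restr_neq0 u v : free [:: u; v] -> restr f (u 0) (v 0) != 0.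
Proof.
move=> uv; apply/eqP => p0; case: (S_nolines (L := mkline uv)) => y.
rewrite val_mkline => /mem_pointsE /mem_span2[s [t yE]].
have fs s' t' : s' != 0 -> f.@[fun i => s' * u 0 i + t' * v 0 i] = 0.
  move=> s0; have := congr1 (horner^~ (t' / s')) p0; rewrite horner_restr horner0 => f0.
  rewrite -[RHS](mulr0 (s' ^+ d)) -f0 -(meval_homogZ _ _ f_homog).
  by congr meval; apply: funext => i; rewrite mulrDr !mulrA [s' * t']mulrC mulfK.
apply/surfaceP; rewrite -[hcoord y]/(hvec y 0) yE.
have -> : (s *: u + t *: v) 0 = (fun i => s * u 0 i + t * v 0 i).
  by apply: funext => i; rewrite !mxE.
have [->|/fs //] := eqVneq s 0.
(* The point v is the case s = 0, which [fs] does not cover; it follows because f(s u + t v) is a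
   polynomial in s with zeros at all s != 0. *)
have /(congr1 (horner^~ 0)) : restr f (fun i => t * v 0 i) (u 0) = 0.
  apply: poly_mulX0 => s' s'0; rewrite horner_restr -[RHS](fs s' t s'0).
  by congr meval; apply: funext => i; rewrite addrC.
rewrite restr0 horner0 => ftv; rewrite -[RHS]ftv.
by congr meval; apply: funext => i; rewrite mul0r add0r.
Qed.

Lemma tgt_contact u v : tgt u v ->
  exists m psi, restr f (u 0) (v 0) = 'X^(m.+2) * psi /\ psi.[0] != 0.
Proof.
move=> [fu uv nv]; have [m [psi [pE psi0]]] := polyX_factor (restr_neq0 uv).
case: m pE => [|[|m]] pE; last by exists m, psi.
  by move: psi0; have := restr0 f (u 0) (v 0); rewrite pE fu mul1r => ->; rewrite eqxx.
move: psi0; have := deriv_restr0 f (u 0) (v 0).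
rewrite pE nv expr1 derivM derivX hornerD !hornerM hornerX hornerC mul1r mul0r addr0 => ->.
by rewrite eqxx.
Qed.

Lemma hurwitz_kernel (F : {mpoly K[6]}) u v : vanishing_forms hurwitz F -> tgt u v ->
  let th := dot (grad F (wedge (u 0) (v 0))) in
  (forall z, th (wedge (u 0) z) = 0) /\
  exists c, (forall z, th (wedge z (v 0)) = c * dot (grad f (u 0)) z) /\
    ('X^3 %| restr f (u 0) (v 0) -> c = 0).
Proof.
move=> /vanishing_hurwitzP[[e Fe] F0] uvt; have [fu uv nv] := uvt.
have [m [psi [pE psi0]]] := tgt_contact uvt.
have [u0 _] := free2_neq0 uv; have [w nw] := grad_neq0 u0 fu.
have [thx [c [thc c0]]] := tangent_kernel Fe (hurwitz_comp Fe F0) fu nv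
  (ex_intro _ (w 0) nw) pE psi0.
split=> //; exists c; split=> // X3; apply: c0; rewrite lt0n; apply/eqP => m0.
move: X3; rewrite pE m0 exprSr dvdp_mul2l ?expf_neq0 ?polyX_eq0 //.
by move=> /dvdpP[q psiE]; move: psi0; rewrite psiE hornerM hornerX mulr0 eqxx.
Qed.

Lemma surface_irr (I1 I2 : set {mpoly K[4]}) : I1 `<=` form -> I2 `<=` form ->
  (forall r, r != 0 -> f.@[r 0] = 0 ->
    (forall G, I1 G -> G.@[r 0] = 0) \/ (forall G, I2 G -> G.@[r 0] = 0)) ->
  (forall r G, r != 0 -> f.@[r 0] = 0 -> I1 G -> G.@[r 0] = 0) \/
  (forall r G, r != 0 -> f.@[r 0] = 0 -> I2 G -> G.@[r 0] = 0).
Proof.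
move=> I1f I2f I12; have [_ [_ irr] _] := S_surface.
have zl (I : set {mpoly K[4]}) : I `<=` form -> zariski_closed (zero_locus I) by exists I.
have fin I : I `<=` form -> S `<=` zero_locus I ->
    forall r G, r != 0 -> f.@[r 0] = 0 -> I G -> G.@[r 0] = 0.
  move=> If SI r G r0 fr IG; have [x [Sx rx]] := surface_memI r0 fr.
  by apply/(form_eval (If _ IG) r0 rx); apply: SI.
have [|S1|S2] := irr _ _ (zl _ I1f) (zl _ I2f); [|by left; apply: fin|by right; apply: fin].
move=> x /surfaceP fx; have [H|H] := I12 _ (hvec_neq0 x) fx; [left|right] => G; exact: H.
Qed.

(* For fixed (v, w) the forms tangent_comp f v w F live on S, whose irreducibility is
   used; two parameters (v, w) are joined by an affine line. *)
Lemma hurwitz_irreducible : zariski_irreducible hurwitz.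
Proof.
split.
  have [u [v uvt]] := tgt_exists; have [_ uv _] := uvt; have [u0 _] := free2_neq0 uv.
  exists (pluecker (mkline uv)); apply: subset_closureX; exists (mkline uv) => //.
  by exists (mkproj u0); have [uL vL] := mem_mkline uv; apply: tgt_tangent_at uvt _ _.
move=> Z1 Z2 [I1 I1f ->] [I2 I2f ->] X12.
pose J (I : set {mpoly K[6]}) : set {mpoly K[4]} :=
  [set G | exists (v w : 'I_4 -> K) F, I F /\ G = tangent_comp f v w F].
have Jf I : I `<=` form -> J I `<=` form.
  by move=> If _ [v [w [F [/If Ff ->]]]]; apply: tangent_comp_form.
have fin I : I `<=` form -> (forall r G, r != 0 -> f.@[r 0] = 0 -> J I G -> G.@[r 0] = 0) ->
    hurwitz `<=` zero_locus I.
  move=> If J0 p Xp F IF; have [e Fe] := If _ IF.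
  suff vF : vanishing_forms hurwitz F by apply: vF.2.
  apply/vanishing_hurwitzP; split=> [|u v uvt]; first exact: If.
  have [fu uv _] := uvt; have [u0 _] := free2_neq0 uv; have [w nw] := grad_neq0 u0 fu.
  have := J0 u (tangent_comp f (v 0) (w 0) F) u0 fu.
  rewrite (meval_tangent_comp_tgt _ Fe uvt) => E.
  have /eqP := E (ex_intro _ _ (ex_intro _ _ (ex_intro _ _ (conj IF erefl)))).
  by rewrite mulf_eq0 expf_eq0 (negPf nw) andbF => /eqP.
have X12v u v F1 F2 : tgt u v -> I1 F1 -> I2 F2 ->
    F1.@[wedge (u 0) (v 0)] = 0 \/ F2.@[wedge (u 0) (v 0)] = 0.
  move=> uvt IF1 IF2; have [_ uv _] := uvt; have [u0 _] := free2_neq0 uv.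
  have [uL vL] := mem_mkline uv.
  have /X12[Zp|Zp] : hurwitz (pluecker (mkline uv)).
  - apply: subset_closureX; exists (mkline uv) => //.
    by exists (mkproj u0); apply: tgt_tangent_at uvt _ _.
  - by left; apply/(form_pluecker (I1f _ IF1) uL vL uv)/Zp.
  - by right; apply/(form_pluecker (I2f _ IF2) uL vL uv)/Zp.
have [|H|H] := surface_irr (Jf _ I1f) (Jf _ I2f); [|by left; apply: fin|by right; apply: fin].
move=> r r0 fr; apply: contrapT => /not_orP[/existsNP[G1 /not_implyP[[v1 [w1 [F1 [IF1 ->]]]] G1r]]].
move=> /existsNP[G2 /not_implyP[[v2 [w2 [F2 [IF2 ->]]]] G2r]].
move: G1r G2r; rewrite !meval_tangent_comp; set n := grad f (r 0) => G1r G2r.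
pose V := curve v1 (fun i => v2 i - v1 i); pose W := curve w1 (fun i => w2 i - w1 i).
pose T i := dot (@polyC K \o n) W * V i - dot (@polyC K \o n) V * W i.
pose Tv s i := (T i).[s]; pose Vs s i := (V i).[s]; pose Ws s i := (W i).[s].
have TvE s i : Tv s i = dot n (Ws s) * Vs s i - dot n (Vs s) * Ws s i.
  have evd (Y : 'I_4 -> {poly K}) :
      (dot (@polyC K \o n) Y).[s] = dot n (fun l => (Y l).[s]).
    rewrite -[LHS]/(horner_eval s _) rmorph_dot; congr dot.
    by apply: funext => l; rewrite /= /horner_eval hornerC.
  by rewrite /Tv /T hornerD hornerN !hornerM !evd.
have pE F s : (mmap (@polyC K) (wedge (@polyC K \o r 0) T) F).[s] = F.@[wedge (r 0) (Tv s)].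
  rewrite horner_mmap; congr meval; apply: funext => k.
  rewrite -[LHS]/(horner_eval s _) wedge_rmorph; congr (wedge _ _ k).
  by apply: funext => l; rewrite /= /horner_eval hornerC.
have V0 : Vs 0 = v1 by apply: curve0.
have W0 : Ws 0 = w1 by apply: curve0.
have V1 : Vs 1 = v2.
  by apply: funext => l; rewrite /Vs /V /curve !hornerE /=; ring.
have W1 : Ws 1 = w2.
  by apply: funext => l; rewrite /Ws /W /curve !hornerE /=; ring.
have nz1 : mmap (@polyC K) (wedge (@polyC K \o r 0) T) F1 != 0.
  apply/eqP => /(congr1 (horner^~ 0)); rewrite pE horner0; move: G1r.
  by rewrite -V0 -W0; congr (_ <> _); congr meval; congr wedge; apply: funext => i; rewrite TvE.
have nz2 : mmap (@polyC K) (wedge (@polyC K \o r 0) T) F2 != 0.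
  apply/eqP => /(congr1 (horner^~ 1)); rewrite pE horner0; move: G2r.
  by rewrite -V1 -W1; congr (_ <> _); congr meval; congr wedge; apply: funext => i; rewrite TvE.
(* At this s neither F1 nor F2 vanishes, although the corresponding line is tangent at r, unless it
   degenerates. *)
have [s] := poly_nonroot (mulf_neq0 nz1 nz2); rewrite hornerM mulf_eq0 negb_or !pE.
pose ur : 'rV_4 := \row_i Tv s i; have urE : Tv s = ur 0.
  by apply: funext => i; rewrite mxE.
rewrite urE => /andP[/eqP F1s /eqP F2s].
have nu : dot n (ur 0) = 0.
  rewrite -urE; have -> : Tv s = (fun i => dot n (Ws s) * Vs s i + (- dot n (Vs s)) * Ws s i).
    by apply: funext => i; rewrite TvE mulNr.
  by rewrite dot_lin; ring.
have [ruf|/wedgev_dep ru0] := boolP (free [:: r; ur]).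
  by have [|/F1s|/F2s] := X12v r ur F1 F2 _ IF1 IF2.
(* In the degenerate case F1 and F2 are nonzero at the zero bivector, hence nonzero constants, and
   any tangent line contradicts [X12v]. *)
have [u1 [v1' uvt]] := tgt_exists; move: F1s F2s; rewrite -!wedgevE ru0.
have -> : (0 : 'rV[K]_6) 0 = (fun=> 0) by apply: funext => k; rewrite mxE.
have [[e1 Fe1] [e2 Fe2]] := (I1f _ IF1, I2f _ IF2).
rewrite (form_at0 (wedge (u1 0) (v1' 0)) Fe1) (form_at0 (wedge (u1 0) (v1' 0)) Fe2).
by case: (X12v _ _ F1 F2 uvt IF1 IF2) => ->; rewrite ?mulr0.
Qed.

(** On the irreducible S either H or all pullbacks of F vanish identically, and the former is
    excluded. Vanishing on CH_1(S) may therefore be checked at contact points in a chart. *)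
Lemma hurwitz_generic (H : {mpoly K[4]}) (F : {mpoly K[6]}) :
  form H -> (exists r, [/\ r != 0, f.@[r 0] = 0 & H.@[r 0] != 0]) -> form F ->
  (forall u v, tgt u v -> H.@[u 0] != 0 -> F.@[wedge (u 0) (v 0)] = 0) ->
  forall u v, tgt u v -> F.@[wedge (u 0) (v 0)] = 0.
Proof.
move=> Hf [r [r0 fr Hr]] [e Fe] F0 u v uvt.
pose J : set {mpoly K[4]} :=
  [set G | exists v w : 'I_4 -> K, G = tangent_comp f v w F].
have Jf : J `<=` form by move=> _ [v' [w' ->]]; apply: tangent_comp_form; exists e.
have Hs : [set H] `<=` form by move=> _ ->.
have [|HS|JS] := surface_irr Hs Jf.
- move=> x x0 fx; have [Hx|Hx] := eqVneq (H.@[x 0]) 0; first by left=> _ ->.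
  right=> _ [v' [w' ->]]; apply: (tangent_comp_eq0 _ _ Fe x0 fx) => u' xu.
  exact: F0.
- by case/eqP: Hr; apply: HS.
have [fu uv _] := uvt; have [u0 _] := free2_neq0 uv; have [w nw] := grad_neq0 u0 fu.
have /eqP := JS u (tangent_comp f (v 0) (w 0) F) u0 fu
  (ex_intro _ _ (ex_intro _ _ erefl)).
rewrite (meval_tangent_comp_tgt _ Fe uvt) mulf_eq0 expf_eq0 (negPf nw) andbF.
by move=> /eqP.
Qed.

End Surface.

(** * The dimension of the Hurwitz hypersurface *)

Lemma ord4_mem (i j k l a : 'I_4) : uniq [:: i; j; k; l] -> a \in [:: i; j; k; l].
Proof.
move=> uq; have sz : size (enum 'I_4) = 4 by rewrite size_enum_ord.
have sub : {subset [:: i; j; k; l] <= enum 'I_4} by move=> b _; rewrite mem_enum.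
have [|_ ->] := uniq_min_size uq sub; first by rewrite sz.
by rewrite mem_enum.
Qed.

Lemma ord4_sum (V : nmodType) (F : 'I_4 -> V) i j k l : uniq [:: i; j; k; l] ->
  \sum_a F a = F i + F j + F k + F l.
Proof.
move=> uq; transitivity (\sum_(a <- [:: i; j; k; l]) F a).
  apply: perm_big; apply: uniq_perm; rewrite ?index_enum_uniq // => a.
  by rewrite mem_index_enum ord4_mem.
by rewrite !big_cons big_nil addr0 !addrA.
Qed.

Lemma ord4_sumE (V : nmodType) (F : 'I_4 -> V) :
  \sum_a F a = F (inord 0) + F (inord 1) + F (inord 2) + F (inord 3).
Proof. by apply: ord4_sum; rewrite /= !inE -!val_eqE /= !inordK. Qed.

Lemma uniq4_neq (T : eqType) (i j k l : T) : uniq [:: i; j; k; l] ->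
  [/\ (i == j) = false, (i == k) = false & (i == l) = false] /\
  [/\ (j == k) = false, (j == l) = false & (k == l) = false].
Proof.
rewrite /= !inE !negb_or !andbT => /and3P[/and3P[ij ik il] /andP[jk jl] kl].
by split; split; apply/negbTE.
Qed.

Section Chart.
Variables (K : numClosedFieldType) (S : set (proj K 3)) (d : nat) (f : {mpoly K[4]}).
Hypothesis hS : smooth_lineless_surface S d f.
Implicit Types (r u v w : 'rV[K]_4).

Let f_homog : f \is d.-homog. Proof. by case: hS => _ []. Qed.

(** If v_i = 0, the first three coordinates are u_i times v_k, v_l, v_j and record the direction of
    the line; the last also involves the contact point through u_k and u_l. The entry 0 serves as
    denominator in [trdeg_hurwitz_ge3]. *)
Definition chart (i j k l : 'I_4) (m : 'I_4) : {mpoly K[6]} :=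
  nth 0 [:: pform K i k; pform K i l; pform K i j; pform K k l] m.

Lemma chart_homog i j k l m : chart i j k l m \is 1.-homog.
Proof. by case: m => -[|[|[|[|?]]]] ? //=; apply: pform_homog. Qed.

Lemma chartE i j k l : [/\ chart i j k l (inord 0) = pform K i k,
  chart i j k l (inord 1) = pform K i l, chart i j k l (inord 2) = pform K i j
  & chart i j k l (inord 3) = pform K k l].
Proof. by rewrite /chart !inordK. Qed.

Lemma tgt_reduce u v (i : 'I_4) : tgt f u v -> u 0 i != 0 ->
  exists v', [/\ tgt f u v', v' 0 i = 0 & wedge (u 0) (v' 0) = wedge (u 0) (v 0)].
Proof.
move=> [fu uv nv] ui; pose t := v 0 i / u 0 i; exists (v - t *: u).
have wE : wedge (u 0) ((v - t *: u) 0) = wedge (u 0) (v 0).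
  by apply: funext => k; rewrite /wedge !mxE; ring.
split=> //; last by rewrite !mxE /t divfK // subrr.
split=> //.
  rewrite free2P; have -> : wedgev u (v - t *: u) = wedgev u v.
    by apply/rowP => k; rewrite !mxE wE.
  exact: wedgev_neq0.
have -> : (v - t *: u) 0 = (fun i => 1 * v 0 i + (- t) * u 0 i).
  by apply: funext => a; rewrite !mxE; ring.
by rewrite dot_lin nv (grad_self hS) // !mulr0 addr0.
Qed.

Lemma tgt_coord_neq0 u v (i j k l : 'I_4) : uniq [:: i; j; k; l] -> tgt f u v ->
  v 0 i = 0 -> grad f (u 0) j != 0 -> v 0 k != 0 \/ v 0 l != 0.
Proof.
move=> uq [_ uv nv] vi nj; apply/orP; apply: contraT.
rewrite negb_or !negbK => /andP[/eqP vk /eqP vl].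
have vj : v 0 j = 0.
  move: nv; rewrite /dot (ord4_sum _ uq) vi vk vl !mulr0 !addr0 add0r => /eqP.
  by rewrite mulf_eq0 (negPf nj) => /eqP.
have [_ /eqP[]] := free2_neq0 uv; apply/rowP => a; rewrite mxE.
by have := ord4_mem a uq; rewrite !inE => /or4P[] /eqP ->.
Qed.

(* The tangent space at u /\ v contains u /\ K^4 and v /\ T_u, which forces all the
   partial derivatives of H to vanish on the Hurwitz hypersurface. *)
Lemma chart_indep i j k l N (H : {mpoly K[4]}) : uniq [:: i; j; k; l] ->
  (exists r, [/\ f.@[r 0] = 0, r 0 i != 0 & grad f (r 0) j != 0]) ->
  H \is N.-homog ->
  (forall u v, tgt f u v -> H.@[fun m => (chart i j k l m).@[wedge (u 0) (v 0)]] = 0) ->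
  H = 0.
Proof.
move=> uq [r [fr ri gj]]; have [[ij ik il] [jk jl kl]] := uniq4_neq uq.
elim: N H => [|N IH] H HN H0.
  have HE : H = (H@_0%MM)%:MP.
    apply/mpolyP => m; rewrite mcoeffC; have [->|m0] := eqVneq m 0%MM.
      by rewrite mulr1.
    by rewrite mulr0; apply: (dhomog_nemf_coeff HN); rewrite /= mdeg_eq0.
  have [u [v uvt]] := tgt_exists hS.
  by have := H0 u v uvt; rewrite HE mevalC => ->; rewrite mpolyC0.
pose Y := chart i j k l; have Yh m : Y m \is 1.-homog by apply: chart_homog.
pose F := mmap (@mpolyC 6 K) Y H.
have vF : vanishing_forms (hurwitz S) F.
  apply/(vanishing_hurwitzP hS); split; first by exists (1 * N.+1)%N; apply: dhomog_mmap.
  by move=> u v uvt; rewrite /F meval_mmap; apply: H0.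
(* In characteristic zero Euler's relation recovers H from its partial derivatives, whose degree is
   smaller. *)
suff dH0 m : H^`M(m) = 0.
  have := mpoly_euler HN; rewrite big1 => [/esym/eqP|m _]; last by rewrite dH0 mul0r.
  by rewrite scaler_eq0 pnatr_eq0 /= => /eqP.
apply: IH => [|u v uvt]; first exact: mderiv_homog m HN.
rewrite -meval_mmap; move: u v uvt.
apply: (hurwitz_generic hS (H := 'X_i * f^`M(j))).
- by exists (1 + d.-1)%N; apply: dhomogM; [apply: dhomogXU | apply: mderiv_homog].
- exists r; split=> //; first by apply/rV0Pn; exists i.
  by rewrite mevalM mevalXU mulf_neq0.
- by exists (1 * N)%N; apply: dhomog_mmap => //; apply: mderiv_homog HN.
move=> u v0 uv0; rewrite mevalM mevalXU mulf_eq0 negb_or => /andP[ui nj].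
have [v [uvt vi <-]] := tgt_reduce uv0 ui.
have [thu [c [thv _]]] := hurwitz_kernel hS vF uvt.
have [fu uv nv] := uvt.
set p := wedge (u 0) (v 0) in thu thv *.
pose D m := H^`M(m).@[fun a => (Y a).@[p]].
have thE M : dot (grad F p) M = D (inord 0) * pcoord M i k + D (inord 1) * pcoord M i l +
    D (inord 2) * pcoord M i j + D (inord 3) * pcoord M k l.
  rewrite /F dot_grad_mmap ord4_sumE -/(D _); have [Y0 Y1 Y2 Y3] := chartE i j k l.
  congr (_ * _ + _ * _ + _ * _ + _ * _).
  - by rewrite /Y Y0 dot_grad_pform.
  - by rewrite /Y Y1 dot_grad_pform.
  - by rewrite /Y Y2 dot_grad_pform.
  - by rewrite /Y Y3 dot_grad_pform.
rewrite meval_mmap -/(D m).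
suff [? ? ? ?] : [/\ D (inord 0) = 0, D (inord 1) = 0, D (inord 2) = 0 & D (inord 3) = 0].
  by move: m; apply: ord4_ind.
move: (D (inord 0)) (D (inord 1)) (D (inord 2)) (D (inord 3)) thE => D0 D1 D2 D3 thE.
pose n := grad f (u 0); have {}nj : n j != 0 := nj.
(* On y /\ v with y tangent and y_i = v_i = 0 the coordinates p_ik, p_il, p_ij vanish, which
   isolates the coefficient of p_kl. The others are isolated below by u /\ z. *)
have D3v (y : 'rV[K]_4) : dot n (y 0) = 0 -> y 0 i = 0 -> D3 * (y 0 k * v 0 l - y 0 l * v 0 k) = 0.
  move=> ny yi; have := thv (y 0); rewrite ny mulr0 thE !pcoord_wedge vi yi => <-; ring.
have kvE (a b : K) (s t e : 'I_4) : kvec a b s t 0 e = a * (e == s)%:R + b * (e == t)%:R.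
  by rewrite /kvec !mxE eqxx.
have D30 : D3 = 0.
  have [vk|vl] := tgt_coord_neq0 uq uvt vi nj.
    have y1 : dot n (kvec (n j) (- n l) l j 0) = 0 by rewrite dot_kvec; ring.
    have y2 : kvec (n j) (- n l) l j 0 i = 0 by rewrite kvE il ij !mulr0 addr0.
    have := D3v _ y1 y2; rewrite !kvE eqxx kl [k == j]eq_sym jk [l == j]eq_sym jl => E.
    have /eqP : D3 * - (n j * v 0 k) = 0 by rewrite -[RHS]E /=; ring.
    by rewrite mulf_eq0 oppr_eq0 mulf_eq0 (negPf nj) (negPf vk) /= orbF => /eqP.
  have z1 : dot n (kvec (n j) (- n k) k j 0) = 0 by rewrite dot_kvec; ring.
  have z2 : kvec (n j) (- n k) k j 0 i = 0 by rewrite kvE ik ij !mulr0 addr0.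
  have := D3v _ z1 z2; rewrite !kvE eqxx [k == j]eq_sym jk [l == j]eq_sym jl.
  rewrite [l == k]eq_sym kl => E.
  have /eqP : D3 * (n j * v 0 l) = 0 by rewrite -[RHS]E /=; ring.
  by rewrite mulf_eq0 mulf_eq0 (negPf nj) (negPf vl) /= orbF => /eqP.
have Dz (z : 'I_4 -> K) : z i = 0 -> (D0 * z k + D1 * z l + D2 * z j) * u 0 i = 0.
  move=> zi; have := thu z; rewrite thE !pcoord_wedge zi D30 => E; rewrite -[RHS]E; ring.
have uI x : x * u 0 i = 0 -> x = 0.
  by move=> /eqP; rewrite mulf_eq0 (negPf ui) orbF => /eqP.
split=> //; apply: uI.
- have := Dz (fun a => (a == k)%:R); rewrite ik eqxx jk [l == k]eq_sym kl => /(_ erefl) E.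
  by rewrite -[RHS]E /=; ring.
- have := Dz (fun a => (a == l)%:R); rewrite il eqxx jl kl => /(_ erefl) E.
  by rewrite -[RHS]E /=; ring.
- have := Dz (fun a => (a == j)%:R); rewrite ij eqxx ![_ == j]eq_sym jk jl => /(_ erefl) E.
  by rewrite -[RHS]E /=; ring.
Qed.

Lemma trdeg_hurwitz_ge3 : trdeg_ge (hurwitz S) 3.
Proof.
have [r [r0 fr]] := surface_neq0 hS; have [i ri] : exists i, r 0 i != 0 by apply/rV0Pn.
have [j [k [l [uq gj]]]] := frame_at hS fr ri.
pose Y := chart i j k l.
have indep N (H : {mpoly K[4]}) : H \is N.-homog ->
    (forall u v, tgt f u v -> H.@[fun m => (Y m).@[wedge (u 0) (v 0)]] = 0) -> H = 0.
  by apply: chart_indep => //; exists r.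
have Yf m : form (Y m) by exists 1%N; apply: chart_homog.
exists 1%N, (fun m : 'I_3 => Y (lift ord0 m)), (Y ord0); split=> [m||| P P0].
- exact: chart_homog.
- exact: chart_homog.
- apply: contrapT => no; have X0 : ('X_ord0 : {mpoly K[4]}) = 0.
    apply: (indep 1%N) => [|u v uvt]; first exact: dhomogXU.
    rewrite mevalXU; apply: contrapT => /eqP Yuv; apply: no.
    have [fu uv nv] := uvt; have [u0 _] := free2_neq0 uv; have [uL vL] := mem_mkline uv.
    exists (pluecker (mkline uv)).
      apply: subset_closureX; exists (mkline uv) => //.
      by exists (mkproj u0); apply: (tgt_tangent_at hS _ uvt uL vL).
    by apply/eqP => /(form_pluecker (Yf _) uL vL uv)/eqP; rewrite (negPf Yuv).
  have := congr1 (meval (fun=> 1)) X0; rewrite mevalXU meval0 => /eqP.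
  by rewrite oner_eq0.
pose N := msize P.
have PN a : a \in msupp P -> (mdeg a <= N)%N by move=> /msize_mdeg_lt/ltnW.
pose H := hom_sum (msupp P) (fun a => P@_a) id (@mpolyC 4 K) N 'X_ord0
  (fun m : 'I_3 => 'X_(lift ord0 m)).
(* The extra factor covers the lines at which the denominator vanishes; there nothing is known about
   H. *)
have H0 : 'X_ord0 * H = 0.
  apply: (indep (1 + 1 * N)%N) => [|u v uvt].
    by apply: dhomogM; [apply: dhomogXU | apply: hom_sum_homog => // *; apply: dhomogXU].
  pose y m := (Y m).@[wedge (u 0) (v 0)]; rewrite -/y mevalM mevalXU.
  have [->|Y0] := eqVneq (y ord0) 0; first by rewrite mul0r.
  have -> : H.@[y] = hom_sum (msupp P) (fun a => P@_a) id id N (y ord0)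
      (fun m : 'I_3 => y (lift ord0 m)).
    rewrite /H rmorph_hom_sum /= mevalXU; congr hom_sum; apply: funext => a /=.
      by rewrite mevalC.
    by rewrite mevalXU.
  rewrite hom_sum_field // -mpolyE.
  have [fu uv nv] := uvt; have [u0 _] := free2_neq0 uv; have [uL vL] := mem_mkline uv.
  have Xz : hurwitz S (pluecker (mkline uv)).
    apply: subset_closureX; exists (mkline uv) => //.
    by exists (mkproj u0); apply: (tgt_tangent_at hS _ uvt uL vL).
  have wz : wedgev u v \in val (pluecker (mkline uv)) := mem_pluecker uL vL uv.
  have [c wE] := mem_proj_scale wz.
  have c0 : c != 0.
    by apply: contraNneq (wedgev_neq0 uv) => c0; rewrite wE c0 scale0r.
  have yE m : y m = c * (Y m).@[hcoord (pluecker (mkline uv))].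
    rewrite /y -wedgevE wE scale_rowE (meval_homogZ _ _ (chart_homog _ _ _ _ _)) expr1.
    by [].
  have := P0 _ Xz; rewrite !yE in Y0 *; rewrite mulf_eq0 (negPf c0) /= in Y0 *.
  move=> /(_ Y0) E; rewrite mulrA; apply/eqP; rewrite mulf_eq0; apply/orP; right.
  apply/eqP; rewrite -[RHS]E; congr meval; apply: funext => m.
  by rewrite !yE -mulf_div divff // mul1r.
have {}H0 : H = 0.
  by move/eqP: H0; rewrite mulf_eq0 => /orP[/eqP X0|/eqP //];
    have := congr1 (meval (fun=> 1)) X0; rewrite mevalXU meval0 => /eqP;
    rewrite oner_eq0.
have := congr1 (mmap (@mpolyC 3 K) (fun m : 'I_4 => if unlift ord0 m is Some m' then 'X_m' else 1)) H0.
rewrite mmap0 rmorph_hom_sum /= => <-.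
rewrite {1}[P]mpolyE; apply: eq_bigr => a _.
rewrite /= mmapC mmapXU unlift_none expr1n mul1r mul_mpolyC; congr (_ *: _).
rewrite -mmap1_id; apply: mmap1_eq => m.
by rewrite /= mmapXU liftK.
Qed.

End Chart.

(** * Upper bound for the dimension *)

Section UpperBound.
Variables (K : numClosedFieldType) (S : set (proj K 3)) (d : nat) (f : {mpoly K[4]}).
Hypothesis hS : smooth_lineless_surface S d f.
Implicit Types (r u v w : 'rV[K]_4).

Let f_homog : f \is d.-homog. Proof. by case: hS => _ []. Qed.

Lemma off_surface (L : grass_line K) : exists2 v, v \in val L & f.@[v 0] != 0.
Proof.
case: hS => -[_ _ /(_ L) nL] _; apply: contrapT => no; apply: nL => y /mem_pointsE yL.
by apply/(surfaceP hS); apply: contrapT => /eqP fy; apply: no; exists (hvec y).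
Qed.

Lemma off_surface_coord i : exists x : 'I_4 -> K, f.@[x] != 0 /\ x i != 0.
Proof.
have [u [v [_ uv _]]] := tgt_exists hS; have [p _ fp] := off_surface (mkline uv).
pose e a : K := (a == i)%:R.
have nz1 : restr f (p 0) e != 0.
  by apply/eqP => /(congr1 (horner^~ 0)); rewrite restr0 horner0 => /eqP; apply/negP.
have nz2 : restr ('X_i : {mpoly K[4]}) (p 0) e != 0.
  apply/eqP => E; have := congr1 (horner^~ (1 - p 0 i)) E.
  rewrite horner_restr horner0 mevalXU /e eqxx mulr1 addrC subrK => /eqP.
  by rewrite oner_eq0.
have [t] := poly_nonroot (mulf_neq0 nz1 nz2); rewrite hornerM mulf_eq0 negb_or.
rewrite !horner_restr mevalXU => /andP[ft it].
by exists (fun a => p 0 a + t * e a).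
Qed.

Lemma hurwitz_pluecker u v (uv : free [:: u; v]) : tgt f u v ->
  hurwitz S (pluecker (mkline uv)).
Proof.
move=> uvt; have [u0 _] := free2_neq0 uv; have [uL vL] := mem_mkline uv.
apply: subset_closureX; exists (mkline uv) => //.
by exists (mkproj u0); apply: (tgt_tangent_at hS _ uvt uL vL).
Qed.

(* The tangent lines at (1, x_k, x_l, x_j), except the one in the plane of i, l and j,
   are parametrized by the tangent direction with coordinates (1, s) along (k, l); the
   slot z_i of the dehomogenized coordinate stores s. *)
Definition pencil_point (A : comNzRingType) (i : 'I_4) (z : 'I_4 -> A) a :=
  if a == i then 1 else z a.

Definition pencil_dir (A : comNzRingType) (i j k l : 'I_4) (s : A) (n : 'I_4 -> A) a :=
  n j * ((a == k)%:R + s * (a == l)%:R) - (n k + s * n l) * (a == j)%:R.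

Definition pencil (i j k l : 'I_4) : 'I_6 -> {mpoly K[4]} :=
  let X := pencil_point i (fun a => 'X_a) in
  wedge X (pencil_dir i j k l 'X_i (fun a => mmap (@mpolyC 4 K) X f^`M(a))).

Lemma meval_pencil_point i (z : 'I_4 -> K) (F : {mpoly K[4]}) :
  (mmap (@mpolyC 4 K) (pencil_point i (fun a => 'X_a)) F).@[z] = F.@[pencil_point i z].
Proof.
rewrite meval_mmap; congr meval; apply: funext => a; rewrite /pencil_point.
by case: ifP => _; rewrite ?meval1 ?mevalXU.
Qed.

Lemma meval_pencil i j k l (z : 'I_4 -> K) b : (pencil i j k l b).@[z] =
  wedge (pencil_point i z) (pencil_dir i j k l (z i) (grad f (pencil_point i z))) b.
Proof.
rewrite /pencil -[LHS]/(meval z _) wedge_rmorph; congr (wedge _ _ b); apply: funext => a /=.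
  by rewrite /pencil_point; case: ifP => _; rewrite ?meval1 ?mevalXU.
rewrite /pencil_dir mevalB !mevalM !mevalD !mevalM !meval_pencil_point !mevalXU.
by rewrite !rmorph_nat.
Qed.

Lemma pencil_tgt i j k l u v : uniq [:: i; j; k; l] -> tgt f u v ->
  u 0 i != 0 -> grad f (u 0) j != 0 -> pcoord (wedge (u 0) (v 0)) i k != 0 ->
  exists z c, [/\ c != 0, f.@[pencil_point i z] = 0 &
    forall b, (pencil i j k l b).@[z] = c * wedge (u 0) (v 0) b].
Proof.
move=> uq uvt0 ui nj; have [v' [uvt vi <-]] := tgt_reduce hS uvt0 ui.
rewrite pcoord_wedge vi mulr0 subr0 mulf_eq0 negb_or => /andP[_ vk].
have [[ij ik il] [jk jl kl]] := uniq4_neq uq.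
(* The slope stored in slot i is defined because p_ik = u_i v'_k is nonzero. *)
pose z a := if a == i then v' 0 l / v' 0 k else u 0 a / u 0 i.
have xE : pencil_point i z = (fun a => (u 0 i)^-1 * u 0 a).
  apply: funext => a; rewrite /pencil_point /z.
  by have [->|ai] := eqVneq a i; rewrite ?mulVf // mulrC.
have [fu uv nv] := uvt; set n := grad f (u 0) in nj nv.
set q := (u 0 i)^-1 ^+ d.-1.
have q0 : q != 0 by rewrite expf_neq0 // invr_eq0.
exists z, (q * n j / (u 0 i * v' 0 k)); split.
- by rewrite !mulf_neq0 // invr_eq0 mulf_neq0.
- by rewrite xE (meval_homogZ _ _ f_homog) fu mulr0.
move=> b; rewrite meval_pencil xE (grad_homogZ _ _ f_homog) -/n -/q.
have zi : z i = v' 0 l / v' 0 k by rewrite /z eqxx.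
have -> : pencil_dir i j k l (z i) (fun a => q * n a) =
    (fun a => (q * n j / v' 0 k) * v' 0 a).
  apply: funext => a; rewrite /pencil_dir zi.
  have := ord4_mem a uq; rewrite !inE => /or4P[] /eqP ->.
  - by rewrite ik il ij vi /=; ring.
  - rewrite jk jl eqxx; have vjE : n j * v' 0 j = - (n k * v' 0 k + n l * v' 0 l).
      apply/eqP; rewrite -addr_eq0; apply/eqP; rewrite -[RHS]nv /dot (ord4_sum _ uq) vi; ring.
    have -> : q * n j / v' 0 k * v' 0 j = q / v' 0 k * (n j * v' 0 j) by ring.
    by rewrite vjE /=; field.
  - by rewrite eqxx kl [k == j]eq_sym jk /=; field.
  - by rewrite eqxx [l == k]eq_sym kl [l == j]eq_sym jl /=; field.
by rewrite /wedge /=; field; rewrite ui vk.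
Qed.

(** Pulled back along [pencil], the four numerators and the denominator are polynomials in three
    affine coordinates and a slope. Modulo the equation of S only three parameters remain, so a
    relation exists by [algebraic_dependence]. *)
Lemma trdeg_hurwitz_lt4 : ~ trdeg_ge (hurwitz S) 4.
Proof.
move=> [e [F [G [Fe Ge _ indep]]]].
have [r [r0 fr]] := surface_neq0 hS; have [i ri] : exists i, r 0 i != 0 by apply/rV0Pn.
have [j [k [l [uq gj]]]] := frame_at hS fr ri.
pose M := pencil i j k l; pose ev := mmap (@mpolyC 4 K) M.
pose H : {mpoly K[4]} := mmap (@mpolyC 4 K) (pencil_point i (fun a => 'X_a)) f.
have H0 : H != 0.
  have [x [fx xi]] := off_surface_coord i.
  apply/eqP => /(congr1 (meval (fun a => (x i)^-1 * x a))).
  rewrite meval_pencil_point meval0.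
  have -> : pencil_point i (fun a => (x i)^-1 * x a) = (fun a => (x i)^-1 * x a).
    apply: funext => a; rewrite /pencil_point.
    by have [->|//] := eqVneq a i; rewrite mulVf.
  rewrite (meval_homogZ _ _ f_homog) => /eqP.
  by rewrite mulf_eq0 expf_eq0 invr_eq0 (negPf xi) andbF (negPf fx).
have [N [c [Q [[a0 ca0] E]]]] := algebraic_dependence (fun m => ev (F m)) (ev G) H0.
pose s := index_enum {ffun 'I_4 -> 'I_N}.
have le4N a : a \in s -> (mdeg (box_mnm a) <= 4 * N)%N by move=> _; apply: box_mnm_deg.
pose Psi := hom_sum s c (@box_mnm N) (@mpolyC 6 K) (4 * N)%N G F.
have Psi_homog : Psi \is (e * (4 * N)).-homog by apply: hom_sum_homog.
have evPsi : ev Psi = H * Q.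
  rewrite -E /Psi /ev rmorph_hom_sum; congr hom_sum; apply: funext => a.
  by rewrite /= mmapC.
(* [pencil] misses the lines with p_ik = 0, so only this product is seen to vanish. Irreducibility
   then removes [pform K i k], which is not identically zero on CH_1(S). *)
have PsiX : forall u v, tgt f u v -> (Psi * pform K i k).@[wedge (u 0) (v 0)] = 0.
  apply: (hurwitz_generic hS (H := 'X_i * f^`M(j))).
  - by exists (1 + d.-1)%N; apply: dhomogM; [apply: dhomogXU | apply: mderiv_homog].
  - exists r; split=> //; by rewrite mevalM mevalXU mulf_neq0.
  - by exists (e * (4 * N) + 1)%N; apply: dhomogM; rewrite ?pform_homog.
  move=> u v uvt; rewrite !mevalM mevalXU mulf_eq0 negb_or => /andP[ui nj].
  rewrite meval_pform; have [->|pik] := eqVneq (pcoord (wedge (u 0) (v 0)) i k) 0.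
    by rewrite mulr0.
  have [z [t [t0 fz zE]]] := pencil_tgt uq uvt ui nj pik.
  have := congr1 (meval z) evPsi; rewrite mevalM meval_pencil_point fz mul0r meval_mmap.
  rewrite [fun i0 => _](_ : _ = fun b => t * wedge (u 0) (v 0) b); last first.
    by apply: funext => b; apply: zE.
  rewrite (meval_homogZ _ _ Psi_homog) => /eqP.
  by rewrite mulf_eq0 expf_eq0 (negPf t0) andbF => /eqP ->; rewrite mul0r.
have pikX : exists u v (uv : free [:: u; v]), tgt f u v /\ (pform K i k).@[wedge (u 0) (v 0)] != 0.
  apply: contrapT => no.
  have X0 : ('X_ord0 : {mpoly K[4]}) = 0.
    apply: (chart_indep hS uq (N := 1)); [by exists r | exact: dhomogXU |].
    move=> u v uvt; rewrite mevalXU; apply: contrapT => /eqP nz; apply: no.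
    by have [_ uv _] := uvt; exists u, v, uv.
  have := congr1 (meval (fun=> 1)) X0; rewrite mevalXU meval0 => /eqP.
  by rewrite oner_eq0.
have Psi0 y : hurwitz S y -> Psi.@[hcoord y] = 0.
  have [_ irr] := hurwitz_irreducible hS.
  have Pf : form Psi by exists (e * (4 * N))%N.
  have pf : form (pform K i k) by exists 1%N; apply: pform_homog.
  have Z P : form P -> zariski_closed (zero_locus [set P : {mpoly K[6]}]).
    by move=> Pform; exists [set P] => [_ ->|].
  have [|PX|pX] := irr _ _ (Z _ Pf) (Z _ pf); last 2 first.
  - by move=> /PX; apply.
  - have [u [v [uv [uvt]]]] := pikX; have [uL vL] := mem_mkline uv.
    by rewrite (form_pluecker pf uL vL uv).1 ?eqxx //; apply: pX => //; apply: hurwitz_pluecker.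
  move=> x Xx; have vPp : vanishing_forms (hurwitz S) (Psi * pform K i k).
    apply/(vanishing_hurwitzP hS); split=> //.
    by exists (e * (4 * N) + 1)%N; apply: dhomogM; rewrite ?pform_homog.
  have /eqP := vPp.2 x Xx; rewrite mevalM mulf_eq0 => /orP[] /eqP P0; [left|right];
    by move=> _ ->.
have P0 : \sum_(a <- s) c a *: 'X_[box_mnm a] = 0 :> {mpoly K[4]}.
  apply: indep => z Xz Gz.
  have := Psi0 z Xz; rewrite /Psi rmorph_hom_sum => EP.
  have /eqP : hom_sum s c (@box_mnm N) id (4 * N)%N G.@[hcoord z] (fun m => (F m).@[hcoord z]) = 0.
    by rewrite -[RHS]EP; congr hom_sum; apply: funext => a; rewrite /= mevalC.
  by rewrite hom_sum_field // mulf_eq0 expf_eq0 (negPf Gz) andbF => /eqP.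
by move: ca0; rewrite -(mcoeff_box_sum c a0) P0 mcoeff0 eqxx.
Qed.

End UpperBound.

(** * The Hurwitz form *)

Section LinePolynomial.
Variables (R A : comNzRingType).

(** Unlike in [restr], the endpoints lie over the ring A: they depend on the Pluecker coordinates of
    the line or on the parameter of a curve of lines. *)
Definition line_restr n (h : R -> A) (F : {mpoly R[n]}) (p q : 'I_n -> A) : {poly A} :=
  mmap (@polyC A \o h) (fun i => (p i)%:P + 'X * (q i)%:P) F.

Let top k (P : {poly A}) c := (size P <= k.+1)%N /\ P`_k = c.

Let topM k k' P Q c c' : top k P c -> top k' Q c' -> top (k + k') (P * Q) (c * c').
Proof.
move=> [sP <-] [sQ <-]; split.
  apply: leq_trans (size_polyMleq _ _) _; move: (size P) (size Q) sP sQ => a b; lia.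
rewrite coefM (bigD1 (inord k)) //= inordK ?ltnS ?leq_addr // addKn.
rewrite big1 ?addr0 // => -[i /= ilt]; rewrite -val_eqE /= inordK ?ltnS ?leq_addr // => ik.
case: (ltngtP i k) ik => // ik _.
  by rewrite [Q`__]nth_default ?mulr0 // (leq_trans sQ) //; lia.
by rewrite nth_default ?mul0r // (leq_trans sP).
Qed.

Lemma line_restr_top n (h : {rmorphism R -> A}) (F : {mpoly R[n]}) e p q :
  F \is e.-homog -> (size (line_restr h F p q) <= e.+1)%N /\
  (line_restr h F p q)`_e = mmap h q F.
Proof.
move=> /dhomogP Fe; rewrite /line_restr /mmap.
have sumtop (I : eqType) (s : seq I) (P : I -> {poly A}) c :
    (forall m, m \in s -> top e (P m) (c m)) ->
    top e (\sum_(m <- s) P m) (\sum_(m <- s) c m).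
  elim: s => [|m s IH] Ps; first by rewrite !big_nil; split; rewrite ?size_poly0 ?coef0.
  have [sm cm] := Ps m (mem_head _ _).
  have [|ss cs] := IH; first by move=> m' m's; apply: Ps; rewrite inE m's orbT.
  rewrite !big_cons; split; last by rewrite coefD cm cs.
  by apply: leq_trans (size_polyD _ _) _; rewrite geq_max sm.
apply: sumtop => m /Fe /= <-.
have topC c : top 0 c%:P c by rewrite /top size_polyC coefC; split=> //; case: (c != 0).
rewrite -[mdeg m]add0n; apply: topM; first exact: topC.
rewrite mdegE /mmap1; elim/big_rec3: _ => [|i y1 y2 y3 _ IH]; first by rewrite -polyC1.
apply: topM => //; elim: (m i) => [|k IHk]; first by rewrite !expr0 -polyC1.
rewrite !exprS -add1n; apply: topM => //; split.
  apply: leq_trans (size_polyD _ _) _; rewrite geq_max (leq_trans (size_polyC_leq1 _)) //=.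
  by apply: leq_trans (size_polyMleq _ _) _; rewrite size_polyX /= ltnS size_polyC_leq1.
by rewrite coefD coefC coefXM coefC add0r.
Qed.

End LinePolynomial.

Lemma line_restr_homog n k (R : comNzRingType) (F : {mpoly R[n]}) e
    (p q : 'I_n -> {mpoly R[k]}) j :
  F \is e.-homog -> (forall i, p i \is 1.-homog) -> (forall i, q i \is 1.-homog) ->
  (line_restr (@mpolyC k R) F p q)`_j \is e.-homog.
Proof.
move=> /dhomogP Fe p1 q1; pose C s (P : {poly {mpoly R[k]}}) := forall j, P`_j \is s.-homog.
have CM a b P Q : C a P -> C b Q -> C (a + b)%N (P * Q).
  by move=> Pa Qb i; rewrite coefM; apply: rpred_sum => l _; apply: dhomogM.
have CC c : C 0%N (c%:MP)%:P.
  move=> i; rewrite coefC; case: eqP => _; last exact: rpred0.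
  by rewrite -[c%:MP]mulr1 mul_mpolyC rpredZ // dhomog1.
have C1 : C 0%N 1 by move=> i; rewrite coef1; case: eqP => _; [exact: dhomog1 | exact: rpred0].
rewrite /line_restr /mmap big_seq coef_sum; apply: rpred_sum => m /Fe /= <-.
apply: (CM 0%N (mdeg m)); first exact: CC.
rewrite mdegE /mmap1; elim/big_rec2: _ => [//|i y1 y2 _ IH].
apply: (CM) => //; elim: (m i) => [|l IHl]; first by rewrite expr0.
rewrite exprS -add1n; apply: (CM) => // l'.
rewrite coefD coefC coefXM coefC.
by apply: rpredD; case: l' => [|[|l']]; rewrite ?p1 ?q1 ?rpred0.
Qed.

Lemma line_restr_rmorph n (R A B : comNzRingType) (h : {rmorphism R -> A})
    (g : {rmorphism A -> B}) (F : {mpoly R[n]}) p q :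
  map_poly g (line_restr h F p q) = line_restr (g \o h) F (g \o p) (g \o q).
Proof.
rewrite /line_restr.
have -> : (fun i => ((g \o p) i)%:P + 'X * ((g \o q) i)%:P) =
    map_poly g \o (fun i => (p i)%:P + 'X * (q i)%:P).
  by apply: funext => i /=; rewrite rmorphD rmorphM /= !map_polyC map_polyX.
by apply: mmap_rmorph => c /=; rewrite map_polyC.
Qed.

Lemma pcoord_rmorph (A B : comNzRingType) (g : {rmorphism A -> B}) M i j :
  g (pcoord M i j) = pcoord (g \o M) i j.
Proof. by rewrite /pcoord; case: ifP => _ //; case: ifP => _; rewrite ?rmorphN ?rmorph0. Qed.

Lemma papply_rmorph (A B : comNzRingType) (g : {rmorphism A -> B}) M a :
  g \o papply M a = papply (g \o M) (g \o a).
Proof.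
apply: funext => i; rewrite /papply /= rmorph_dot; congr dot.
by apply: funext => j; rewrite /= pcoord_rmorph.
Qed.

Lemma det_homog n k (R : comNzRingType) e (M : 'M[{mpoly R[k]}]_n) :
  (forall i j, M i j \is e.-homog) -> \det M \is (e * n).-homog.
Proof.
move=> Me; rewrite /determinant; apply: rpred_sum => s _; rewrite rpredMsign.
have -> : (e * n = \sum_(i < n) e)%N by rewrite sum_nat_const card_ord mulnC.
by elim/big_rec2: _ => [|i y1 y2 _ IH]; [exact: dhomog1 | apply: dhomogM].
Qed.

Section HurwitzForm.
Variables (R : comNzRingType) (f : {mpoly R[4]}) (d : nat).

(* The discriminant of f on the line parametrized by M a + t M b, multiplied by the
   value of f at M b. *)
Definition hurwitz_form (a b : 'I_4 -> R) : {mpoly R[6]} :=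
  let g := line_restr (@mpolyC 6 R) f (papply (fun k => 'X_k) (@mpolyC 6 R \o a))
    (papply (fun k => 'X_k) (@mpolyC 6 R \o b)) in
  \det (sylvester d.-1 g g^`()).

Lemma mmap_hurwitz_form (A : comNzRingType) (h : {rmorphism R -> A}) a b (M : 'I_6 -> A) :
  let g := line_restr h f (papply M (h \o a)) (papply M (h \o b)) in
  mmap h M (hurwitz_form a b) = \det (sylvester d.-1 g g^`()).
Proof.
move=> g; rewrite /hurwitz_form -det_map_mx map_sylvester -deriv_map.
rewrite line_restr_rmorph !papply_rmorph.
have hX : mmap h M \o (fun k => 'X_k) = M by apply: funext => k; rewrite /= mmapXU.
have hC (c : 'I_4 -> R) : mmap h M \o (@mpolyC 6 R \o c) = h \o c.
  by apply: funext => i; rewrite /= mmapC.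
have hh : mmap h M \o @mpolyC 6 R = h by apply: funext => c; rewrite /= mmapC.
by rewrite hX !hC hh.
Qed.

Lemma papply_homog (c : 'I_4 -> R) i :
  papply (fun k => 'X_k) (@mpolyC 6 R \o c) i \is 1.-homog.
Proof.
apply: rpred_sum => j _; rewrite /= mulrC mul_mpolyC rpredZ //= /pcoord.
case: ifP => _; first exact: dhomogXU.
by case: ifP => _; rewrite ?rpredN ?dhomogXU ?rpred0.
Qed.

Lemma hurwitz_form_homog a b : f \is d.-homog ->
  hurwitz_form a b \is (d * (d.-1 + d.-1.+1)).-homog.
Proof.
move=> fd; apply: det_homog => i j.
rewrite mxE; case: splitP => i' _; rewrite mxE coefMXn; case: ifP => _; rewrite ?rpred0 //.
  by apply: line_restr_homog => // ?; apply: papply_homog.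
by rewrite coef_deriv rpredMn // line_restr_homog // => ?; apply: papply_homog.
Qed.

End HurwitzForm.

Lemma dual_free (K : fieldType) m n (X : m.-tuple 'rV[K]_n) (t : 'I_m -> K) : free X ->
  exists a, forall i : 'I_m, dot (X`_i 0) a = t i.
Proof.
move=> /freeP Xfree; pose B := \matrix_(i < m) X`_i.
have Bfree : row_free B.
  apply/row_freeP; exists (pinvmx B); apply/mulmxVp.
  rewrite -kermx_eq0; apply/rowV0P => c /sub_kermxP cB.
  apply/rowP => i; rewrite mxE; apply: (Xfree (fun i => c 0 i)).
  have := cB; rewrite mulmx_sum_row => E; rewrite -[RHS]E.
  by apply: eq_bigr => l _; rewrite rowK.
pose T : 'cV_m := \col_i t i; exists (fun j => (pinvmx B *m T) j 0) => i.
have : (B *m (pinvmx B *m T)) i 0 = t i by rewrite mulmxA mulmxVp // mul1mx mxE.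
by rewrite mxE => <-; apply: eq_bigr => j _; rewrite [B i j]mxE.
Qed.

Lemma size_deriv_leq (R : nzRingType) (p : {poly R}) m :
  (size p <= m.+1)%N -> (size p^`() <= m)%N.
Proof.
move=> sp; have [->|p0] := eqVneq p 0; first by rewrite deriv0 size_poly0.
by rewrite -ltnS (leq_trans (lt_size_deriv p0)).
Qed.

Lemma horner_deriv_restr (K : numFieldType) n (F : {mpoly K[n]}) (x z : 'I_n -> K) t :
  (restr F x z)^`().[t] = dot (grad F (fun i => x i + t * z i)) z.
Proof.
rewrite deriv_restr -[LHS]/(horner_eval t _) rmorph_dot; congr dot; apply: funext => i /=.
  by rewrite /horner_eval horner_restr.
by rewrite /horner_eval hornerC.
Qed.

(** * The discriminant at tangent lines *)

Section HurwitzSmooth.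
Variables (K : numClosedFieldType) (S : set (proj K 3)) (d : nat) (f : {mpoly K[4]}).
Hypothesis hS : smooth_lineless_surface S d f.
Implicit Types (r u v w : 'rV[K]_4) (L : grass_line K).

Let f_homog : f \is d.-homog. Proof. by case: hS => _ []. Qed.
Let d_gt1 : (1 < d)%N. Proof. by case: hS => _ []. Qed.
Let predd : d.-1.+1 = d. Proof. by rewrite prednK // ltnW. Qed.

Lemma size_restr_surface p q : (size (restr f p q) <= d.-1.+2)%N.
Proof. by rewrite predd; case: (line_restr_top idfun p q f_homog). Qed.

Lemma coef_restr_surface p q : (restr f p q)`_d = f.@[q].
Proof. by case: (line_restr_top idfun p q f_homog). Qed.

Lemma meval_hurwitz_form a b M :
  let g := restr f (papply M a) (papply M b) in
  (hurwitz_form f d a b).@[M] = \det (sylvester d.-1 g g^`()).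
Proof. exact: (mmap_hurwitz_form f d idfun). Qed.

(** The contact point u appears on p + t q at t = -t1/t2, a common root of the restriction and its
    derivative; for t2 = 0 it appears at t = 0 if t1 = 0, and at infinity otherwise, where both
    formal leading coefficients vanish. *)
Lemma hurwitz_form_tgt u v a b : tgt f u v ->
  (hurwitz_form f d a b).@[wedge (u 0) (v 0)] = 0.
Proof.
move=> [fu uv nv]; rewrite meval_hurwitz_form !papply_wedge.
set s1 := dot _ a; set t1 := - dot _ a; set s2 := dot _ b; set t2 := - dot _ b.
set p := fun i => _; set q := fun i => _.
have sg := size_restr_surface p q; have sg' := size_deriv_leq sg.
have root_at t c : (forall i, p i + t * q i = c * u 0 i) -> \det (sylvester d.-1
    (restr f p q) (restr f p q)^`()) = 0.
  move=> /funext E; apply: (sylvester_root sg sg' (t := t)); apply/eqP.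
    by rewrite horner_restr E (meval_homogZ _ _ f_homog) fu mulr0.
  rewrite horner_deriv_restr E (grad_homogZ _ _ f_homog) dotC dotZ dotC.
  by rewrite /q dot_lin nv (grad_self hS) // !mulr0 addr0 mulr0.
have [t20|t20] := eqVneq t2 0; last first.
  apply: (root_at (- t1 / t2) (s1 - t1 / t2 * s2)) => i; rewrite /p /q.
  by field.
have [t10|t10] := eqVneq t1 0.
  by apply: (root_at 0 s1) => i; rewrite /p t10; ring.
apply: sylvester_lead; last apply: size_deriv_leq.
all: rewrite predd; apply/leq_sizeP => j; rewrite leq_eqVlt => /orP[/eqP <-|dj].
all: try by rewrite nth_default // (leq_trans sg) // predd.
all: rewrite coef_restr_surface /q t20.
all: have -> : (fun i => s2 * u 0 i + 0 * v 0 i) = (fun i => s2 * u 0 i) by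
  apply: funext => i; ring.
all: by rewrite (meval_homogZ _ _ f_homog) fu mulr0.
Qed.

Lemma hurwitz_form_vanishing a b : vanishing_forms (hurwitz S) (hurwitz_form f d a b).
Proof.
apply/(vanishing_hurwitzP hS); split; last by move=> u v; apply: hurwitz_form_tgt.
by eexists; apply: hurwitz_form_homog f_homog.
Qed.

(** With a point v of L off S at infinity, the restriction of f has exact degree d, so the vanishing
    discriminant yields a double root, which is a point of tangency. Thus each line of the closure
    is itself tangent. *)
Lemma hurwitz_line L : hurwitz S (pluecker L) ->
  exists u v, [/\ tgt f u v, u \in val L, v \in val L & f.@[v 0] != 0].
Proof.
move=> XL; have [v vL fv] := off_surface hS L.
have v0 : v != 0.
  apply: contraNneq fv => ->; have [u0 [_ [fu0 _ _]]] := tgt_exists hS.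
  have -> : (0 : 'rV[K]_4) 0 = (fun i => 0 * u0 0 i).
    by apply: funext => i; rewrite mxE mul0r.
  by rewrite (meval_homogZ _ _ f_homog) fu0 mulr0.
have [u1 [vu1 u1L]] := free2_exists v0 vL.
have uv1 : free [:: u1; v].
  by rewrite (@perm_free _ _ _ [:: v; u1]) // (perm_catC [:: u1] [:: v]).
(* These covectors are chosen so that contracting u1 /\ v with a and b gives exactly u1 and v. *)
have [a aE] := dual_free (X := [tuple u1; v]) (fun i => (i == lift ord0 ord0)%:R) uv1.
have [b bE] := dual_free (X := [tuple u1; v]) (fun i => - (i == ord0)%:R) uv1.
have [ua va] := (aE ord0, aE (lift ord0 ord0)).
have [ub vb] := (bE ord0, bE (lift ord0 ord0)); rewrite /= in ua va ub vb.
have := (hurwitz_form_vanishing a b).2 _ XL.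
move/(form_pluecker (hurwitz_form_vanishing a b).1 u1L vL uv1).
rewrite meval_hurwitz_form !papply_wedge ua va ub vb.
have -> : (fun i => 1 * u1 0 i + - 0 * v 0 i) = u1 0 by apply: funext => i; ring.
have -> : (fun i => - 0 * u1 0 i + - -1 * v 0 i) = v 0 by apply: funext => i; ring.
set g := restr _ _ _ => det0.
have sg : size g = d.-1.+2.
  apply/eqP; rewrite eqn_leq size_restr_surface predd ltnNge; apply: contra fv => sg.
  by rewrite -(coef_restr_surface (u1 0)) -/g nth_default.
have := det_sylvester0 sg (size_deriv_leq (eq_leq sg)) det0.
move=> /(Pdiv.ClosedField.coprimepP _ _) /existsNP[t /not_implyP[gt /negP]].
rewrite negbK => /eqP g't; exists (u1 + t *: v), v.
have uE : (u1 + t *: v) 0 = (fun i => u1 0 i + t * v 0 i).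
  by apply: funext => i; rewrite !mxE.
split=> //; last by rewrite memvD // memvZ.
split; first by rewrite uE -horner_restr; apply/eqP.
  rewrite free2P; have -> : wedgev (u1 + t *: v) v = wedgev u1 v.
    by apply/rowP => k; rewrite !mxE /wedge !mxE; ring.
  exact: wedgev_neq0.
by rewrite uE -horner_deriv_restr.
Qed.

(** The derivative is taken along the lines (u + s w) /\ v. At s = 0 the restriction of f has the
    double root 0 and no other multiple root, while its constant term f(u + s w) has a simple zero
    in s; [sylvester_simple] then applies. *)
Lemma hurwitz_form_simple u v w : tgt f u v -> f.@[v 0] != 0 ->
  ~~ ('X^3 %| restr f (u 0) (v 0)) ->
  (forall t, t != 0 -> root (restr f (u 0) (v 0)) t -> ~ root (restr f (u 0) (v 0))^`() t) ->
  dot (grad f (u 0)) (w 0) != 0 -> exists a b,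
  dot (grad (hurwitz_form f d a b) (wedge (u 0) (v 0))) (wedge (w 0) (v 0)) != 0.
Proof.
move=> uvt fv nX3 simple nw; have [fu uv nv] := uvt.
have wuv : free [:: w; u; v].
  rewrite free_cons uv andbT; apply: contra nw => /mem_span2[s [t ->]].
  have -> : (s *: u + t *: v) 0 = (fun i => s * u 0 i + t * v 0 i).
    by apply: funext => i; rewrite !mxE.
  by rewrite dot_lin nv (grad_self hS) // !mulr0 addr0.
(* Both covectors kill w, so the contractions give u + s w and v for the whole family of lines. *)
have [a aE] := dual_free (X := [tuple w; u; v]) (fun i => (i == lift ord0 (lift ord0 ord0))%:R) wuv.
have [b bE] := dual_free (X := [tuple w; u; v]) (fun i => - (i == lift ord0 ord0)%:R) wuv.
have [wa ua va] := And3 (aE ord0) (aE (lift ord0 ord0)) (aE (lift ord0 (lift ord0 ord0))).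
have [wb ub vb] := And3 (bE ord0) (bE (lift ord0 ord0)) (bE (lift ord0 (lift ord0 ord0))).
rewrite /= in wa ua va wb ub vb; exists a, b.
set D := hurwitz_form f d a b; set l := wedge (u 0) (v 0).
have DE : restr D l (wedge (w 0) (v 0)) = \det (sylvester d.-1
    (line_restr (@polyC K) f (curve (u 0) (w 0)) (@polyC K \o v 0))
    (line_restr (@polyC K) f (curve (u 0) (w 0)) (@polyC K \o v 0))^`()).
  have curveE : curve l (wedge (w 0) (v 0)) = wedge (curve (u 0) (w 0)) (@polyC K \o v 0).
    apply: funext => k; rewrite /curve /l !wedge_rmorph /wedge /=.
    by move: (polyC _) (polyC _) => *; ring.
  have dotcurve c : dot (curve (u 0) (w 0)) (@polyC K \o c) =
      (dot (u 0) c)%:P + 'X * (dot (w 0) c)%:P.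
    by rewrite !rmorph_dot /dot mulr_sumr -big_split; apply: eq_bigr => i _ /=; rewrite mulrDl mulrA.
  have dotC c : dot (@polyC K \o v 0) (@polyC K \o c) = (dot (v 0) c)%:P by rewrite -rmorph_dot.
  rewrite /restr curveE mmap_hurwitz_form !papply_wedge.
  rewrite !dotcurve !dotC wa ua va wb ub vb polyCN polyC0 polyC1 oppr0 !mulr0 !addr0.
  rewrite ?polyCN ?opprK ?polyC1 ?oppr0.
  have -> : (fun i => 1 * curve (u 0) (w 0) i + 0 * (@polyC K \o v 0) i) = curve (u 0) (w 0).
    by apply: funext => i; rewrite mul1r mul0r addr0.
  have -> : (fun i => 0 * curve (u 0) (w 0) i + 1 * (@polyC K \o v 0) i) = @polyC K \o v 0.
    by apply: funext => i; rewrite mul0r mul1r add0r.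
  by [].
have [m [psi [restrE psi0]]] := tgt_contact hS uvt.
have m0 : m = 0%N.
  case: m restrE nX3 => // m ->; rewrite -(addn1 m) -addnS -addnS addnC exprD.
  by rewrite -mulrA dvdp_mulr.
rewrite {m}m0 in restrE.
set g := line_restr _ f _ _ in DE.
have gE : map_poly (horner_eval 0) g = 'X^2 * psi.
  rewrite -restrE line_restr_rmorph /restr /line_restr.
  have hC (c : 'I_4 -> K) : horner_eval 0 \o (@polyC K \o c) = c.
    by apply: funext => i; rewrite /= /horner_eval hornerC.
  have -> : horner_eval 0 \o curve (u 0) (w 0) = u 0 by apply: curve0.
  by rewrite hC; apply: mmap_eq_fun => c /=; rewrite /horner_eval hornerC.
have g'E : map_poly (horner_eval 0) g^`() = 'X * (2%:R * psi + 'X * psi^`()).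
  rewrite -deriv_map gE derivM derivXn /= expr1 -mulr_natl; ring.
have g0 : g`_0 = restr f (u 0) (w 0).
  rewrite -horner_coef0 /g /line_restr -[LHS]/(horner_eval 0 _).
  rewrite (mmap_rmorph (h' := @polyC K)) => [|c]; last by rewrite /= /horner_eval hornerC.
  congr (mmap _ _ _); apply: funext => i /=.
  by rewrite /horner_eval hornerD hornerC hornerM hornerX mul0r addr0.
have [al alE] : exists al, restr f (u 0) (w 0) = 'X * al.
  by apply: rootX_factor; rewrite restr0.
have al0 : al.[0] = dot (grad f (u 0)) (w 0).
  by rewrite -deriv_restr0 alE derivM derivX !hornerE.
have [be beE] : exists be, (g^`())`_0 = 'X * be.
  apply: rootX_factor; rewrite -[LHS]/(horner_eval 0 _) -coef_map g'E.
  by rewrite coefXM.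
have spsi : size psi = d.-1.
  have : size (restr f (u 0) (v 0)) = d.-1.+2.
    apply/eqP; rewrite eqn_leq size_restr_surface predd ltnNge; apply: contra fv => sg.
    by rewrite -(coef_restr_surface (u 0)) nth_default.
  have nz : psi != 0 by apply: contraNneq psi0 => ->; rewrite horner0.
  by rewrite restrE mulrC size_mulXn // => -[].
set k := 2%:R * psi + 'X * psi^`() in g'E.
have restr'E : (restr f (u 0) (v 0))^`() = 'X * k.
  by rewrite restrE derivM derivXn /= expr1 -mulr_natl /k; ring.
have sk : (size k <= d.-1)%N.
  have := size_deriv_leq (size_restr_surface (u 0) (v 0)); rewrite restr'E.
  have [->|k0] := eqVneq k 0; first by rewrite size_poly0.
  by rewrite mulrC size_mulX.
(* At 0 the value of k is 2 psi(0); a common root elsewhere would be a second multiple root of the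
   restriction. *)
have cop : coprimep ('X * psi) k.
  apply/Pdiv.ClosedField.coprimepP => t; rewrite /root hornerM hornerX mulf_eq0.
  have [->|t0] /= := eqVneq t 0.
    by rewrite /k hornerD !hornerM hornerX mul0r addr0 -polyC_natr hornerC mulf_neq0 ?pnatr_eq0.
  move=> psit; apply/negP => kt; apply: (simple t t0).
    by rewrite /root restrE hornerM mulf_eq0 psit orbT.
  by rewrite /root restr'E hornerM mulf_eq0 kt orbT.
have [|||D1 D1E D10] := sylvester_simple _ _ beE gE g'E spsi sk cop (al := al).
- by rewrite -ltnS predd.
- by rewrite g0.
- by rewrite al0.
by rewrite -deriv_restr0 DE D1E derivM derivX mul1r hornerD hornerM hornerX mul0r addr0.
Qed.

End HurwitzSmooth.

(** * The tangent spaces of the Hurwitz hypersurface *)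

Definition pfaff_form (K : fieldType) : {mpoly K[6]} := pfaff (fun k => 'X_k).

(** Testing against the wedge of two unit vectors isolates, up to sign, the coordinate with the
    complementary index pair. *)
Lemma pfpolar_nondegenerate (K : comNzRingType) (M : 'I_6 -> K) k :
  (forall u v : 'I_4 -> K, pfpolar M (wedge u v) = 0) -> M k = 0.
Proof.
move=> M0; pose de (a i : 'I_4) : K := (i == a)%:R.
have E a b : (a < 4)%N -> (b < 4)%N -> (inord a == inord b :> 'I_4) = (a == b).
  by move=> a4 b4; rewrite -val_eqE /= !inordK.
have ev (a b i j : nat) : (a < 4)%N -> (b < 4)%N -> (i < 4)%N -> (j < 4)%N ->
    pcoord (wedge (de (inord a)) (de (inord b))) (inord i) (inord j) =
    ((i == a) && (j == b))%:R - ((j == a) && (i == b))%:R.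
  by move=> *; rewrite pcoord_wedge /de !E // -!natrM !mulnb.
have H01 := M0 (de (inord 0)) (de (inord 1)); have H02 := M0 (de (inord 0)) (de (inord 2)).
have H03 := M0 (de (inord 0)) (de (inord 3)); have H12 := M0 (de (inord 1)) (de (inord 2)).
have H13 := M0 (de (inord 1)) (de (inord 3)); have H23 := M0 (de (inord 2)) (de (inord 3)).
rewrite /pfpolar !ev //= in H01 H02 H03 H12 H13 H23.
have C := pcoordC M; have diag a : pcoord M a a = 0 by rewrite /pcoord ltnn.
rewrite pcoordE; move: (nth _ _ _).1 (nth _ _ _).2 => i j.
move: (pcoord M) C diag H01 H02 H03 H12 H13 H23 => q C diag H01 H02 H03 H12 H13 H23.
have [c10 c20 c30] := And3 (C (inord 1) (inord 0)) (C (inord 2) (inord 0)) (C (inord 3) (inord 0)).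
have [c21 c31 c32] := And3 (C (inord 2) (inord 1)) (C (inord 3) (inord 1)) (C (inord 3) (inord 2)).
set p01 := q (inord 0) (inord 1) in H01 H02 H03 H12 H13 H23 c10.
set p02 := q (inord 0) (inord 2) in H01 H02 H03 H12 H13 H23 c20.
set p03 := q (inord 0) (inord 3) in H01 H02 H03 H12 H13 H23 c30.
set p12 := q (inord 1) (inord 2) in H01 H02 H03 H12 H13 H23 c21.
set p13 := q (inord 1) (inord 3) in H01 H02 H03 H12 H13 H23 c31.
set p23 := q (inord 2) (inord 3) in H01 H02 H03 H12 H13 H23 c32.
have [p01E p02E p03E] : [/\ p01 = 0, p02 = 0 & p03 = 0].
  move: H23 H13 H12; clear; move: p01 p02 p03 p12 p13 p23 => p01 p02 p03 p12 p13 p23 H23 H13 H12.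
  split; [rewrite -[RHS]H23; ring | apply: oppr_inj; rewrite oppr0 -[RHS]H13; ring
    | rewrite -[RHS]H12; ring].
have [p12E p13E p23E] : [/\ p12 = 0, p13 = 0 & p23 = 0].
  move: H03 H02 H01; clear; move: p01 p02 p03 p12 p13 p23 => p01 p02 p03 p12 p13 p23 H03 H02 H01.
  split; [rewrite -[RHS]H03; ring | apply: oppr_inj; rewrite oppr0 -[RHS]H02; ring
    | rewrite -[RHS]H01; ring].
move: i j; do 2!elim/ord4_ind;
  by rewrite ?diag ?c10 ?c20 ?c30 ?c21 ?c31 ?c32 -?/p01 -?/p02 -?/p03 -?/p12 -?/p13 -?/p23 ?p01E ?p02E ?p03E ?p12E ?p13E ?p23E ?oppr0.
Qed.

(** The values on M1 and M2 form a triangular matrix, so the two functionals are independent. *)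
Lemma kernel_pair_dim (K : fieldType) n (g1 g2 : 'I_n -> K) (M1 M2 : 'rV[K]_n) :
  dot g1 (M1 0) != 0 -> dot g1 (M2 0) = 0 -> dot g2 (M2 0) != 0 ->
  exists U : {vspace 'rV[K]_n}, (\dim U).+2 = n /\
    forall M, (M \in U) = (dot g1 (M 0) == 0) && (dot g2 (M 0) == 0).
Proof.
move=> g11 g12 g22; pose B : 'M[K]_(n, 2) := \matrix_(k, i) if i == 0 then g1 k else g2 k.
have BE (M : 'rV[K]_n) : (M *m B) 0 0 = dot g1 (M 0) /\ (M *m B) 0 (lift 0 0) = dot g2 (M 0).
  by split; rewrite mxE /dot; apply: eq_bigr => k _; rewrite mxE mulrC.
have ord2 (i : 'I_2) : i = 0 \/ i = lift 0 0.
  by case: i => -[|[|?]] // ?; [left | right]; apply: val_inj.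
pose phi : 'Hom('rV[K]_n, 'rV[K]_2) := linfun (mulmxr B).
exists (lker phi); split=> [|M]; last first.
  rewrite memv_ker lfunE /=; have [E1 E2] := BE M.
  apply/eqP/andP => [M0|[/eqP d1 /eqP d2]].
    by rewrite -E1 -E2 M0 !mxE.
  by apply/rowP => i; rewrite [RHS]mxE; case: (ord2 i) => ->; rewrite ?E1 ?E2.
have := limg_ker_dim phi fullv; rewrite capfv.
suff -> : limg phi = fullv by rewrite !dimvf /dim /= !mul1n addn2.
apply/eqP; rewrite eqEsubv subvf /=; apply/subvP => t _.
pose s1 := t 0 0 / dot g1 (M1 0).
pose s2 := (t 0 (lift 0 0) - s1 * dot g2 (M1 0)) / dot g2 (M2 0).
have dE (g : 'I_n -> K) : dot g ((s1 *: M1 + s2 *: M2) 0) = s1 * dot g (M1 0) + s2 * dot g (M2 0).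
  by rewrite -dot_lin; congr dot; apply: funext => k; rewrite !mxE.
have -> : t = phi (s1 *: M1 + s2 *: M2).
  rewrite lfunE /=; have [E1 E2] := BE (s1 *: M1 + s2 *: M2).
  apply/rowP => i; case: (ord2 i) => ->.
    by rewrite E1 dE g12 mulr0 addr0 /s1 divfK.
  by rewrite E2 dE /s2 divfK // addrC subrK.
by apply: memv_img; rewrite memvf.
Qed.

Section Main.
Variables (K : numClosedFieldType) (S : set (proj K 3)) (d : nat) (f : {mpoly K[4]}).
Hypothesis hS : smooth_lineless_surface S d f.
Implicit Types (r u v w : 'rV[K]_4) (L : grass_line K) (F : {mpoly K[6]}).

Let f_homog : f \is d.-homog. Proof. by case: hS => _ []. Qed.
Let d_gt1 : (1 < d)%N. Proof. by case: hS => _ []. Qed.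

Lemma meval_pfaff_form (M : 'I_6 -> K) : (pfaff_form K).@[M] = pfaff M.
Proof.
have E (a b c d' e g : {mpoly K[6]}) : (a * b - c * d' + e * g).@[M] =
    a.@[M] * b.@[M] - c.@[M] * d'.@[M] + e.@[M] * g.@[M].
  by rewrite mevalD mevalB !mevalM.
by rewrite /pfaff_form /pfaff [LHS]E; congr (_ * _ - _ * _ + _ * _); apply: meval_pform.
Qed.

Lemma grad_pfaff_form (M M' : 'I_6 -> K) : dot (grad (pfaff_form K) M) M' = pfpolar M M'.
Proof.
have E (a b c d' e g : {mpoly K[6]}) (D : {mpoly K[6]} -> K) :
    D = (fun F => dot (grad F M) M') ->
    D (a * b - c * d' + e * g) =
    a.@[M] * D b + D a * b.@[M] - c.@[M] * D d' - D c * d'.@[M]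
    + e.@[M] * D g + D e * g.@[M].
  by move=> ->; rewrite !(dot_gradPD, dot_gradN) !dot_gradM; ring.
rewrite /pfaff_form /pfaff [LHS](E _ _ _ _ _ _ _ erefl).
by congr (_ * _ + _ * _ - _ * _ - _ * _ + _ * _ + _ * _);
  first [apply: meval_pform | apply: dot_grad_pform].
Qed.

Lemma pfaff_form_vanishing : vanishing_forms (hurwitz S) (pfaff_form K).
Proof.
apply/(vanishing_hurwitzP hS); split=> [|u v _]; last by rewrite meval_pfaff_form pfaff_wedge.
by exists (1 + 1)%N; apply: rpredD; [apply: rpredB|]; apply: dhomogM; apply: pform_homog.
Qed.

(** [grass_Sing] refers to an image in P^5, whereas [hurwitz] is a closure there. Every point of the
    closure is a line, because the Pfaffian vanishes on it. *)
Lemma hurwitz_image : @pluecker K @` CH1 S = hurwitz S.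
Proof.
apply/seteqP; split=> [_ [L XL <-]//|p Xp].
have [|L LE] := pluecker_surj (p := p); last by exists L => //; rewrite /CH1 /grass_closure /= LE.
by rewrite -meval_pfaff_form; apply: pfaff_form_vanishing.2.
Qed.

Lemma hurwitz_local_dim (p : proj K 5) : hurwitz S p -> local_dim (hurwitz S) p 3.
Proof.
move=> Xp; apply: local_dim_irreducible => //.
- exact: closure_closed.
- exact: hurwitz_irreducible hS.
- by split; [apply: (trdeg_hurwitz_ge3 hS) | apply: (trdeg_hurwitz_lt4 hS)].
Qed.

Lemma hurwitz_tangent_space L u v (y : proj K 5) (M : 'rV[K]_6) :
  u \in val L -> v \in val L -> free [:: u; v] -> M != 0 -> M \in val y ->
  tangent_space (hurwitz S) (pluecker L) y <->
  (forall F, vanishing_forms (hurwitz S) F -> dot (grad F (wedge (u 0) (v 0))) (M 0) = 0).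
Proof.
move=> uL vL uv M0 My; rewrite -wedgevE; have l0 := wedgev_neq0 uv.
have lL := mem_pluecker uL vL uv.
by split=> H F vF; have := H F vF; move/(form_grad_eval vF.1 l0 lL M0 My).
Qed.

Definition full_tangent L := forall u v F (z : 'I_4 -> K),
  u \in val L -> v \in val L -> free [:: u; v] -> vanishing_forms (hurwitz S) F ->
  dot (grad F (wedge (u 0) (v 0))) (wedge (u 0) z) = 0.

Lemma full_tangent_singular L : full_tangent L -> ~ smooth_at (hurwitz S) (pluecker L).
Proof.
move=> fullL [Xp [m [U [dimX TU dU]]]].
have m3 := local_dim_uniq (hurwitz_local_dim Xp) dimX.
have [u [v [uv LE]]] := line_basis L.
have [uL vL] : u \in val L /\ v \in val L.
  by rewrite LE; split; apply: memv_span; rewrite !inE eqxx ?orbT.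
have [b [c /wedgev_basis bas]] := basis_extend2 uv.
have inU (M : 'rV[K]_6) : M != 0 -> (forall F, vanishing_forms (hurwitz S) F ->
    dot (grad F (wedge (u 0) (v 0))) (M 0) = 0) -> M \in U.
  move=> M0 HM; have /subvP : points U (mkproj M0).
    by rewrite -TU; apply/(hurwitz_tangent_space uL vL uv M0 (mem_mkproj M0)).
  by apply; apply: mem_mkproj.
have vu : free [:: v; u].
  by rewrite (@perm_free _ _ _ [:: u; v]) // (perm_catC [:: v] [:: u]).
have fu z : wedgev u z != 0 -> wedgev u z \in U.
  by move=> nz; apply: inU => // F vF; rewrite wedgevE; apply: fullL.
have fv z : wedgev v z != 0 -> wedgev v z \in U.
  move=> nz; apply: inU => // F vF; rewrite wedgevE.
  have := fullL v u F (z 0) vL uL vu vF; rewrite [wedge (v 0) (u 0)]wedgeC.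
  have [e Fe] := vF.1; rewrite (grad_homogZ _ _ Fe) dotC dotZ dotC => /eqP.
  by rewrite mulf_eq0 expf_eq0 oppr_eq0 oner_eq0 andbF => /eqP.
have freeX : free [:: wedgev u v; wedgev u b; wedgev u c; wedgev v b; wedgev v c].
  apply: (@catl_free _ _ [:: wedgev b c]); exact: basis_free bas.
have /dimvS : (<<[:: wedgev u v; wedgev u b; wedgev u c; wedgev v b; wedgev v c]>> <= U)%VS.
  apply/span_subvP => M MX; have M0 := free_not0 freeX MX.
  by move: MX M0; rewrite !inE => /or4P[/eqP->|/eqP->|/eqP->|/orP[/eqP->|/eqP->]];
    [exact: fu|exact: fu|exact: fu|exact: fv|exact: fv].
by rewrite (eqP freeX) dU -m3.
Qed.

(** The condition for one basis of L, which is what tangency and inflection provide;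
    [full_tangent_closure] turns it into the condition for all bases, also at limit lines. *)
Definition full_tangent_basis u v := forall F (z : 'I_4 -> K),
  vanishing_forms (hurwitz S) F ->
  dot (grad F (wedge (u 0) (v 0))) (wedge (u 0) z) = 0 /\
  dot (grad F (wedge (u 0) (v 0))) (wedge (v 0) z) = 0.

(* A bilinear reformulation of full_tangent by forms on P^5, which makes it a closed
   condition. *)
Definition move_form F (a b : 'I_4 -> K) : {mpoly K[6]} :=
  dot (fun k => F^`M(k)) (wedge (papply (fun k => 'X_k) (@mpolyC 6 K \o a)) (@mpolyC 6 K \o b)).

Lemma meval_move_form F a b M :
  (move_form F a b).@[M] = dot (grad F M) (wedge (papply M a) b).
Proof.
rewrite /move_form rmorph_dot; congr dot; apply: funext => k /=.
rewrite -[LHS]/(meval M _) wedge_rmorph papply_rmorph.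
have hC (c : 'I_4 -> K) : meval M \o (@mpolyC 6 K \o c) = c.
  by apply: funext => i; rewrite /= mevalC.
have hX : meval M \o (fun k => 'X_k) = M by apply: funext => i; rewrite /= mevalXU.
by rewrite !hC hX.
Qed.

Lemma move_form_form F a b : form F -> form (move_form F a b).
Proof.
move=> [e Fe]; exists (e.-1 + (1 + 0))%N; apply: rpred_sum => k _.
apply: dhomogM; first exact: mderiv_homog.
have C0 i : (@mpolyC 6 K \o b) i \is 0.-homog.
  by rewrite /= -[(b i)%:MP]mulr1 mul_mpolyC rpredZ // dhomog1.
by apply: rpredB; apply: dhomogM => //; apply: papply_homog.
Qed.

Lemma meval_move_form_eq0 u v : full_tangent_basis u v ->
  forall F a b, vanishing_forms (hurwitz S) F ->
  (move_form F a b).@[wedge (u 0) (v 0)] = 0.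
Proof.
move=> H F a b vF; rewrite meval_move_form papply_wedge wedge_linl dot_lin.
by have [-> ->] := H F b vF; rewrite !mulr0 addr0.
Qed.

Lemma full_tangent_closure (A : set (grass_line K)) :
  (forall L, A L -> exists u v, [/\ u \in val L, v \in val L, free [:: u; v] &
    full_tangent_basis u v]) ->
  forall L, grass_closure A L -> full_tangent L.
Proof.
move=> HA L /closureP cL u v F z uL vL uv vF.
(* With a(u) = 0 and a(v) = 1, the contraction of u /\ v is u. *)
have [a aE] := dual_free (X := [tuple u; v]) (fun i => (i == lift ord0 ord0)%:R) uv.
have [ua va] := (aE ord0, aE (lift ord0 ord0)); rewrite /= in ua va.
have mf := move_form_form a z vF.1.
have /cL : vanishing_forms (@pluecker K @` A) (move_form F a z).
  split=> // _ [L' AL' <-]; have [u' [v' [uL' vL' uv' H']]] := HA L' AL'.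
  by apply/(form_pluecker mf uL' vL' uv'); apply: (meval_move_form_eq0 H').
move/(form_pluecker mf uL vL uv); rewrite meval_move_form papply_wedge ua va => E.
by rewrite -[RHS]E; congr (dot _ (wedge _ _)); apply: funext => i; ring.
Qed.

(** Each of the two contact points contributes its own half: the differential kills x /\ K^4 and, by
    exchanging the roles, y /\ K^4. The change of sign of the Pluecker vector is absorbed by
    homogeneity. *)
Lemma bitangent_full L x y : x <> y -> tangent_at S L x -> tangent_at S L y ->
  exists u v, [/\ u \in val L, v \in val L, free [:: u; v] &
    full_tangent_basis u v].
Proof.
move=> xy [[Sx _] xL LTx] [[Sy _] yL LTy].
have nxy := (tangent_spaceP hS y Sx).1 (LTx y yL).
have nyx := (tangent_spaceP hS x Sy).1 (LTy x xL).
move/mem_pointsE: xL => xL; move/mem_pointsE: yL => yL.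
have xyf : free [:: hvec x; hvec y].
  rewrite free_cons span_seq1 free_cons nil_free andbT span_nil memv0 hvec_neq0 andbT.
  by apply/negP => yx; apply: xy; apply: proj_eq; rewrite hvec_line.
have yxf : free [:: hvec y; hvec x].
  by rewrite (@perm_free _ _ _ [:: hvec x; hvec y]) // (perm_catC [:: hvec y] [:: hvec x]).
exists (hvec x), (hvec y); split=> // F z vF; split.
  have txy : tgt f (hvec x) (hvec y) by split=> //; apply/(surfaceP hS).
  by have [] := hurwitz_kernel hS vF txy.
have tyx : tgt f (hvec y) (hvec x) by split=> //; apply/(surfaceP hS).
have [+ _] := hurwitz_kernel hS vF tyx; move=> /(_ z).
rewrite [wedge (hvec y 0) (hvec x 0)]wedgeC.
have [e Fe] := vF.1; rewrite (grad_homogZ _ _ Fe) dotC dotZ dotC => /eqP.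
by rewrite mulf_eq0 expf_eq0 oppr_eq0 oner_eq0 andbF => /eqP.
Qed.

Lemma inflection_tgt L x : meets_with_mult L S x 3 ->
  exists v, [/\ tgt f (hvec x) v, hvec x \in val L, v \in val L
    & 'X^3 %| restr f (hvec x 0) (v 0)].
Proof.
move=> [Sx /mem_pointsE xL mult].
have [v [xv vL]] := free2_exists (hvec_neq0 x) xL.
have X3 : 'X^3 %| restr f (hvec x 0) (v 0).
  have vf : vanishing_forms S f by case: hS => _ [_ _ /(_ f)[|_]]; [exists d | apply; exists 1; rewrite mul1r].
  have := mult f v vf vL; congr (_ %| _); apply: mmap_ext => i.
  by rewrite /curve mulrC mul_polyC.
exists v; split=> //; split=> //; first exact/(surfaceP hS).
have /dvdpP[q qE] := X3; rewrite -deriv_restr0 qE exprS derivM !hornerD !hornerM.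
by rewrite derivM derivX !hornerE /= !(mulr0, mul0r, addr0) // hornerXn expr0n mulr0 mul0r addr0.
Qed.

(** Here a single contact point suffices: third-order contact makes the constant [c] of
    [hurwitz_kernel] vanish, which frees v /\ K^4. *)
Lemma inflection_full L x : meets_with_mult L S x 3 ->
  exists u v, [/\ u \in val L, v \in val L, free [:: u; v] &
    full_tangent_basis u v].
Proof.
move=> /inflection_tgt[v [xv xL vL X3]]; exists (hvec x), v.
split=> //; first by case: xv.
move=> F z vF; have [thx [c [thc c0]]] := hurwitz_kernel hS vF xv; split=> //.
by rewrite [wedge (v 0) z]wedgeC dotZ thc c0 // mul0r mulr0.
Qed.

(** This is s^d f(u + (t/s) v) with polynomials s and t, checked pointwise; the factor s disposes of
    the zeros of s. It is needed because [meets_with_mult] lets the direction range over all of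
    L. *)
Lemma mmap_line_comb (u v : 'I_4 -> K) (s t : {poly K}) : s != 0 ->
  mmap (@polyC K) (fun i => s * (u i)%:P + t * (v i)%:P) f =
  \sum_(k < d.+1) (restr f u v)`_k *: (t ^+ k * s ^+ (d - k)).
Proof.
move=> s0; apply/eqP; rewrite -subr_eq0.
suff /eqP : s * (mmap (@polyC K) (fun i => s * (u i)%:P + t * (v i)%:P) f -
    \sum_(k < d.+1) (restr f u v)`_k *: (t ^+ k * s ^+ (d - k))) = 0.
  by rewrite mulf_eq0 (negPf s0).
apply: poly_horner0 => z; rewrite hornerM.
have [->|sz] := eqVneq s.[z] 0; first by rewrite mul0r.
rewrite hornerD hornerN horner_mmap; apply/eqP; rewrite mulf_eq0 (negPf sz) /=.
rewrite subr_eq0; apply/eqP.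
have -> : (fun i => (s * (u i)%:P + t * (v i)%:P).[z]) =
    (fun i => s.[z] * (u i + (t.[z] / s.[z]) * v i)).
  by apply: funext => i; rewrite !hornerE; field.
rewrite (meval_homogZ _ _ f_homog) -horner_restr.
have szr : (size (restr f u v) <= d.+1)%N.
  by have := size_restr_surface hS u v; rewrite prednK // ltnW.
rewrite (horner_coef_wide _ szr) mulr_sumr horner_sum; apply: eq_bigr => k _.
rewrite hornerZ hornerM !horner_exp exprMn exprVn.
rewrite mulrCA; congr (_ * _); rewrite mulrCA; congr (_ * _).
by rewrite -{1}(subnK (ltnSE (ltn_ord k))) exprD mulfK // expf_neq0.
Qed.

Lemma inflection_meets L u v (u0 : u != 0) : tgt f u v -> u \in val L -> v \in val L ->
  'X^3 %| restr f (u 0) (v 0) -> meets_with_mult L S (mkproj u0) 3.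
Proof.
move=> uvt uL vL X3; have [fu uv _] := uvt.
have Su : S (mkproj u0) by apply/(surface_memP hS u0 (mem_mkproj u0)).
have /vlineP[c hE] : hvec (mkproj u0) \in <[u]>%VS := memv_pick _.
have c0 : c != 0 by apply: contraNneq (hvec_neq0 (mkproj u0)) => c0; rewrite hE c0 scale0r.
split=> // F q vF.
rewrite (line_span uL vL uv) => /mem_span2[al [be ->]].
have [G ->] : exists G, F = G * f.
  by case: hS => _ [_ _ /(_ F vF.1)[H _]]; apply: H.
rewrite rmorphM /= dvdp_mull //.
(* For q = al u + be v and the representative c u of the point, the curve is s u + t v. The terms of
   index below 3 vanish by [X3], and the others contain t^3. *)
pose s : {poly K} := c%:P + al *: 'X; pose t : {poly K} := be *: 'X.
rewrite (mmap_ext _ (Y' := fun i => s * (u 0 i)%:P + t * (v 0 i)%:P)) => [|i].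
  have s0 : s != 0.
    apply: contraNneq c0 => /(congr1 (horner^~ 0)).
    by rewrite /s !hornerE ?mulr0 ?addr0 => ->.
  rewrite mmap_line_comb //; have /dvdpP[p pE] := X3.
  apply: (big_ind (fun r : {poly K} => is_true ('X^3 %| r))) => [|r r' *|k _]; [exact: dvdp0|exact: dvdp_add|].
  rewrite pE coefMXn; case: ltnP => k3; first by rewrite scale0r dvdp0.
  rewrite -mul_polyC dvdp_mull // dvdp_mulr // /t -mul_polyC exprMn dvdp_mull //.
  by rewrite -(subnK k3) exprD dvdp_mull.
rewrite -[hcoord _ i]/(hvec (mkproj u0) 0 i) hE !mxE /s /t -!mul_polyC !polyCD !polyCM.
by ring.
Qed.

(* The tangent space is the common kernel of the differentials of the Pfaffian and of
   the Hurwitz form. *)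
Lemma hurwitz_smooth L : hurwitz S (pluecker L) ->
  ~ (exists x y, [/\ x <> y, tangent_at S L x & tangent_at S L y]) ->
  ~ (exists2 x, smooth_at S x & meets_with_mult L S x 3) ->
  smooth_at (hurwitz S) (pluecker L).
Proof.
move=> XL nbit ninf; have [u [v [uvt uL vL fv]]] := hurwitz_line hS XL.
have [fu uv nv] := uvt; have [u0 _] := free2_neq0 uv.
have nX3 : ~~ ('X^3 %| restr f (u 0) (v 0)).
  apply/negP => X3; apply: ninf; exists (mkproj u0).
    by apply: (smooth_surface_at hS); apply/(surface_memP hS u0 (mem_mkproj u0)).
  exact: inflection_meets uvt uL vL X3.
have simple t : t != 0 -> root (restr f (u 0) (v 0)) t -> ~ root (restr f (u 0) (v 0))^`() t.
  move=> t0 /eqP ft /eqP f't; apply: nbit.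
  pose y := u + t *: v.
  have yE : y 0 = (fun i => u 0 i + t * v 0 i) by apply: funext => i; rewrite !mxE.
  have yvt : tgt f y v.
    split; first by rewrite yE -horner_restr.
      rewrite free2P; have -> : wedgev y v = wedgev u v.
        by apply/rowP => k; rewrite !mxE /wedge yE; ring.
      exact: wedgev_neq0.
    by rewrite yE -horner_deriv_restr.
  have [_ yv _] := yvt; have [y0 _] := free2_neq0 yv.
  have yL : y \in val L by rewrite memvD // memvZ.
  exists (mkproj u0), (mkproj y0); split; [|exact: (tgt_tangent_at hS _ uvt)|exact: (tgt_tangent_at hS _ yvt)].
  move=> uy; have := mem_mkproj y0; rewrite -uy => /vlineP[s yu].
  have := wedgev_neq0 uv; have -> : wedgev u v = t^-1 *: wedgev u y.
    by apply/rowP => k; rewrite !mxE /wedge yE; field.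
  have -> : wedgev u y = 0.
    by rewrite yu; apply/rowP => k; rewrite !mxE /wedge !mxE; ring.
  by rewrite scaler0 eqxx.
have [w nw] := grad_neq0 hS u0 fu.
have [a [b Dw]] := hurwitz_form_simple hS uvt fv nX3 simple nw.
set D := hurwitz_form f d a b in Dw; have vD : vanishing_forms (hurwitz S) D.
  exact: hurwitz_form_vanishing hS a b.
set l := wedge (u 0) (v 0) in Dw.
have [Du [c [Dv _]]] := hurwitz_kernel hS vD uvt; rewrite -/l in Du Dv.
have c0 : c != 0 by apply: contraNneq Dw => c0; rewrite Dv c0 mul0r.
have [b1 [b2 bas]] := basis_extend2 uv.
pose g1 := grad (pfaff_form K) l; pose g2 := grad D l.
have g1E M : dot g1 M = pfpolar l M by apply: grad_pfaff_form.
have pfu z : dot g1 (wedge (u 0) z) = 0 by rewrite g1E /l pfpolar_wedge.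
have pfv z : dot g1 (wedge (v 0) z) = 0.
  have [->|] := eqVneq (dot g1 (wedge (v 0) z)) 0; first by [].
  by rewrite g1E /l /pfpolar !pcoord_wedge; case/eqP; ring.
have dotcomb (g : 'I_6 -> K) p q s : dot g ((wedgev u p + wedgev v q + s *: wedgev b1 b2) 0) =
    dot g (wedge (u 0) (p 0)) + dot g (wedge (v 0) (q 0)) + s * dot g (wedgev b1 b2 0).
  rewrite -[dot g (wedge (u 0) _)]mul1r -[dot g (wedge (v 0) _)]mul1r -!wedgevE.
  rewrite /dot !mulr_sumr -!big_split; apply: eq_bigr => k _ /=; rewrite !mxE; ring.
(* The polar form of the Pfaffian at l kills L /\ K^4; if it killed the complement too, it would be
   zero, against its nondegeneracy. *)
have g1b : dot g1 (wedgev b1 b2 0) != 0.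
  apply/eqP => g10; have := wedgev_neq0 uv; case/negP; apply/eqP/rowP => k.
  have all0 (M : 'rV[K]_6) : pfpolar l (M 0) = 0.
    have [p [q [s ->]]] := wedgev_decomp M bas.
    by rewrite -g1E dotcomb pfu pfv g10 mulr0 !addr0.
  rewrite !mxE; apply: pfpolar_nondegenerate => x y.
  pose xr : 'rV[K]_4 := \row_i x i; pose yr : 'rV[K]_4 := \row_i y i.
  have -> : wedge x y = wedgev xr yr 0.
    by rewrite wedgevE; congr wedge; apply: funext => i; rewrite mxE.
  exact: all0.
have [||U [dU UE]] := kernel_pair_dim g1b (M2 := wedgev w v) (g2 := g2).
- by rewrite wedgevE [wedge _ _]wedgeC dotZ pfv mulr0.
- by rewrite wedgevE.
split=> //; exists 3%N, U; split; [exact: hurwitz_local_dim | | by case: dU].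
apply/seteqP; split=> y.
  move=> Ty; apply/mem_pointsE; rewrite UE; apply/andP; split; apply/eqP.
    apply: ((hurwitz_tangent_space uL vL uv (hvec_neq0 y) (memv_pick _)).1 Ty).
    exact: pfaff_form_vanishing.
  exact: ((hurwitz_tangent_space uL vL uv (hvec_neq0 y) (memv_pick _)).1 Ty).
(* The two equations leave u /\ p + v /\ q with q tangent to S at u, and by [hurwitz_kernel] every
   vanishing form has a differential that kills these bivectors. *)
move=> /mem_pointsE; rewrite UE => /andP[/eqP d1 /eqP d2].
apply/(hurwitz_tangent_space uL vL uv (hvec_neq0 y) (memv_pick _)) => F vF.
have [p [q [s yE]]] := wedgev_decomp (hvec y) bas.
have s0 : s = 0.
  move/eqP: d1; rewrite yE dotcomb pfu pfv !add0r mulf_eq0 (negPf g1b) orbF.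
  by move/eqP.
have nq : dot (grad f (u 0)) (q 0) = 0.
  move/eqP: d2; rewrite yE dotcomb s0 mul0r addr0 Du add0r.
  rewrite [wedge (v 0) _]wedgeC dotZ Dv mulN1r oppr_eq0 mulf_eq0 (negPf c0).
  by move/eqP.
have [Fu [c' [Fv _]]] := hurwitz_kernel hS vF uvt.
rewrite yE dotcomb s0 mul0r addr0 Fu add0r [wedge (v 0) _]wedgeC dotZ.
by rewrite Fv nq !mulr0.
Qed.

End Main.

Theorem theorem4p1 (R : realType) (S : set (proj R[i] 3)) (d : nat)
  (hS : irreducible_surface S) (hsmooth : smooth_surface S)
  (hdeg : surface_degree S d) (hd : (4 <= d)%N)
  (hlines : contains_no_line S) :
  grass_Sing (CH1 S) = Bit S `|` Infl S.
Proof.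
have [f [_ fd f_gen]] := hdeg.
have good : smooth_lineless_surface S d f.
  by split; split=> //; apply: leq_trans hd.
have imE := hurwitz_image good.
apply/seteqP; split=> L; rewrite /grass_Sing /= imE.
  move=> [XL nsm]; apply: contrapT => /not_orP[nbit ninf]; apply: nsm.
  apply: (hurwitz_smooth good XL) => [[x [y bit]]|[x sx inf]].
    by apply: nbit; apply: subset_closureX; exists L => //; exists x, y.
  by apply: ninf; apply: subset_closureX; exists L => //; exists x.
have sub (A : set (grass_line R[i])) : A `<=` @tangent_lines R[i] S ->
    grass_closure A `<=` [set L | hurwitz S (pluecker L)].
  move=> AT L' cL' Z cZ TZ; apply: cL' => // _ [L1 AL1 <-].
  by apply: TZ; exists L1 => //; apply: AT.
case=> cL; split.
- by apply: sub cL => L1 [x [y [_ tx _]]]; exists x.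
- apply: (full_tangent_singular good); apply: (full_tangent_closure _ cL).
  by move=> L1 [x [y [xy tx ty]]]; apply: (bitangent_full good xy tx ty).
(* Contact of order 3 includes tangency, so Infl(S) lies in CH_1(S). *)
- apply: sub cL => L1 [x sx inf]; exists x.
  have [v [xv xL vL _]] := inflection_tgt good inf.
  have [_ xvf _] := xv; have [x0 _] := free2_neq0 xvf.
  have := tgt_tangent_at good x0 xv xL vL; congr (tangent_at _ _ _).
  by apply/esym/proj_eq; apply: memv_line.
- apply: (full_tangent_singular good); apply: (full_tangent_closure _ cL).
  by move=> L1 [x sx inf]; apply: (inflection_full good inf).
Qed.
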